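(* Let $p,q\ge2$ be integers and suppose $(\beta,h)\in\Theta$ is special. Assume $h$ is known and $\boldsymbol X\sim\mathbb P_{\beta,h,N}$. Let $\boldsymbol m_*=\boldsymbol x_s$ be the unique maximizer of $H_{\beta,h}$, and let $\hat\beta_N$ be the maximum likelihood estimator of $\beta$. For type-I special $(\beta,h)$ let $T_{\bar\beta,\bar h}$ be a random variable with density at $x$ proportional to $\exp\left(\frac{x^4}{24}q^4f^{(4)}_{\beta,h}(s)+\left(\bar\beta p\langle\boldsymbol m_*^{p-1},\boldsymbol u\rangle+\bar h(1-q)\right)x\right)$ with $\boldsymbol u=(1-q,1,\dots,1)$, and let $F_{\bar\beta,\bar h}$ be its distribution function. Let $F_0$ be a random variable with density proportional to $\exp\left(-\frac{32}{15}x^6\right)$. (1) If $(\beta,h)$ is type-I special then, as $N\to\infty$: - if $(p,q)\notin\{(2,2),(3,2)\}$, then $N^{3/4}(\hat\beta_N-\beta)\xrightarrow{D}L_1$, where the distribution function of $L_1$ is $$L_1(t)=F_{0,0}\left(-\int_{-\infty}^\infty u\,\mathrm dF_{t,0}(u)\right);$$ - if $(p,q)=(2,2)$ or $(p,q)=(3,2)$, then $N^{3/4}(\hat\beta_N-\beta)\xrightarrow{D}\alpha\delta_{-\infty}+(1-\alpha)\delta_\infty$, where $\alpha:=\mathbb P\left(T_{0,0}^2\le\mathbb E\,T_{0,0}^2\right)$. (2) If $(\beta,h)$ is type-II special then, as $N\to\infty$, $$N^{5/6}(\hat\beta_N-\beta)\xrightarrow{D}\gamma_2\delta_{-\infty}+(1-\gamma_2)\delta_\infty,\qquad\gamma_2:=\mathbb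 P\left(F_0^2\le\mathbb E F_0^2\right).$$
   Context: For real $\beta,h$ and $N\ge1$, $\mathbb P_{\beta,h,N}$ is the probability measure on $\{1,\dots,q\}^N$ with $\mathbb P_{\beta,h,N}(\boldsymbol X)\propto\exp\left(\beta N\sum_{r=1}^q\bar X_{\cdot r}^p+Nh\bar X_{\cdot1}\right)$, where $\bar X_{\cdot r}=N^{-1}\#\{i:X_i=r\}$; $\bar{\boldsymbol X}_N=(\bar X_{\cdot1},\dots,\bar X_{\cdot q})^\top$, $\|\bar{\boldsymbol X}_N\|_p^p=\sum_r\bar X_{\cdot r}^p$, and $\mathbb E_{\beta,h,N}$ is the expectation. $\Theta=(0,\infty)\times[0,\infty)$. For known $h$ and one sample $\boldsymbol X$, $\hat\beta_N$ maximizes the likelihood $\beta'\mapsto\mathbb P_{\beta',h,N}(\boldsymbol X)$ over $\beta'\in\mathbb R$; equivalently it is the solution in $\beta'$ of $\mathbb E_{\beta',h,N}(\|\bar{\boldsymbol X}_N\|_p^p)=\|\bar{\boldsymbol X}_N\|_p^p$ (the left side is strictly increasing in $\beta'$; if there is no finite solution, $\hat\beta_N=\pm\infty$ according to where the supremum of the likelihood is approached). On the set $\mathcal P_q$ of probability vectors in $\mathbb R^q$, $H_{\beta,h}(\boldsymbol t)=\beta\sum_r t_r^p+ht_1-\sum_r t_r\log t_r$. For $s\in[0,1]$, $\boldsymbol x_s=\left(\frac{1+(q-1)s}{q},\frac{1-s}{q},\dots,\frac{1-s}{q}\right)$ and $f_{\beta,h}(s)=H_{\beta,h}(\boldsymbol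 x_s)$. A unique global maximizer of $H_{\beta,h}$ is of the form $\boldsymbol x_s$, $s\in[0,1)$. With $\boldsymbol Q_{\boldsymbol v,\beta}(\boldsymbol t)=\sum_{r=1}^q\left(\beta p(p-1)v_r^{p-2}-\frac1{v_r}\right)t_r^2$ and $\mathcal H_q=\{\boldsymbol t\in\mathbb R^q:\sum_r t_r=0\}$, the point $(\beta,h)$ is special if $H_{\beta,h}$ has a unique global maximizer $\boldsymbol m_*=\boldsymbol x_s$ and $\boldsymbol Q_{\boldsymbol m_*,\beta}$ is singular on $\mathcal H_q$ (there is a nonzero $\boldsymbol t\in\mathcal H_q$ with $\boldsymbol Q_{\boldsymbol m_*,\beta}(\boldsymbol t)=0$); it is type-I special if $f^{(4)}_{\beta,h}(s)<0$ and type-II special if $f^{(4)}_{\beta,h}(s)=0$. Powers of vectors are coordinatewise. Convergence in distribution to mixtures of $\delta_{\pm\infty}$ is of probability measures on $[-\infty,\infty]$. *)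

(* Defs.v *)
From HB Require Import structures.
From mathcomp Require Import all_boot all_order all_algebra.
From mathcomp Require Import all_classical all_reals all_analysis measurable_realfun.

Set Implicit Arguments.
Unset Strict Implicit.
Unset Printing Implicit Defensive.

Import Order.TTheory GRing.Theory Num.Theory.
Import numFieldNormedType.Exports.

Local Open Scope classical_set_scope.
Local Open Scope ring_scope.

(* The colours 1, ..., q are the elements 0, ..., q - 1 of 'I_q, so the
   distinguished colour 1 is the ordinal of value 0. *)

Section finite_volume.
Context {R : realType}.
Variables (p q : nat).

Definition config (N : nat) := {ffun 'I_N -> 'I_q}.

Definition first_coord (t : 'rV[R]_q) : R :=
  \sum_(r < q | r == 0 :> nat) t 0 r.

Definition freq (N : nat) (X : config N) : 'rV[R]_q :=
  \row_(r < q) (#|[set i | X i == r]%SET|%:R / N%:R).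

Definition pnormp (t : 'rV[R]_q) : R := \sum_(r < q) t 0 r ^+ p.

Definition weight (beta h : R) (N : nat) (X : config N) : R :=
  expR (beta * N%:R * pnormp (freq X) + N%:R * h * first_coord (freq X)).

Definition potts (beta h : R) (N : nat) (X : config N) : R :=
  weight beta h X / \sum_(Y : config N) weight beta h Y.

Definition potts_expectation (beta h : R) (N : nat) (Z : config N -> R) : R :=
  \sum_(X : config N) potts beta h X * Z X.

Definition likelihood (h : R) (N : nat) (X : config N) : R -> R :=
  fun beta' => potts beta' h X.

Definition maximizes_likelihood (h : R) (N : nat) (X : config N) (b : R) :=
  forall b' : R, likelihood h X b' <= likelihood h X b.

(* For N = 1 the likelihood is constant, so that the maximum likelihood
   estimate is unique only from N = 2 on; this is why it is a relation. *)
Definition is_mle (h : R) (N : nat) (X : config N) (b : \bar R) : Prop :=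
  match b with
  | r%:E => maximizes_likelihood h X r
  | +oo%E => ~ (exists r, maximizes_likelihood h X r) /\
      likelihood h X b' @[b' --> +oo] --> sup (range (likelihood h X))
  | -oo%E => ~ (exists r, maximizes_likelihood h X r) /\
      likelihood h X b' @[b' --> -oo] --> sup (range (likelihood h X))
  end.

(* The random variables Y N, defined on the configuration spaces with the
   Potts measures, converge in distribution on [-oo, +oo] to the measure mu. *)
Definition potts_cvg_distr (beta h : R) (Y : forall N, config N -> \bar R)
    (mu : set (\bar R) -> \bar R) : Prop :=
  forall g : \bar R -> R, continuous g -> (exists M, forall x, `|g x| <= M) ->
    potts_expectation beta h (fun X : config N => g (Y N X)) @[N --> \oo]
      --> fine (\int[mu]_x (g x)%:E)%E.

Definition scaled_error (a beta : R) (betahat : forall N, config N -> \bar R)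
    (N : nat) (X : config N) : \bar R :=
  ((N%:R `^ a)%:E * (betahat N X - beta%:E))%E.

End finite_volume.

Section landscape.
Context {R : realType}.
Variables (p q : nat).

Definition prob_vec (t : 'rV[R]_q) : Prop :=
  (forall r, 0 <= t 0 r) /\ \sum_(r < q) t 0 r = 1.

(* ln 0 = 0 in the library, whence the convention 0 log 0 = 0. *)
Definition Hfun (beta h : R) (t : 'rV[R]_q) : R :=
  beta * pnormp p t + h * first_coord t - \sum_(r < q) t 0 r * ln (t 0 r).

Definition global_maximizer (beta h : R) (m : 'rV[R]_q) : Prop :=
  prob_vec m /\ forall t, prob_vec t -> Hfun beta h t <= Hfun beta h m.

Definition unique_global_maximizer (beta h : R) (m : 'rV[R]_q) : Prop :=
  global_maximizer beta h m /\
  forall m', global_maximizer beta h m' -> m' = m.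

Definition xvec (s : R) : 'rV[R]_q :=
  \row_(r < q) (if r == 0 :> nat then (1 + (q%:R - 1) * s) / q%:R
                else (1 - s) / q%:R).

(* The entries of xvec s are positive for -1/(q-1) < s < 1, hence fline is smooth
   near every s in [0, 1[ and its two-sided derivatives at s = 0 agree with the
   one-sided ones. *)
Definition fline (beta h : R) (s : R) : R := Hfun beta h (xvec s).

Definition Qform (v : 'rV[R]_q) (beta : R) (t : 'rV[R]_q) : R :=
  \sum_(r < q) (beta * p%:R * (p%:R - 1) * v 0 r ^+ (p - 2) - (v 0 r)^-1)
               * t 0 r ^+ 2.

Definition singular_on_sum0 (v : 'rV[R]_q) (beta : R) : Prop :=
  exists t : 'rV[R]_q, [/\ t != 0, \sum_(r < q) t 0 r = 0 & Qform v beta t = 0].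

Definition special (beta h s : R) : Prop :=
  [/\ 0 <= s < 1, unique_global_maximizer beta h (xvec s)
    & singular_on_sum0 (xvec s) beta].

Definition typeI_special (beta h s : R) : Prop :=
  special beta h s /\ derive1n 4 (fline beta h) s < 0.

Definition typeII_special (beta h s : R) : Prop :=
  special beta h s /\ derive1n 4 (fline beta h) s = 0.

Definition uvec : 'rV[R]_q :=
  \row_(r < q) (if r == 0 :> nat then 1 - q%:R else 1).

Definition T_density (beta h s bbar hbar : R) (x : R) : R :=
  expR (x ^+ 4 / 24 * q%:R ^+ 4 * derive1n 4 (fline beta h) s +
        (bbar * p%:R * (\sum_(r < q) xvec s 0 r ^+ (p - 1) * uvec 0 r)
         + hbar * (1 - q%:R)) * x).

End landscape.

Section limit_laws.
Context {R : realType}.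

Definition law_of_density (g : R -> R) (A : set (measurableTypeR R)) : \bar R :=
  (\int[lebesgue_measure]_(x in A)
     (g x / Rintegral lebesgue_measure setT g)%:E)%E.

Definition law_cdf (mu : set (measurableTypeR R) -> \bar R) (t : R) : R :=
  fine (mu `]-oo, t]%classic).

Definition law_expectation (mu : set (measurableTypeR R) -> \bar R) (g : R -> R) : R :=
  fine (\int[mu]_x (g x)%:E)%E.

Definition prob_sqr_le_mean (mu : set (measurableTypeR R) -> \bar R) : R :=
  fine (mu [set x | x ^+ 2 <= law_expectation mu (fun y => y ^+ 2)]).

Definition T_law (p q : nat) (beta h s bbar hbar : R) :
    set (measurableTypeR R) -> \bar R :=
  law_of_density (T_density p q beta h s bbar hbar).

Definition F0_law : set (measurableTypeR R) -> \bar R :=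
  law_of_density (fun x => expR (- (32 / 15) * x ^+ 6)).

Definition infty_mixture (a : R) (A : set (\bar R)) : \bar R :=
  (a%:E * \d_(-oo) A + (1 - a)%:E * \d_(+oo) A)%E.

End limit_laws.

(* Main.v *)
Require Import Defs.
From HB Require Import structures.
From mathcomp Require Import all_boot all_order all_algebra.
From mathcomp Require Import all_classical all_reals all_analysis measurable_realfun.
From mathcomp Require Import ring lra.

Import Order.TTheory GRing.Theory Num.Theory.
Import numFieldNormedType.Exports.

(** The estimator is governed by one statistic, [S = pnormp p (freq X)]: the likelihood is
    an exponential family in [beta], so the estimator lies below [b] exactly when [S] lies
    below its mean under [b] (mle_le_iff). Its distribution function at [t] is therefore the
    [beta]-probability that [S] is at most its mean at the shifted parameter
    [beta + t / K ^+ (d - 1)], where [K = N `^ (1 / d)], and one needs limit theorems for [S],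
    at the scale of its fluctuations, for every parameter in this window.

    These come from Stein's method. Comparing configurations that differ at a single site
    gives an exact identity (exchange_identity). Applied to two colours other than the
    distinguished one it shows that all those proportions agree up to an error of variance
    [1 / N], because at their common value the map
    [theta u = u * expR (- (beta * (p%:R * u ^+ p.-1)))] is increasing (equalization).
    Applied to the distinguished colour and the others (balance), it reads: the displacement
    [xi] of the order parameter performs a one-dimensional dynamics whose drift
    [expR (- h) * theta (a - (q - 1) * xi) - theta (b + xi)], where [a] and [b] are the first
    and the other coordinates of the maximizer, vanishes at a special point to order [d - 1],
    with [d = 4] for type I and [d = 6] for type II. At scale [K] the drift,
    the diffusion and the shift of the parameter balance, and [K * xi] satisfies in the limit
    Stein's identity of the density proportional to [expR (- (c * x ^+ d) + e * x)]
    (stein_order); with a bound on moments this determines the limit of expectations of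
    functions of quadratic growth (stein_cvg). The localization near the maximizer that the
    argument needs follows from Gibbs' variational bound and the number of possible
    frequency vectors (concentration).

    It remains to expand [S]. Off the centre it is linear in [xi] to leading order, with
    slope [field_coef p q s < 0], and the shift of the parameter tilts the density by
    [t * field_coef p q s]: the limit event compares a variable with the mean of its tilt, and
    evenness of the untilted density gives the announced distribution function, which is a
    true one because the mean of the tilt grows without bound. At the centre
    [s = 0] the slope vanishes, the shift of the parameter is not felt and [S] is quadratic
    in [xi]: the limit event is that a square is at most its mean, whatever [t], so the
    estimator escapes to plus or minus infinity.

    Which case occurs is decided by algebra at the special point. Singularity of the
    quadratic form at the maximizer means that the second derivative of [fline] vanishes
    (F2_eq0), and maximality then kills the third (F3_eq0). At the centre this forces
    [q = 2], and the sign of the fourth derivative leaves [p = 2] or [p = 3] for type I and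
    [p = 4] for type II; off the centre, type II and the two exceptional pairs are impossible
    (flat4_absurd, flat_lowdegree_absurd). *)

Set Implicit Arguments.
Unset Strict Implicit.
Unset Printing Implicit Defensive.

Local Open Scope classical_set_scope.
Local Open Scope ring_scope.

(** * Derivatives of real functions *)

Section derivation_rules.
Context {R : realType}.
Implicit Types (f g : R -> R) (x a b : R).

Lemma dv_eq f x a b : is_derive x (1 : R) f a -> a = b -> is_derive x (1 : R) f b.
Proof. by move=> + <-. Qed.

Lemma dv_cst x a : is_derive x (1 : R) (fun=> a) 0.
Proof. exact: is_derive_cst. Qed.

Lemma dv_id x : is_derive x (1 : R) (fun y => y) 1.
Proof. exact: is_derive_id. Qed.

Lemma dvD f g x a b : is_derive x (1 : R) f a -> is_derive x (1 : R) g b ->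
  is_derive x (1 : R) (fun y => f y + g y) (a + b).
Proof. by move=> df dg; exact: (is_deriveD df dg). Qed.

Lemma dvN f x a : is_derive x (1 : R) f a -> is_derive x (1 : R) (fun y => - f y) (- a).
Proof. by move=> df; exact: (is_deriveN df). Qed.

Lemma dvB f g x a b : is_derive x (1 : R) f a -> is_derive x (1 : R) g b ->
  is_derive x (1 : R) (fun y => f y - g y) (a - b).
Proof. by move=> df dg; exact: (is_deriveB df dg). Qed.

Lemma dvM f g x a b : is_derive x (1 : R) f a -> is_derive x (1 : R) g b ->
  is_derive x (1 : R) (fun y => f y * g y) (a * g x + f x * b).
Proof.
move=> df dg; apply: dv_eq (is_deriveM df dg) _.
by rewrite /GRing.scale /=; ring.
Qed.

Lemma dvZ f x a b : is_derive x (1 : R) f a ->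
  is_derive x (1 : R) (fun y => b * f y) (b * a).
Proof. by move=> df; apply: dv_eq (dvM (dv_cst x b) df) _; ring. Qed.

Lemma dv_comp f g x a b : is_derive (g x) (1 : R) f a -> is_derive x (1 : R) g b ->
  is_derive x (1 : R) (fun y => f (g y)) (a * b).
Proof. exact: is_derive1_comp. Qed.

Lemma dvX n x : is_derive x (1 : R) (fun y => y ^+ n) (n%:R * x ^+ n.-1).
Proof.
elim: n => [|n IH]; first by apply: dv_eq (dv_cst x 1) _; rewrite mul0r.
have -> : (fun y : R => y ^+ n.+1) = (fun y => y * y ^+ n).
  by apply/funext => y; rewrite exprS.
apply: dv_eq (dvM (dv_id x) IH) _ => /=.
case: n {IH} => [|n]; first by rewrite !expr0; ring.
by rewrite !exprS /= -(natr1 n.+1); ring.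
Qed.

Lemma dv_expR x : is_derive x (1 : R) expR (expR x).
Proof. exact: is_derive_expR. Qed.

Lemma dv_exp f x a : is_derive x (1 : R) f a ->
  is_derive x (1 : R) (fun y => expR (f y)) (expR (f x) * a).
Proof. exact: (dv_comp (dv_expR (f x))). Qed.

Lemma dv_ln x : 0 < x -> is_derive x (1 : R) (@ln R) x^-1.
Proof. exact: is_derive1_ln. Qed.

Lemma dv_inv x : x != 0 -> is_derive x (1 : R) (fun y => y^-1) (- (x ^+ 2)^-1).
Proof.
move=> x0; apply: dv_eq (is_deriveV x0 (dv_id x)) _.
by rewrite /GRing.scale /= mulr1.
Qed.

Lemma dv_continuous f x a : is_derive x (1 : R) f a -> {for x, continuous f}.
Proof. by move=> [df _]; apply: differentiable_continuous; apply/derivable1_diffP. Qed.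

(** The mean value theorem with unordered end points, since the increments it is applied
    to have no sign. *)
Lemma dv_MVT f (df : R -> R) a b :
  (forall x, Num.min a b <= x <= Num.max a b -> is_derive x (1 : R) f (df x)) ->
  exists2 c, Num.min a b <= c <= Num.max a b & f b - f a = df c * (b - a).
Proof.
have main u v : u <= v -> (forall x, u <= x <= v -> is_derive x (1 : R) f (df x)) ->
    exists2 c, u <= c <= v & f v - f u = df c * (v - u).
  move=> uv H; have [|z|c] := @MVT_segment R f df u v uv.
  - by move=> y /[!in_itv] /= /andP[uy yv]; apply: H; rewrite !ltW.
  - apply: continuous_in_subspaceT => y /[!inE] /= /[!in_itv] /= Hy.
    exact: dv_continuous (H y Hy).
  - by rewrite in_itv /= => Hc E; exists c.
move=> H; have [ab|ba] := leP a b.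
  have [y Hy|c] := main a b ab; first by apply: H; rewrite min_l // max_r.
  by move=> Hc E; exists c.
move/ltW in ba.
have [y Hy|c Hc E] := main b a ba; first by apply: H; rewrite min_r // max_l.
by exists c => //; rewrite -opprB E; ring.
Qed.

End derivation_rules.

(** * Expectations under finite laws *)

Section finite_expectation.
Context {R : realType}.

Definition fexp (T : finType) (P Z : T -> R) : R := \sum_(x : T) P x * Z x.

Definition is_dist (T : finType) (P : T -> R) : Prop :=
  (forall x, 0 <= P x) /\ \sum_x P x = 1.

Variables (T : finType) (P : T -> R).
Hypothesis hP : is_dist P.

Lemma fexpD (Z1 Z2 : T -> R) :
  fexp P (fun x => Z1 x + Z2 x) = fexp P Z1 + fexp P Z2.
Proof. by rewrite /fexp -big_split; apply: eq_bigr => x _; rewrite mulrDr. Qed.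

Lemma fexpZ (c : R) (Z : T -> R) : fexp P (fun x => c * Z x) = c * fexp P Z.
Proof. by rewrite /fexp mulr_sumr; apply: eq_bigr => x _; rewrite mulrCA. Qed.

Lemma fexpB (Z1 Z2 : T -> R) :
  fexp P (fun x => Z1 x - Z2 x) = fexp P Z1 - fexp P Z2.
Proof. by rewrite /fexp -sumrB; apply: eq_bigr => x _; rewrite mulrBr. Qed.

Lemma fexp_sum (I : finType) (A : pred I) (Z : I -> T -> R) :
  fexp P (fun x => \sum_(i | A i) Z i x) = \sum_(i | A i) fexp P (Z i).
Proof.
by rewrite /fexp exchange_big /=; apply: eq_bigr => x _; rewrite mulr_sumr.
Qed.

Lemma fexp_cst (c : R) : fexp P (fun=> c) = c.
Proof. by rewrite /fexp -mulr_suml hP.2 mul1r. Qed.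

Lemma le_fexp (Z1 Z2 : T -> R) :
  (forall x, Z1 x <= Z2 x) -> fexp P Z1 <= fexp P Z2.
Proof. by move=> Z12; apply: ler_sum => x _; rewrite ler_wpM2l // hP.1. Qed.

Lemma fexp_ge0 (Z : T -> R) : (forall x, 0 <= Z x) -> 0 <= fexp P Z.
Proof. by move=> Z0; apply: sumr_ge0 => x _; rewrite mulr_ge0 // hP.1. Qed.

Lemma fexp_norm (Z : T -> R) : `|fexp P Z| <= fexp P (fun x => `|Z x|).
Proof.
apply: (le_trans (ler_norm_sum _ _ _)); apply: ler_sum => x _.
by rewrite normrM ger0_norm // hP.1.
Qed.

Lemma fexp_le_cst (Z : T -> R) (c : R) : (forall x, Z x <= c) -> fexp P Z <= c.
Proof. by move=> Zc; rewrite -[leRHS](fexp_cst c); exact: le_fexp. Qed.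

Lemma fexp_ge_cst (Z : T -> R) (c : R) : (forall x, c <= Z x) -> c <= fexp P Z.
Proof. by move=> Zc; rewrite -[leLHS](fexp_cst c); exact: le_fexp. Qed.

End finite_expectation.

Section potts_basics.
Context {R : realType}.
Variables (p q : nat) (h : R).
Hypothesis hq : (0 < q)%N.

Lemma weight_gt0 (b : R) N (X : config q N) : 0 < weight p b h X.
Proof. exact: expR_gt0. Qed.

Definition cst_config N (k : 'I_q) : config q N := [ffun=> k].

Lemma partition_function_gt0 (b : R) N :
  0 < \sum_(Y : config q N) weight p b h Y.
Proof.
rewrite (bigD1 (cst_config N (Ordinal hq))) //=.
by rewrite ltr_pwDl ?weight_gt0 // sumr_ge0 // => Y _; rewrite ltW ?weight_gt0.
Qed.

Lemma potts_gt0 (b : R) N (X : config q N) : 0 < potts p b h X.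
Proof. by rewrite divr_gt0 ?weight_gt0 ?partition_function_gt0. Qed.

Lemma potts_dist (b : R) N : is_dist (@potts R p q b h N).
Proof.
split => [X|]; first by rewrite ltW ?potts_gt0.
by rewrite -mulr_suml divff // gt_eqF // partition_function_gt0.
Qed.

Lemma freq_ge0 N (X : config q N) r : 0 <= freq X 0 r :> R.
Proof. by rewrite mxE divr_ge0. Qed.

Lemma sum_count N (X : config q N) : (\sum_(r < q) #|[set i | X i == r]%SET| = N)%N.
Proof.
transitivity (\sum_(r < q) \sum_(i < N | X i == r) 1)%N.
  by apply: eq_bigr => r _; rewrite sum1dep_card.
rewrite -(@partition_big _ _ _ _ _ _ xpredT (fun i => X i) xpredT (fun=> 1%N)) //=.
by rewrite sum1_card card_ord.
Qed.

Lemma freq_sum N (X : config q N) : (0 < N)%N -> \sum_(r < q) freq X 0 r = 1 :> R.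
Proof.
move=> N0; under eq_bigr do rewrite mxE.
by rewrite -mulr_suml -natr_sum sum_count divff // pnatr_eq0 -lt0n.
Qed.

Lemma freq_le1 N (X : config q N) r : freq X 0 r <= 1 :> R.
Proof.
rewrite mxE; case: N X => [|N] X; first by rewrite invr0 mulr0.
rewrite ler_pdivrMr ?ltr0n // mul1r ler_nat.
by apply: leq_trans (max_card _) _; rewrite card_ord.
Qed.

Lemma freq_prob_vec N (X : config q N) : (0 < N)%N -> prob_vec (freq X : 'rV[R]_q).
Proof. by move=> N0; split => [r|]; [exact: freq_ge0 | exact: freq_sum]. Qed.

(** The laws at different inverse temperatures form an exponential family, which turns
    likelihood ratios into moment generating functions. *)
Lemma pottsE (b b' : R) N (X : config q N) :
  potts p b' h X =
  potts p b h X * expR ((b' - b) * N%:R * pnormp p (freq X)) /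
  fexp (@potts R p q b h N) (fun Y => expR ((b' - b) * N%:R * pnormp p (freq Y))).
Proof.
have wE (Y : config q N) : weight p b' h Y =
    weight p b h Y * expR ((b' - b) * N%:R * pnormp p (freq Y)).
  by rewrite /weight -expRD; congr expR; ring.
set Z := \sum_(Y : config q N) weight p b h Y.
have Z0 : Z != 0 by rewrite gt_eqF // partition_function_gt0.
have -> : fexp (@potts R p q b h N)
    (fun Y => expR ((b' - b) * N%:R * pnormp p (freq Y))) =
    (\sum_(Y : config q N) weight p b' h Y) / Z.
  rewrite /fexp mulr_suml; apply: eq_bigr => Y _.
  by rewrite wE /potts -/Z; ring.
have Z'0 : \sum_(Y : config q N) weight p b' h Y != 0.
  by rewrite gt_eqF // partition_function_gt0.
by rewrite /potts -/Z wE; field; rewrite Z0 Z'0.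
Qed.

End potts_basics.


(** * The maximum likelihood estimator *)

Section likelihood_ratio.
Context {R : realType}.

(** Convexity of the exponential on the ray through 0 and [x], beyond [x]. *)
Lemma expR_convex_ray (d x : R) : 1 <= d ->
  d * (expR x - 1) <= expR (d * x) - 1.
Proof.
move=> d1.
have d0 : 0 < d by lra.
have E1 : expR (d * x) * expR (x - d * x) = expR x by rewrite -expRD; congr expR; lra.
have E2 : expR x * expR (- x) = 1 by rewrite -expRD subrr expR0.
have h1 := expR_ge1Dx (d * x - x); have h2 := expR_ge1Dx (- x).
have ex := expR_gt0 x.
have E3 : expR (d * x) = expR x * expR (d * x - x) by rewrite -expRD; congr expR; lra.
have h3 : expR x * (1 + (d * x - x)) <= expR (d * x) by rewrite E3 ler_pM2l.
have h4 : expR x * (1 - x) <= 1 by rewrite -[leRHS]E2 ler_pM2l.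
have : (d - 1) * (expR x * (1 - x)) <= (d - 1) * 1 by rewrite ler_wpM2l //; lra.
lra.
Qed.

Variables (T : finType) (P : T -> R).
Hypotheses (hP : is_dist P) (P0 : forall x, 0 < P x).

Definition mgf (Z : T -> R) (d : R) : R := fexp P (fun x => expR (d * Z x)).

Lemma mgf_gt0 Z d : 0 < mgf Z d.
Proof.
rewrite /mgf /fexp lt_neqAle; apply/andP; split; last first.
  by apply: sumr_ge0 => x _; rewrite mulr_ge0 // ?ltW // expR_gt0.
apply/eqP => /esym H0; have := hP.2.
have/(_ _)/eqP Px : forall x, P x * expR (d * Z x) == 0.
  move=> x; apply/eqP; apply: (psumr_eq0P _ H0) => // y _.
  by rewrite mulr_ge0 // ?ltW // expR_gt0.
rewrite big1 => [/eqP|x _]; first by rewrite eq_sym oner_eq0.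
by have /eqP := Px x; rewrite mulf_eq0 gt_eqF //= gt_eqF // expR_gt0.
Qed.

(** By [1 + x <= expR x], strictly where [Z] does not vanish. *)
Lemma mgf_gt1 Z d : 0 <= d * fexp P Z -> d != 0 -> (exists x, Z x != 0) ->
  1 < mgf Z d.
Proof.
move=> dZ d0 [x Zx].
apply: (@le_lt_trans _ _ (fexp P (fun x => 1 + d * Z x))).
  by rewrite (fexpD P (fun=> 1)) fexp_cst // fexpZ lerDl.
rewrite /fexp (bigD1 x) //= /mgf /fexp [ltRHS](bigD1 x) //=.
rewrite ltr_leD //; first by rewrite ltr_pM2l // expR_gt1Dx // mulf_neq0.
by apply: ler_sum => y _; rewrite ler_pM2l // expR_ge1Dx.
Qed.

(** Beyond a point where it is at least its value 1 at the origin, a convex function keeps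
    growing along the ray: this rules out maximizers of the likelihood at infinity. *)
Lemma mgf_ray Z d e : 1 <= mgf Z d -> 1 <= e -> mgf Z d <= mgf Z (e * d).
Proof.
move=> h1 e1.
have : fexp P (fun x => e * (expR (d * Z x) - 1)) <=
       fexp P (fun x => expR (e * d * Z x) - 1).
  by apply: le_fexp => // x; rewrite -mulrA expR_convex_ray.
rewrite fexpZ !fexpB !fexp_cst // -/(mgf Z d) -/(mgf Z (e * d)).
have : 0 <= (e - 1) * (mgf Z d - 1) by rewrite mulr_ge0; lra.
lra.
Qed.

Lemma expR_le_quadratic (x : R) : `|x| <= 1 / 2 ->
  expR x <= 1 + x + 2 * x ^+ 2.
Proof.
rewrite ler_norml => /andP[x1 x2].
have E2 : expR x * expR (- x) = 1 by rewrite -expRD subrr expR0.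
have h4 : expR x * (1 - x) <= 1.
  by rewrite -[leRHS]E2 ler_pM2l ?expR_gt0 //; have := expR_ge1Dx (- x); lra.
have x0 : 0 < 1 - x by lra.
rewrite -(ler_pM2r x0); apply: (le_trans h4).
have -> : (1 + x + 2 * x ^+ 2) * (1 - x) = 1 + x ^+ 2 * (1 - 2 * x) by ring.
by rewrite lerDl mulr_ge0 ?sqr_ge0; lra.
Qed.

(** The derivative at the origin is the mean, here negative. *)
Lemma mgf_lt1 Z M : 0 < M -> (forall x, `|Z x| <= M) -> fexp P Z < 0 ->
  exists2 d, 0 < d & mgf Z d < 1.
Proof.
move=> M0 ZM EZ.
have EM : - fexp P Z <= M.
  rewrite -lerN2 opprK; apply: fexp_ge_cst => // x.
  by have := ZM x; rewrite ler_norml => /andP[].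
pose d := - fexp P Z / (4 * M ^+ 2).
have M2 : 0 < 4 * M ^+ 2 by rewrite mulr_gt0 // exprn_gt0.
have d0 : 0 < d by rewrite divr_gt0 // oppr_gt0.
have dE : d * (4 * M ^+ 2) = - fexp P Z by rewrite /d divfK // gt_eqF.
have dM : d * M <= 1 / 4.
  have : d * (4 * M ^+ 2) <= M by rewrite dE.
  have -> : d * (4 * M ^+ 2) = (4 * (d * M)) * M by ring.
  by rewrite -[leRHS]mul1r ler_pM2r //; lra.
exists d => //.
have : mgf Z d <= fexp P (fun x => 1 + d * Z x + 2 * (d * M) ^+ 2).
  apply: le_fexp => // x.
  have dZ : `|d * Z x| <= d * M by rewrite normrM gtr0_norm // ler_pM2l.
  apply: le_trans (expR_le_quadratic _) _; first by apply: le_trans dZ _; lra.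
  rewrite lerD2l ler_pM2l // -real_normK ?num_real // lerXn2r ?nnegrE //.
  by rewrite mulr_ge0 // ltW.
rewrite !fexpD fexpZ !fexp_cst // => /le_lt_trans; apply.
suff : 2 * (d * M) ^+ 2 < - (d * fexp P Z) by lra.
rewrite -mulrN -dE.
have -> : 2 * (d * M) ^+ 2 = d * (d * (2 * M ^+ 2)) by ring.
by rewrite !ltr_pM2l // ltr_pM2r ?exprn_gt0 //; lra.
Qed.

End likelihood_ratio.

Section mle_event.
Context {R : realType}.
Variables (p q : nat) (h : R).
Hypotheses (hp : (2 <= p)%N) (hq : (2 <= q)%N).

Lemma pnormp_ge0 N (X : config q N) : 0 <= pnormp p (freq X) :> R.
Proof. by apply: sumr_ge0 => r _; rewrite exprn_ge0 // freq_ge0. Qed.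

Lemma pnormp_le1 N (X : config q N) : (0 < N)%N -> pnormp p (freq X) <= 1 :> R.
Proof.
move=> N0; rewrite -[leRHS](freq_sum (R := R) X N0); apply: ler_sum => r _.
have p0 : (0 < p)%N by apply: leq_trans hp.
by rewrite -{2}[freq X 0 r]expr1 ler_wiXn2l // ?freq_ge0 ?freq_le1.
Qed.

(** Monochromatic and two-coloured configurations differ as soon as there are two sites;
    this makes the likelihood strictly concave. *)
Lemma pnormp_nonconstant N (X : config q N) : (2 <= N)%N ->
  exists Y : config q N, pnormp p (freq Y) != pnormp p (freq X) :> R.
Proof.
move=> N2; have N0 : (0 < N)%N by apply: leq_trans N2.
have p0 : (0 < p)%N by apply: leq_trans hp.
pose k0 : 'I_q := Ordinal (ltnW hq); pose k1 : 'I_q := Ordinal hq.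
have k01 : k1 != k0 by [].
pose Y0 : config q N := [ffun=> k0].
pose Y1 : config q N := [ffun i : 'I_N => if i == Ordinal N0 then k1 else k0].
suff [h0 h1] : 1 <= pnormp p (freq Y0) :> R /\ pnormp p (freq Y1) < 1 :> R.
  have [eX|] := eqVneq (pnormp p (freq Y0)) (pnormp p (freq X) : R); last by exists Y0.
  by exists Y1; rewrite lt_eqF // -eX; apply: lt_le_trans h0.
split.
  rewrite /pnormp (bigD1 k0) //= ler_wpDr //.
    by apply: sumr_ge0 => r _; rewrite exprn_ge0 // freq_ge0.
  rewrite mxE.
  have -> : [set i | Y0 i == k0]%SET = [set: 'I_N]%SET.
    by apply/setP => i; rewrite !inE ffunE eqxx.
  by rewrite cardsT card_ord divff ?expr1n // pnatr_eq0 -lt0n.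
have f1 : freq Y1 0 k1 = N%:R^-1 :> R.
  rewrite mxE.
  have -> : [set i | Y1 i == k1]%SET = [set Ordinal N0]%SET.
    by apply/setP => i; rewrite !inE ffunE; case: ifP => // _; rewrite eq_sym (negPf k01).
  by rewrite cards1 mul1r.
have lt1 : freq Y1 0 k1 ^+ p < freq Y1 0 k1 :> R.
  have g0 : 0 < N%:R^-1 :> R by rewrite invr_gt0 ltr0n.
  have g1 : N%:R^-1 < 1 :> R by rewrite invf_lt1 ?ltr0n // ltr1n.
  by rewrite f1 ltr_iXnr.
rewrite -[ltRHS](freq_sum (R := R) Y1 N0) /pnormp (bigD1 k1) //= [ltRHS](bigD1 k1) //=.
rewrite ltr_leD //; apply: ler_sum => r _.
by rewrite -{2}[freq Y1 0 r]expr1 ler_wiXn2l // ?freq_ge0 ?freq_le1.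
Qed.

Lemma likelihood_ratio (b b' : R) N (X : config q N) :
  likelihood p h X b' * mgf (@potts R p q b h N)
    (fun Y => N%:R * (pnormp p (freq Y) - pnormp p (freq X))) (b' - b)
  = likelihood p h X b.
Proof.
have q0 : (0 < q)%N by apply: ltnW.
rewrite /likelihood (pottsE p h q0 b b' X).
set w := fexp _ _.
have w0 : 0 < w.
  have -> : w = mgf (@potts R p q b h N)
     (fun Y => N%:R * pnormp p (freq Y)) (b' - b).
    by rewrite /w /mgf; congr fexp; apply/funext => Y; congr expR; ring.
  by apply: mgf_gt0 => [|Y]; [exact: potts_dist | exact: potts_gt0].
have -> : mgf (@potts R p q b h N)
    (fun Y => N%:R * (pnormp p (freq Y) - pnormp p (freq X))) (b' - b) =
  expR (- ((b' - b) * N%:R * pnormp p (freq X))) * w.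
  rewrite /mgf /w -fexpZ; congr fexp; apply/funext => Y.
  by rewrite -expRD; congr expR; ring.
set e := expR _; set e' := expR _.
have ee' : e * e' = 1 by rewrite -expRD subrr expR0.
transitivity (potts p b h X * (e * e') * (w / w)); first by ring.
by rewrite ee' divff ?gt_eqF // !mulr1.
Qed.

(** The log-likelihood is strictly concave with derivative
    [N * (S X - E_b S)], so the maximizer lies at or below [b] exactly when this
    derivative is nonpositive at [b]; infinite estimates follow the same rule
    because the likelihood stays bounded away from its value at [b] along the ray
    of decrease. *)
Lemma mle_le_iff N (X : config q N) (bh : \bar R) (b : R) : (2 <= N)%N ->
  is_mle p h X bh ->
  (bh <= b%:E)%E =
  (pnormp p (freq X) <= potts_expectation p b h (fun Y : config q N => pnormp p (freq Y))).
Proof.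
move=> N2 hmle; have q0 : (0 < q)%N by apply: ltnW.
have N0 : 0 < N%:R :> R by rewrite ltr0n; apply: leq_trans N2.
set m := potts_expectation _ _ _ _.
pose P := @potts R p q b h N; have hP : is_dist P by exact: potts_dist.
have P0 Y : 0 < P Y by exact: potts_gt0.
pose Z (Y : config q N) : R := N%:R * (pnormp p (freq Y) - pnormp p (freq X)).
have EZ : fexp P Z = N%:R * (m - pnormp p (freq X)).
  by rewrite /Z fexpZ (fexpB P _ (fun=> _)) fexp_cst.
have Zn0 : exists Y, Z Y != 0.
  have [Y SY] := pnormp_nonconstant X N2; exists Y.
  by rewrite /Z mulf_neq0 // ?subr_eq0 // gt_eqF.
pose L := likelihood p h X.
have L0 b' : 0 < L b' by exact: potts_gt0.
have Lb b' : L b' * mgf P Z (b' - b) = L b by exact: likelihood_ratio.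
have mgt1 d : 0 <= d * fexp P Z -> d != 0 -> L (b + d) < L b /\ 1 < mgf P Z d.
  move=> dE d0; have m1 := mgf_gt1 hP P0 dE d0 Zn0; split=> //.
  by rewrite -(Lb (b + d)) addrAC subrr add0r ltr_pMr.
have Lsup b' : L b' <= sup (range L).
  apply: ub_le_sup; last by exists b'.
  exists 1 => _ [c _ <-]; rewrite /L /likelihood.
  rewrite -(potts_dist (R := R) p h q0 c N).2 (bigD1 X) //= ler_wpDr //.
  by apply: sumr_ge0 => Y _; rewrite ltW // potts_gt0.
have far d : d != 0 -> 0 <= d * fexp P Z -> forall e, 1 <= e ->
    L (b + e * d) <= L b / mgf P Z d /\ L b / mgf P Z d < L b.
  move=> d0 dE e e1; have [_ m1] := mgt1 d dE d0.
  have m0 : 0 < mgf P Z d by apply: lt_trans m1.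
  split; last by rewrite ltr_pdivrMr // ltr_pMr.
  rewrite ler_pdivlMr // -(Lb (b + e * d)) addrAC subrr add0r ler_pM2l //.
  by apply: mgf_ray => //; exact: ltW.
have [le_Sm|lt_mS] := leP (pnormp p (freq X)) m.
  have EZ0 : 0 <= fexp P Z by rewrite EZ mulr_ge0 ?subr_ge0 // ltW.
  case: bh hmle => [r||] /= hmle.
  - rewrite lee_fin leNgt; apply/negP => br.
    have := hmle b; rewrite -/L leNgt => /negP; apply.
    have [] := mgt1 (r - b); last by rewrite addrC subrK.
      by rewrite mulr_ge0 // subr_ge0 ltW.
    by rewrite subr_eq0 gt_eqF.
  - have [_ cvL] := hmle; exfalso.
    have [_ c1] := far 1 (oner_neq0 _) (mulr_ge0 ler01 EZ0) 1 (lexx _).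
    suff : sup (range L) <= L b / mgf P Z 1.
      by move=> /le_lt_trans /(_ c1); rewrite ltNge Lsup.
    apply: (cvgr_to_le cvL); near=> c.
    have c2 : 1 <= c - b by rewrite lerBrDr; near: c; by apply: nbhs_pinfty_ge; rewrite num_real.
    have [+ _] := far 1 (oner_neq0 _) (mulr_ge0 ler01 EZ0) _ c2.
    by rewrite mulr1 addrC subrK.
  - by rewrite leNye.
have EZ0 : fexp P Z < 0 by rewrite EZ pmulr_rlt0 // subr_lt0.
have N1 : (-1 : R) != 0 by rewrite oppr_eq0 oner_eq0.
have EZ1 : 0 <= -1 * fexp P Z by rewrite mulN1r oppr_ge0 ltW.
case: bh hmle => [r||] /= hmle.
- apply/negbTE; rewrite lee_fin -ltNge lt_neqAle; apply/andP; split.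
    apply/eqP => br; rewrite -br in hmle.
    have [Y|d d0 m1] := @mgf_lt1 _ _ P hP Z N%:R N0 _ EZ0.
      rewrite normrM (ger0_norm (ltW N0)) (ler_piMr (ltW N0)) // ler_norml.
      have := pnormp_ge0 X; have := pnormp_ge0 Y.
      have := pnormp_le1 X (ltnW N2); have := pnormp_le1 Y (ltnW N2).
      by move=> *; apply/andP; split; lra.
    have := hmle (b + d); rewrite -/L leNgt => /negP; apply.
    rewrite -[ltLHS](Lb (b + d)) addrAC subrr add0r.
    by rewrite gtr_pMr.
  rewrite leNgt; apply/negP => rb.
  have := hmle b; rewrite -/L leNgt => /negP; apply.
  have [] := mgt1 (r - b); last by rewrite addrC subrK.
    by rewrite mulr_le0 // ?subr_le0 ltW.
  by rewrite subr_eq0 lt_eqF.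
- by rewrite leye_eq.
- have [_ cvL] := hmle; exfalso.
  have [_ c1] := far (-1) N1 EZ1 1 (lexx _).
  suff : sup (range L) <= L b / mgf P Z (-1).
    by move=> /le_lt_trans /(_ c1); rewrite ltNge Lsup.
  apply: (cvgr_to_le cvL); near=> c.
  have c2 : 1 <= b - c by rewrite lerBrDr addrC -lerBrDr; near: c; by apply: nbhs_ninfty_le; rewrite num_real.
  have [+ _] := far (-1) N1 EZ1 _ c2.
  by rewrite mulrN1 opprB addrC subrK.
Unshelve. all: end_near. Qed.

End mle_event.

(** * The exchange identity *)

Section exchange.
Context {R : realType}.
Variables (p q : nat) (h : R).

Definition flip N (X : config q N) (i : 'I_N) (l : 'I_q) : config q N :=
  [ffun j => if j == i then l else X j].

(** Both sides sum over the pairs of configurations that differ at one site, of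
    colour [k] in the first and [l] in the second. *)
Lemma sum_flip N (k l : 'I_q) (f : config q N -> config q N -> R) :
  \sum_(X : config q N) \sum_(i | X i == k) f X (flip X i l) =
  \sum_(X : config q N) \sum_(i | X i == l) f (flip X i k) X.
Proof.
rewrite (exchange_big_dep xpredT) //= [RHS](exchange_big_dep xpredT) //=.
apply: eq_bigr => i _.
have flipK (X : config q N) a b : X i = a -> flip (flip X i b) i a = X.
  by move=> Xi; apply/ffunP => j; rewrite !ffunE; case: eqP => // ->.
rewrite (reindex_onto (fun X => flip X i k) (fun X => flip X i l)) /=; last first.
  by move=> X /eqP Xi; exact: flipK.
apply: eq_big => [X|X /andP[_ /eqP XE]]; last by rewrite XE.
rewrite ffunE !eqxx /=; apply/eqP/eqP => [<-|]; last exact: flipK.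
by rewrite ffunE eqxx.
Qed.

Definition jump (N : nat) (k l : 'I_q) (z : 'rV[R]_q) : 'rV[R]_q :=
  \row_r (z 0 r + ((r == l)%:R - (r == k)%:R) / N%:R).

Lemma sum_sites N (X : config q N) (c : 'I_q -> R) : (0 < N)%N ->
  \sum_(i < N) c (X i) = N%:R * \sum_(r < q) c r * freq X 0 r.
Proof.
move=> N0; rewrite (partition_big (fun i => X i) xpredT) //= mulr_sumr.
apply: eq_bigr => r _; rewrite mxE.
under eq_bigr => i /eqP -> do [].
have -> : N%:R * (c r * (#|[set i | X i == r]%SET|%:R / N%:R)) =
    c r * #|[set i | X i == r]%SET|%:R * (N%:R / N%:R) by ring.
rewrite divff ?pnatr_eq0 -?lt0n // mulr1 sumr_const mulr_natr; congr (_ *+ _).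
by apply: eq_card => i; rewrite !inE.
Qed.

Lemma freq_flip N (X : config q N) i k l : X i = k ->
  freq (flip X i l) = jump N k l (freq X).
Proof.
move=> Xi; have N0 : (0 < N)%N by apply: leq_ltn_trans (ltn_ord i).
apply/rowP => r; rewrite [RHS]mxE.
have H (Y : config q N) : N%:R * freq Y 0 r = \sum_(j < N) (Y j == r)%:R :> R.
  rewrite (sum_sites Y (fun a => (a == r)%:R) N0) (bigD1 r) //= eqxx mul1r.
  by rewrite big1 ?addr0 // => a /negPf ->; rewrite mul0r.
have Nn0 : N%:R != 0 :> R by rewrite pnatr_eq0 -lt0n.
apply: (mulfI Nn0); rewrite H mulrDr H [N%:R * (_ / _)]mulrC divfK //.
rewrite (bigD1 i) //= [in RHS](bigD1 i) //= ffunE eqxx Xi.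
rewrite [X in _ + X = _](_ : _ = \sum_(j < N | j != i) (X j == r)%:R); last first.
  by apply: eq_bigr => j /negPf ji; rewrite ffunE ji.
by rewrite [l == r]eq_sym [k == r]eq_sym; ring.
Qed.

Definition energy (b : R) (z : 'rV[R]_q) : R := b * pnormp p z + h * first_coord z.

Lemma weightE b N (X : config q N) :
  weight p b h X = expR (N%:R * energy b (freq X)).
Proof. by rewrite /weight /energy; congr expR; ring. Qed.

(** Reversibility: under the map that recolours one site from [k] to [l] the weight changes
    by an explicit factor, and [sum_flip] lets the two configurations swap roles. *)
Lemma exchange_identity b N (k l : 'I_q) (psi : 'rV[R]_q -> R) : (0 < N)%N ->
  potts_expectation p b h (fun X : config q N =>
    freq X 0 k * expR (N%:R * (energy b (jump N k l (freq X)) - energy b (freq X)))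
      * psi (jump N k l (freq X))) =
  potts_expectation p b h (fun X : config q N => freq X 0 l * psi (freq X)).
Proof.
move=> N0; have Nn0 : N%:R != 0 :> R by rewrite pnatr_eq0 -lt0n.
have cnt (X : config q N) (r : 'I_q) (c : R) :
    \sum_(i | X i == r) c = N%:R * (freq X 0 r * c).
  rewrite sumr_const -(mulr_natl c) mulrA; congr (_ * c).
  rewrite mxE mulrC divfK //.
  by congr (_%:R); apply: eq_card => i; rewrite !inE.
have := @sum_flip N k l (fun X Y => potts p b h Y * psi (freq Y)).
have -> : \sum_(X : config q N) \sum_(i | X i == l) potts p b h X * psi (freq X) =
    N%:R * potts_expectation p b h (fun X : config q N => freq X 0 l * psi (freq X)).
  by rewrite mulr_sumr; apply: eq_bigr => X _; rewrite cnt; ring.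
move=> /esym E; apply: (mulfI Nn0); rewrite E mulr_sumr; apply: eq_bigr => X _.
transitivity (\sum_(i | X i == k) potts p b h X *
   expR (N%:R * (energy b (jump N k l (freq X)) - energy b (freq X))) *
   psi (jump N k l (freq X))); first by rewrite cnt; ring.
apply: eq_bigr => i /eqP Xi; rewrite -(freq_flip l Xi); congr (_ * _).
rewrite /potts !weightE mulrAC -expRD; congr (expR _ / _).
by ring.
Qed.

End exchange.

(** * Concentration *)

Section concentration.
Context {R : realType}.
Variables (p q : nat) (h : R).
Hypotheses (hp : (0 < p)%N) (hq : (0 < q)%N).

Lemma exprn_tangent (n : nat) (a x : R) : 0 <= a -> 0 <= x ->
  a ^+ n.+1 + n.+1%:R * a ^+ n * (x - a) <= x ^+ n.+1.
Proof.
move=> a0 x0; elim: n => [|n IH]; first by rewrite expr0 !expr1; lra.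
have h1 : 0 <= (n.+1)%:R * a ^+ n * (x - a) ^+ 2.
  by rewrite mulr_ge0 ?sqr_ge0 // mulr_ge0 // exprn_ge0.
have h2 : x * (a ^+ n.+1 + n.+1%:R * a ^+ n * (x - a)) <= x * x ^+ n.+1.
  by rewrite ler_wpM2l.
rewrite [leRHS]exprS; apply: le_trans h2.
rewrite -subr_ge0; apply: le_trans h1 _; rewrite le_eqVlt; apply/orP; left; apply/eqP.
by rewrite !exprS -(natr1 n.+1); ring.
Qed.

Lemma jensen_expR (m v : 'I_q -> R) : (forall r, 0 <= m r) -> \sum_r m r = 1 ->
  expR (\sum_r m r * v r) <= \sum_r m r * expR (v r).
Proof.
move=> m0 m1; set c := \sum_r m r * v r.
have -> : expR c = \sum_r m r * (expR c * (1 + (v r - c))).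
  transitivity (expR c * \sum_r m r * (1 + (v r - c))); last first.
    by rewrite mulr_sumr; apply: eq_bigr => r _; ring.
  under eq_bigr do rewrite mulrDr mulr1 mulrBr.
  by rewrite big_split /= sumrB -mulr_suml m1 mul1r -/c subrr addr0 mulr1.
apply: ler_sum => r _; rewrite ler_wpM2l //.
have -> : v r = c + (v r - c) by ring.
by rewrite expRD addrAC subrr add0r ler_pM2l ?expR_gt0 ?expR_ge1Dx.
Qed.

Lemma first_coordE (z : 'rV[R]_q) :
  first_coord z = \sum_(r < q) (r == 0 :> nat)%:R * z 0 r.
Proof.
rewrite /first_coord big_mkcond; apply: eq_bigr => r _.
by case: ifP; rewrite ?mul1r ?mul0r.
Qed.

Lemma energyE (b : R) (z : 'rV[R]_q) :
  energy p h b z = \sum_r (b * z 0 r ^+ p + h * ((r == 0 :> nat)%:R * z 0 r)).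
Proof. by rewrite /energy first_coordE big_split /= !mulr_sumr. Qed.

(** Gibbs variational bound: by convexity of the energy, the mean field value at
    any [m] is attained without correction. *)
Lemma partition_function_ge (b : R) (m : 'rV[R]_q) N : 0 <= b -> (0 < N)%N ->
  prob_vec m -> (forall r, 0 < m 0 r) ->
  expR (N%:R * Hfun p b h m) <= \sum_(X : config q N) weight p b h X.
Proof.
move=> b0 N0 [m0 m1] mpos.
have [n pE] : exists n, p = n.+1 by case: (p) hp => // n; exists n.
pose c r := b * (p%:R * m 0 r ^+ n) + h * (r == 0 :> nat)%:R : R.
have tang (z : 'rV[R]_q) : (forall r, 0 <= z 0 r) ->
    energy p h b m - \sum_r c r * m 0 r + \sum_r c r * z 0 r <= energy p h b z.
  move=> z0; rewrite !energyE -sumrB -big_split /=; apply: ler_sum => r _.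
  have := exprn_tangent n (m0 r) (z0 r); rewrite -pE => /(ler_wpM2l b0).
  by rewrite /c; lra.
have H (X : config q N) :
    expR (N%:R * (energy p h b m - \sum_r c r * m 0 r)) * \prod_(i < N) expR (c (X i))
    <= weight p b h X.
  rewrite -expR_sum sum_sites // -expRD -mulrDr weightE ler_expR ler_wpM2l //.
  by apply: tang => r; exact: freq_ge0.
apply: (@le_trans _ _ (\sum_(X : config q N) expR (N%:R * (energy p h b m -
    \sum_r c r * m 0 r)) * \prod_(i < N) expR (c (X i)))); last exact: ler_sum.
rewrite -mulr_sumr -(bigA_distr_bigA (fun _ r => expR (c r))) /=.
rewrite prodr_const card_ord.
have HE : Hfun p b h m = energy p h b m - \sum_r c r * m 0 r +
    \sum_r m 0 r * (c r - ln (m 0 r)).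
  have -> : \sum_r m 0 r * (c r - ln (m 0 r)) =
      \sum_r c r * m 0 r - \sum_r m 0 r * ln (m 0 r).
    by rewrite -sumrB; apply: eq_bigr => r _; ring.
  by rewrite /Hfun /energy; ring.
rewrite HE mulrDr expRD ler_pM2l ?expR_gt0 // expRM_natl lerXn2r ?nnegrE ?expR_ge0 //.
  by apply: sumr_ge0 => r _; exact: expR_ge0.
apply: le_trans (jensen_expR _ m0 m1) _; apply: ler_sum => r _.
by rewrite expRD expRN lnK ?posrE // mulrCA divff ?mulr1 // gt_eqF.
Qed.

Definition types N := {ffun 'I_q -> 'I_N.+1}.

(** The law of [N] independent colours distributed as [freq X] gives [X] the
    probability [\prod_i freq X 0 (X i)], and there are few possible [freq X]. *)
Lemma sum_empirical_likelihood N : (0 < N)%N ->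
  \sum_(X : config q N) \prod_(i < N) freq X 0 (X i) <= (N.+1 ^ q)%:R :> R.
Proof.
move=> N0; have Nn0 : N%:R != 0 :> R by rewrite pnatr_eq0 -lt0n.
pose good := [pred n : types N | (\sum_r n r == N)%N].
apply: (@le_trans _ _ (\sum_(n | good n) \sum_(X : config q N)
   \prod_(i < N) ((n (X i))%:R / N%:R))).
  rewrite exchange_big /=; apply: ler_sum => X _.
  have ltc r : (#|[set i | X i == r]%SET| < N.+1)%N.
    by rewrite ltnS; apply: leq_trans (max_card _) _; rewrite card_ord.
  rewrite (bigD1 [ffun r => Ordinal (ltc r)]) /=; last first.
    by under eq_bigr do rewrite ffunE /=; rewrite sum_count.
  rewrite ler_wpDr //.
    by apply: sumr_ge0 => n _; apply: prodr_ge0 => i _; rewrite divr_ge0.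
  rewrite le_eqVlt; apply/orP; left; apply/eqP; apply: eq_bigr => i _.
  by rewrite ffunE /= mxE.
rewrite (eq_bigr (fun=> 1)) => [|n /eqP nN].
  rewrite sumr_const -[leRHS]mulr1n ler_nat.
  by rewrite (leq_trans (max_card _)) // card_ffun !card_ord.
rewrite -(bigA_distr_bigA (fun _ r => (n r)%:R / N%:R)) /= prodr_const card_ord.
by rewrite -mulr_suml -natr_sum nN divff // expr1n.
Qed.

(** Each weight is the likelihood of [X] under independent colours of law [freq X], times
    [expR (N * Hfun (freq X))]; the sum of the likelihoods is polynomial in [N], and the
    partition function is at least [expR (N * Hfun m)]. *)
Lemma concentration (b : R) (m : 'rV[R]_q) (A : pred 'rV[R]_q) (g : R) N :
  0 <= b -> (0 < N)%N -> prob_vec m -> (forall r, 0 < m 0 r) ->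
  (forall z, prob_vec z -> A z -> Hfun p b h z <= Hfun p b h m - g) ->
  potts_expectation p b h (fun X : config q N => (A (freq X))%:R) <=
  (N.+1 ^ q)%:R * expR (- (N%:R * g)).
Proof.
move=> b0 N0 hm mpos hA.
have Z1 := partition_function_ge b0 N0 hm mpos.
set Z := \sum_(X : config q N) weight p b h X in Z1.
have Z0 : 0 < Z by apply: lt_le_trans Z1; exact: expR_gt0.
have -> : potts_expectation p b h (fun X : config q N => (A (freq X))%:R) =
    (\sum_(X : config q N) weight p b h X * (A (freq X))%:R) / Z.
  by rewrite mulr_suml; apply: eq_bigr => X _; rewrite /potts -/Z; ring.
rewrite ler_pdivrMr //.
apply: (@le_trans _ _ ((N.+1 ^ q)%:R * expR (- (N%:R * g)) *
   expR (N%:R * Hfun p b h m))); last first.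
  by rewrite ler_pM2l // mulr_gt0 ?expR_gt0 // ltr0n expn_gt0.
rewrite -mulrA -expRD.
have -> : - (N%:R * g) + N%:R * Hfun p b h m = N%:R * (Hfun p b h m - g) by ring.
apply: (@le_trans _ _ ((\sum_(X : config q N) \prod_(i < N) freq X 0 (X i)) *
   expR (N%:R * (Hfun p b h m - g)))); last first.
  by rewrite ler_wpM2r ?expR_ge0 // sum_empirical_likelihood.
rewrite mulr_suml; apply: ler_sum => X _.
have prod0 : 0 <= \prod_(i < N) freq X 0 (X i) :> R.
  by apply: prodr_ge0 => i _; exact: freq_ge0.
have [AX|] := boolP (A (freq X)); last by rewrite mulr0 mulr_ge0 ?expR_ge0.
rewrite mulr1 weightE.
have fpos i : 0 < freq X 0 (X i) :> R.
  rewrite mxE divr_gt0 ?ltr0n // lt0n; apply/eqP => /cards0_eq/setP/(_ i).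
  by rewrite !inE eqxx.
have -> : \prod_(i < N) freq X 0 (X i) = expR (N%:R * \sum_r freq X 0 r * ln (freq X 0 r : R)).
  under eq_bigr => i _ do rewrite -[freq X 0 (X i)]lnK ?posrE //.
  rewrite -expR_sum (sum_sites X (fun r => ln (freq X 0 r : R)) N0).
  by congr (expR (_ * _)); apply: eq_bigr => r _; rewrite mulrC.
rewrite -expRD ler_expR -mulrDr ler_wpM2l //.
by have := hA _ (freq_prob_vec X N0) AX; rewrite /Hfun -/(energy p h b (freq X)); lra.
Qed.

End concentration.

(** * The gap of the unique maximizer *)

Section gap.
Context {R : realType}.

Lemma continuous_sum (T : topologicalType) (I : Type) (r : seq I) (P : pred I)
    (f : I -> T -> R) :
  (forall i, continuous (f i)) -> continuous (fun x => \sum_(i <- r | P i) f i x).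
Proof.
move=> cf x; elim: r => [|i r IH].
  have -> : (fun x => \sum_(i <- [::] | P i) f i x) = cst 0.
    by apply/funext => y; rewrite big_nil.
  exact: cvg_cst.
have -> : (fun x => \sum_(j <- i :: r | P j) f j x) =
    (fun x => if P i then f i x + \sum_(j <- r | P j) f j x
              else \sum_(j <- r | P j) f j x).
  by apply/funext => y; rewrite big_cons.
by case: (P i) => //; apply: cvgD => //; exact: cf.
Qed.

(** Continuity of [x * ln x] at 0 is the only point at stake in that of [Hfun]. *)
Lemma xlnx_le_sqrt (x : R) : 0 < x -> x <= 1 -> `|x * ln x| <= 2 * Num.sqrt x.
Proof.
move=> x0 x1; set w := Num.sqrt x.
have w0 : 0 < w by rewrite sqrtr_gt0.
have w2 : w ^+ 2 = x by rewrite sqr_sqrtr // ltW.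
rewrite -w2 lnXn // mulr2n.
have lnw : ln w <= 0 by apply: ln_le0; rewrite -sqrtr1 ler_wsqrtr.
have h : - ln w < w^-1 by rewrite -lnV // ln_sublinear // invr_gt0.
have h2 : - (w * ln w) <= 1.
  by rewrite -mulrN -(mulfV (lt0r_neq0 w0)) ler_pM2l // ltW.
have h3 : 0 <= - (w * ln w) by rewrite -mulrN; apply: mulr_ge0; rewrite ?oppr_ge0 // ltW.
have -> : w ^+ 2 * (ln w + ln w) = - (2 * w * - (w * ln w)) by ring.
have w20 : 0 < 2 * w by rewrite mulr_gt0.
by rewrite normrN normrM (gtr0_norm w20) (ger0_norm h3) -[leRHS]mulr1 ler_pM2l.
Qed.

Lemma continuous_xlnx : continuous (fun x : R => x * ln x).
Proof.
move=> x; have [x0|x0|->] := ltgtP x 0.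
- suff E : \near x, (cst 0 : R -> R) x = x * ln x.
    by apply: cvg_trans (near_eq_cvg E) _; rewrite (ln0 (ltW x0)) mulr0; exact: cvg_cst.
  near=> y; rewrite ln0 ?mulr0 //; apply/ltW; near: y; exact: lt_nbhsl.
- by apply: cvgM; [exact: cvg_id | exact: continuous_ln].
- rewrite /continuous_at mul0r; apply/cvgr0Pnorm_lt => e e0; near=> y.
  have [y0|y0] := leP y 0; first by rewrite ln0 // mulr0 normr0.
  apply: le_lt_trans (xlnx_le_sqrt y0 _) _.
    by apply: ltW; near: y; apply: lt_nbhsl; exact: ltr01.
  have -> : e = 2 * Num.sqrt ((e / 2) ^+ 2).
    by rewrite sqrtr_sqr gtr0_norm ?divr_gt0 // mulrC divfK.
  rewrite ltr_pM2l // ltr_sqrt ?exprn_gt0 ?divr_gt0 //.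
  by near: y; apply: lt_nbhsl; rewrite exprn_gt0 // divr_gt0.
Unshelve. all: end_near. Qed.

Lemma continuous_coord q (r : 'I_q) : continuous (fun z : 'rV[R]_q => z 0 r).
Proof. exact: coord_continuous. Qed.

Section continuous_operations.
Variables (T : topologicalType) (f g : T -> R).
Hypotheses (cf : continuous f) (cg : continuous g).

Lemma ctD : continuous (fun x => f x + g x).
Proof. by move=> x; apply: cvgD; [exact: cf|exact: cg]. Qed.

Lemma ctB : continuous (fun x => f x - g x).
Proof. by move=> x; apply: cvgB; [exact: cf|exact: cg]. Qed.

Lemma ctM : continuous (fun x => f x * g x).
Proof. by move=> x; apply: cvgM; [exact: cf|exact: cg]. Qed.

Lemma ct_comp (k : R -> R) : continuous k -> continuous (fun x => k (f x)).
Proof. by move=> ck x; apply: cvg_comp; [exact: cf|exact: ck]. Qed.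

End continuous_operations.

Lemma ct_cst (T : topologicalType) (a : R) : continuous (fun _ : T => a).
Proof. by move=> x; exact: cvg_cst. Qed.

Lemma ctX n : continuous (fun x : R => x ^+ n).
Proof. exact: exprn_continuous. Qed.

Lemma continuous_Hfun p q (b h : R) : continuous (@Hfun R p q b h).
Proof.
have cc := @continuous_coord q.
apply: ctB; last first.
  by apply: continuous_sum => r; exact: (ct_comp (cc r) continuous_xlnx).
apply: ctD; apply: ctM; try exact: ct_cst.
  by apply: continuous_sum => r; exact: (ct_comp (cc r) (@ctX p)).
by apply: continuous_sum => r.
Qed.

Definition dist2 q (z m : 'rV[R]_q) : R := \sum_r (z 0 r - m 0 r) ^+ 2.

(** Compactness of the simplex minus a ball around the maximizer. *)
Lemma maximizer_gap p q (b h : R) (m : 'rV[R]_q) (d : R) : 0 < d ->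
  unique_global_maximizer p b h m ->
  exists2 g, 0 < g & forall z, prob_vec z -> d <= dist2 z m ->
    Hfun p b h z <= Hfun p b h m - g.
Proof.
move=> d0 [[hm maxm] uniqm].
pose A := [set z : 'rV[R]_q | prob_vec z /\ d <= dist2 z m].
have cc := @continuous_coord q.
have cA : compact A.
  apply: (@subclosed_compact _ _ [set v : 'rV[R]_q | forall i, `[(0 : R), 1]%classic (v ord0 i)]).
  - have -> : A = (\bigcap_(r in [set: 'I_q]) [set z : 'rV[R]_q | 0 <= z 0 r]) `&`
        [set z | \sum_r z 0 r = 1] `&` [set z | d <= dist2 z m].
      apply/seteqP; split => z.
        by move=> [[z0 z1] dz]; split => //; split => // r _; exact: z0.
      by move=> [[z0 z1] dz]; split => //; split=> // r; exact: z0.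
    apply: closedI; first apply: closedI.
    + apply: closed_bigI => r _.
      exact: (@closed_comp _ _ (fun z : 'rV[R]_q => z 0 r) [set x | 0 <= x]
        (fun z _ => cc r z) (@closed_ge _ _)).
    + apply: (@closed_comp _ _ (fun z : 'rV[R]_q => \sum_r z 0 r) [set x | x = 1]).
        by move=> z _; apply: continuous_sum => r; exact: cc.
      exact: closed_eq.
    + apply: (@closed_comp _ _ (fun z : 'rV[R]_q => dist2 z m) [set x | d <= x]).
        move=> z _; apply: continuous_sum => r; apply: (ct_comp _ (@ctX 2)).
        by apply: ctB; [exact: cc | exact: ct_cst].
      exact: closed_ge.
  - by apply: (@rV_compact _ _ (fun=> `[(0 : R), 1]%classic)) => _; exact: segment_compact.
  - move=> z [[z0 z1] _] r; rewrite /= in_itv /= z0 -z1 (bigD1 r) //= lerDl.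
    by apply: sumr_ge0.
have [[z0 Az0]|A0] := pselect (A !=set0); last first.
  by exists 1 => // z hz dz; exfalso; apply: A0; exists z.
have [||c cAc cmax] := @EVT_max_rV R q (Hfun p b h) A _ cA.
- by exists z0.
- by apply: continuous_subspaceT; exact: continuous_Hfun.
move: cAc; rewrite inE => -[hc dc].
have lt : Hfun p b h c < Hfun p b h m.
  rewrite lt_neqAle maxm // andbT; apply/eqP => E.
  have cm : c = m by apply: uniqm; split=> // t ht; rewrite E; exact: maxm.
  move: dc; rewrite cm /dist2 big1 ?leNgt ?d0 // => r _.
  by rewrite subrr expr0n.
exists (Hfun p b h m - Hfun p b h c); first by rewrite subr_gt0.
move=> z hz dz; rewrite opprB addrC subrK; apply: cmax; rewrite inE; split=> //.
Qed.

End gap.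

(** * Laws with a density *)

Section density.
Context {R : realType}.
Local Notation mu := (@lebesgue_measure R).
Variable g : R -> R.
Hypotheses (g0 : forall x, 0 <= g x) (gi : mu.-integrable setT (EFin \o g)).
Hypothesis gpos : 0 < \int[mu]_x g x.

Local Notation Z := (\int[mu]_x g x).
Local Notation w := (fun x => g x / Z).

Let wi : mu.-integrable setT (EFin \o w).
Proof.
have -> : EFin \o w = (fun x => (Z^-1)%:E * (EFin \o g) x)%E.
  by apply/funext => x /=; rewrite -EFinM mulrC.
exact: integrableZl.
Qed.

Let w0 x : 0 <= w x. Proof. by rewrite divr_ge0 // ltW. Qed.

Let law0 : law_of_density g set0 = 0%E.
Proof. by rewrite /law_of_density integral_set0. Qed.

Let law_ge0 A : (0 <= law_of_density g A)%E.
Proof. by apply: integral_ge0 => x _; rewrite lee_fin. Qed.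

Let law_additive : semi_sigma_additive (law_of_density g).
Proof.
move=> /= A mA tA mUA.
rewrite /law_of_density/= integral_bigcup//=; last first.
  by apply: (integrableS _ _ (subsetT _)).
apply: is_cvg_ereal_nneg_natsum_cond => n _ _.
by apply: integral_ge0 => /= x ?; rewrite lee_fin.
Qed.

Let lawT : law_of_density g setT = 1%E.
Proof.
rewrite /law_of_density.
have -> : (\int[mu]_x (w x)%:E = (Z^-1)%:E * \int[mu]_x (g x)%:E)%E.
  by rewrite -integralZl //=; apply: eq_integral => x _; rewrite -EFinM mulrC.
rewrite -[X in (_ * X)%E]fineK; last exact: integrable_fin_num.
by rewrite -EFinM mulVf // gt_eqF.
Qed.

Lemma law_of_density_probability :
  exists P : probability (measurableTypeR R) R, law_of_density g = P.
Proof.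
pose m : {measure set (measurableTypeR R) -> \bar R} :=
  HB.pack (law_of_density g) (isMeasure.Build _ _ _ (law_of_density g) law0 law_ge0 law_additive).
pose P : probability (measurableTypeR R) R :=
  HB.pack (law_of_density g) (Measure.class m) (Measure_isProbability.Build _ _ _ m lawT).
by exists P.
Qed.

Lemma ge0_integral_law (f : R -> \bar R) : measurable_fun setT f -> (forall x, 0 <= f x)%E ->
  (\int[law_of_density g]_x f x = \int[mu]_x (f x * (w x)%:E))%E.
Proof.
move=> mf f0; have [P PE] := law_of_density_probability.
have mw : measurable_fun setT (EFin \o w) by apply: measurable_int wi.
have dom : P `<< mu.
  apply/null_content_dominatesP => A mA muA.
  rewrite -PE; apply: null_set_integral => //=; exact: measurable_funTS.
rewrite PE -(Radon_Nikodym_SigmaFinite.change_of_variables dom) //.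
apply: ae_eq_integral => //=.
- apply: emeasurable_funM => //.
  by apply: (measurable_int mu); exact: Radon_Nikodym_SigmaFinite.f_integrable.
- exact: emeasurable_funM.
- apply: ae_eqe_mul2l.
  apply: integral_ae_eq => //=.
  + exact: Radon_Nikodym_SigmaFinite.f_integrable.
  + by move=> A _ mA; rewrite -Radon_Nikodym_SigmaFinite.f_integral //= -PE.
Qed.

Lemma integral_law (f : R -> R) : measurable_fun setT f ->
  mu.-integrable setT (EFin \o (fun x => f x * g x)) ->
  (\int[law_of_density g]_x (f x)%:E = ((\int[mu]_x (f x * g x)) / Z)%:E)%E.
Proof.
move=> mf fi.
have fwi : mu.-integrable setT (EFin \o (fun x => f x * w x)).
  have -> : EFin \o (fun x => f x * w x) =
      (fun x => (Z^-1)%:E * (EFin \o (fun x => (f x * g x)%R)) x)%E.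
    by apply/funext => x /=; rewrite -EFinM; congr EFin; ring.
  exact: integrableZl.
have mf' : measurable_fun setT (EFin \o f) by exact/measurable_EFinP.
have [P PE] := law_of_density_probability.
have -> : (\int[law_of_density g]_x (f x)%:E =
    \int[law_of_density g]_x ((EFin \o f)^\+ x) -
    \int[law_of_density g]_x ((EFin \o f)^\- x))%E by rewrite PE; exact: integralE.
rewrite !ge0_integral_law //; last 2 first.
- exact: measurable_funeneg.
- exact: measurable_funepos.
have -> : (\int[mu]_x ((EFin \o f)^\+ x * (w x)%:E) =
    \int[mu]_x ((EFin \o (fun x => (f x * w x)%R))^\+ x))%E.
  apply: eq_integral => x _; rewrite !funeposE /= -!EFin_max -EFinM; congr EFin.
  by rewrite maxr_pMl ?mul0r.
have -> : (\int[mu]_x ((EFin \o f)^\- x * (w x)%:E) =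
    \int[mu]_x ((EFin \o (fun x => (f x * w x)%R))^\- x))%E.
  apply: eq_integral => x _; rewrite !funenegE /= -!EFin_max -EFinM; congr EFin.
  by rewrite maxr_pMl ?mul0r // mulNr.
rewrite -integralE.
have -> : (\int[mu]_x (EFin \o (fun x => (f x * w x)%R)) x =
    (Z^-1)%:E * \int[mu]_x (f x * g x)%R%:E)%E.
  by rewrite -integralZl //=; apply: eq_integral => x _; rewrite -EFinM; congr EFin; ring.
rewrite -[X in (_ * X)%E]fineK; last exact: integrable_fin_num.
by rewrite -EFinM mulrC.
Qed.

Lemma law_of_densityE (A : set (measurableTypeR R)) : measurable A ->
  law_of_density g A = ((\int[mu]_(x in A) g x) / Z)%:E.
Proof.
move=> mA; have giA : mu.-integrable A (EFin \o g) by exact: integrableS gi.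
rewrite /law_of_density.
have -> : (\int[mu]_(x in A) (w x)%:E = (Z^-1)%:E * \int[mu]_(x in A) (g x)%:E)%E.
  by rewrite -integralZl //=; apply: eq_integral => x _; rewrite -EFinM mulrC.
rewrite -[X in (_ * X)%E]fineK; last exact: integrable_fin_num.
by rewrite -EFinM mulrC.
Qed.

End density.

(** * Exponential densities *)

Section exponential_density.
Context {R : realType}.
Local Notation mu := (@lebesgue_measure R).

Definition edens (c e : R) (d : nat) (x : R) : R := expR (- (c * x ^+ d) + e * x).

Lemma edens_gt0 c e d x : 0 < edens c e d x.
Proof. exact: expR_gt0. Qed.

Lemma edens_ge0 c e d x : 0 <= edens c e d x.
Proof. exact: expR_ge0. Qed.

Lemma measurable_ct (f : R -> R) : continuous f -> measurable_fun setT f.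
Proof. exact: continuous_measurable_fun. Qed.

Lemma integrable_dominated (f : R -> R) C : measurable_fun setT f ->
  (forall x, `|f x| <= C * gauss_fun x) -> mu.-integrable setT (EFin \o f).
Proof.
move=> mf fC; apply: (@le_integrable _ _ _ mu setT measurableT (EFin \o f)
  (fun x => C%:E * (EFin \o @gauss_fun R) x)%E).
- exact/measurable_EFinP.
- move=> x _ /=; rewrite lee_fin (le_trans (fC x)) // -[leLHS]ger0_norm //.
  exact: le_trans (normr_ge0 _) (fC x).
- by apply: integrableZl => //; exact: integrableT_gauss.
Qed.

(** The quartic term dominates; the polynomial weight is absorbed by [1 + y <= expR y]. *)
Lemma edens_bound (c : R) (d : nat) (E : R) : 0 < c -> ~~ odd d -> (4 <= d)%N -> 0 <= E ->
  exists2 C, 0 < C & forall x e : R, `|e| <= E ->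
    (1 + x ^+ 2) ^+ 2 * edens c e d x <= C * gauss_fun x.
Proof.
move=> c0 od d4 E0.
exists (expR (E + c + (3 + E) ^+ 2 / (4 * c))) => [|x e eE]; first exact: expR_gt0.
have [j jd] : exists j, d = (2 * j.+2)%N.
  have := odd_double_half d; rewrite (negPf od) add0n => dE.
  exists (d./2 - 2)%N; rewrite -{1}dE -mul2n; congr muln.
  by rewrite -[in RHS]addn2 subnK // (half_leq d4).
rewrite jd /edens /gauss_fun exprM; set y := x ^+ 2.
have y0 : 0 <= y by exact: sqr_ge0.
have yj : y ^+ 2 - 1 <= y ^+ j.+2.
  have [y1|y1] := leP 1 y.
    by rewrite (le_trans _ (ler_weXn2l y1 (_ : 2 <= j.+2)%N)) // lerBlDr lerDl.
  have : 0 <= y ^+ j.+2 by exact: exprn_ge0.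
  have : y ^+ 2 <= 1 by rewrite exprn_ile1 // ltW.
  lra.
have ex : e * x <= E + E * y.
  have : e * x <= `|e| * `|x| by rewrite -normrM ler_norm.
  have : `|e| * `|x| <= E * `|x| by rewrite ler_wpM2r.
  have : E * `|x| <= E * (1 + y).
    rewrite ler_wpM2l // /y -(real_normK (num_real x)).
    have : 0 <= (`|x| - 1) ^+ 2 by exact: sqr_ge0.
    by have := normr_ge0 x; nra.
  lra.
have poly : (1 + y) ^+ 2 <= expR (2 * y).
  have -> : 2 * y = y + y by ring.
  rewrite expRD expr2; apply: ler_pM; try exact: expR_ge1Dx; lra.
apply: (@le_trans _ _ (expR (2 * y) * expR (- (c * y ^+ j.+2) + e * x))).
  by rewrite ler_wpM2r ?expR_ge0.
rewrite -!expRD ler_expR.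
have sq : 3 * y + E * y <= c * y ^+ 2 + (3 + E) ^+ 2 / (4 * c).
  have -> : (3 + E) ^+ 2 / (4 * c) = ((3 + E) / (2 * c)) ^+ 2 * c.
    by field; rewrite gt_eqF.
  have E2 : (3 + E) / (2 * c) * (2 * c) = 3 + E by rewrite divfK // gt_eqF // mulr_gt0.
  move: E2; set u := _ / _ => E2.
  have : 0 <= c * (y - u) ^+ 2 by rewrite mulr_ge0 ?sqr_ge0 // ltW.
  have -> : 3 * y + E * y = u * (2 * c) * y by rewrite E2; ring.
  lra.
have : c * (y ^+ 2 - 1) <= c * y ^+ j.+2 by rewrite ler_pM2l.
lra.
Qed.

Section fixed_density.
Variables (c e : R) (d : nat).
Hypotheses (c0 : 0 < c) (od : ~~ odd d) (d4 : (4 <= d)%N).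
Local Notation w := (edens c e d).

Lemma ct_edens : continuous w.
Proof.
apply: (ct_comp _ (@continuous_expR R)); apply: ctD.
  move=> x; apply: cvgN; move: x; apply: ctM; [exact: ct_cst | exact: ctX].
by apply: ctM; [exact: ct_cst | move=> x; exact: cvg_id].
Qed.

(** Growth of order four leaves room to control truncations of integrands of quadratic
    growth. *)
Lemma integrable_edens (f : R -> R) C : measurable_fun setT f ->
  (forall x, `|f x| <= C * (1 + x ^+ 2) ^+ 2) ->
  mu.-integrable setT (EFin \o (fun x => f x * w x)).
Proof.
move=> mf fC.
have [D D0 HD] := edens_bound c0 od d4 (normr_ge0 e).
have C0 : 0 <= C by have := le_trans (normr_ge0 _) (fC 0); rewrite expr0n addr0 expr1n mulr1.
apply: (@integrable_dominated _ (C * D)).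
  by apply: measurable_funM => //; apply: measurable_ct; exact: ct_edens.
move=> x; rewrite normrM (ger0_norm (edens_ge0 _ _ _ _)).
apply: (@le_trans _ _ (C * ((1 + x ^+ 2) ^+ 2 * w x))).
  by rewrite mulrA ler_wpM2r // edens_ge0.
by rewrite -mulrA ler_wpM2l // HD.
Qed.

Lemma integrable_edens1 : mu.-integrable setT (EFin \o w).
Proof.
have -> : w = fun x => 1 * w x by apply/funext => x; rewrite mul1r.
apply: (@integrable_edens (fun=> 1) 1) => [|x]; first exact: measurable_cst.
rewrite normr1 mul1r; have := sqr_ge0 x; nra.
Qed.

Lemma Rintegral_ge_itv (f : R -> R) (a b m : R) : a <= b ->
  (forall x, 0 <= f x) -> mu.-integrable setT (EFin \o f) ->
  (forall x, a <= x <= b -> m <= f x) -> m * (b - a) <= \int[mu]_x f x.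
Proof.
move=> ab f0 fi fm.
have fiab : mu.-integrable `[a, b] (EFin \o f) by apply: integrableS fi.
apply: (@le_trans _ _ (\int[mu]_(x in `[a, b]) f x)).
  have -> : m * (b - a) = \int[mu]_(x in `[a, b]) m.
    have E : mu `[a, b]%classic = (b - a)%:E.
      rewrite lebesgue_measure_itv /= lte_fin.
      by case: ltgtP ab => // -> _; rewrite subrr.
    by rewrite Rintegral_cst //; congr (_ * _); rewrite [X in fine X]E.
  apply: le_Rintegral => //.
  apply: (@continuous_compact_integrable _ (fun=> m)); first exact: segment_compact.
  by apply: continuous_subspaceT => x; exact: cvg_cst.
rewrite Rintegral_mkcond; apply: le_Rintegral => //.
- have := (integrable_mkcond (mu := mu) (EFin \o f) (measurable_itv `[a, b])).1 fiab.
  by rewrite restrict_EFin.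
- by move=> x _; rewrite patchE; case: ifP.
Qed.

Lemma Rintegral_edens_gt0 : 0 < \int[mu]_x w x.
Proof.
have := @Rintegral_ge_itv w 0 1 (expR (- c - `|e|)) ler01 (edens_ge0 _ _ _) integrable_edens1.
move=> H; apply: (lt_le_trans _ (H _)); first by rewrite subr0 mulr1 expR_gt0.
move=> x /andP[x0 x1]; rewrite ler_expR lerD //.
  by rewrite lerN2 ler_piMr ?(ltW c0) // exprn_ile1.
have : - (`|e| * `|x|) <= e * x by rewrite -normrM lerNl -normrN ler_norm.
have : `|e| * `|x| <= `|e| by rewrite (ger0_norm x0) ler_piMr.
lra.
Qed.

End fixed_density.
End exponential_density.

(** * Cutoff functions *)

Section clamp.
Context {R : realType}.

(** The projection of the line onto the unit interval. *)
Definition clamp (y : R) : R := (1 + `|y| - `|y - 1|) / 2.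

Variant clamp_spec (y : R) : R -> Type :=
  | ClampLow of y <= 0 : clamp_spec y 0
  | ClampMid of 0 <= y <= 1 : clamp_spec y y
  | ClampHigh of 1 <= y : clamp_spec y 1.

Lemma clampP y : clamp_spec y (clamp y).
Proof.
rewrite /clamp; have [y0|y0] := leP y 0.
  rewrite ler0_norm // ler0_norm; last by lra.
  by rewrite (_ : _ / 2 = 0); [exact: ClampLow | lra].
rewrite gtr0_norm //; have [y1|y1] := leP y 1.
  rewrite ler0_norm; last by lra.
  have -> : (1 + y - - (y - 1)) / 2 = y by lra.
  by apply: ClampMid; rewrite y1 ltW.
rewrite gtr0_norm; last by lra.
by rewrite (_ : _ / 2 = 1); [apply: ClampHigh; exact: ltW | lra].
Qed.

Lemma clamp_ge0 y : 0 <= clamp y.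
Proof. by case: clampP => //; lra. Qed.

Lemma clamp_le1 y : clamp y <= 1.
Proof. by case: clampP => //; lra. Qed.

Lemma clamp0 y : y <= 0 -> clamp y = 0.
Proof. by case: clampP => // hy; lra. Qed.

Lemma clamp1 y : 1 <= y -> clamp y = 1.
Proof. by case: clampP => // hy; lra. Qed.

Lemma clamp_lipschitz u v : `|clamp u - clamp v| <= `|u - v|.
Proof.
by case: (clampP u) => hu; case: (clampP v) => hv; rewrite ?subrr ?normr0 //;
  rewrite ler_norml; apply/andP; split;
  (have := ler_norm (u - v); have := ler_norm (v - u); rewrite (distrC v u); lra).
Qed.

Lemma ct_norm : continuous (fun y : R => `|y|).
Proof. exact: norm_continuous. Qed.

Lemma ct_id : continuous (fun y : R => y).
Proof. by move=> y; exact: cvg_id. Qed.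

Lemma ct_clamp : continuous clamp.
Proof.
apply: ctM; last exact: ct_cst.
apply: ctB; first by apply: ctD; [exact: ct_cst | exact: ct_norm].
by apply: (ct_comp _ ct_norm); apply: ctB; [exact: ct_id | exact: ct_cst].
Qed.

End clamp.

(** * Stein's method for exponential densities *)

Section compact_support.
Context {R : realType}.
Local Notation mu := (@lebesgue_measure R).

Definition vanishes_beyond (M : R) (k : R -> R) := forall y, M <= `|y| -> k y = 0.

Lemma integrable_compact (k : R -> R) M : continuous k -> vanishes_beyond M k ->
  mu.-integrable setT (EFin \o k).
Proof.
move=> ck kM.
have ki : mu.-integrable `[- M, M] (EFin \o k).
  apply: continuous_compact_integrable; first exact: segment_compact.
  exact: continuous_subspaceT.
have := (integrable_mkcond (mu := mu) (EFin \o k) (measurable_itv `[- M, M])).1 ki.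
rewrite restrict_EFin; congr (_.-integrable _ (_ \o _)); apply/funext => y.
rewrite patchE; case: ifPn => // /negP; rewrite inE /= in_itv /= -ler_norml => /negP.
by rewrite -ltNge => /ltW /kM.
Qed.

(** The primitive from [-oo]: it vanishes again on the right because the total integral is
    zero. *)
Lemma compact_primitive (k : R -> R) M : continuous k -> vanishes_beyond M k ->
  \int[mu]_y k y = 0 ->
  exists2 K : R -> R, (forall y : R, is_derive y (1 : R) K (k y)) & vanishes_beyond M K.
Proof.
move=> ck kM k0; have ki := integrable_compact ck kM.
exists (fun y => \int[mu]_(t in `]-oo, y]) k t).
  move=> y.
  have [|||K1 K2] := @continuous_FTC1 R k -oo%O y (y + 1) _ _ _ (ck y).
  - by rewrite ltrDl.
  - by apply: integrableS ki.
  - by rewrite ltNyr.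
  by apply: (DeriveDef K1); rewrite -derive1E; exact: K2.
move=> y My; rewrite Rintegral_mkcond.
have [y0|y0] := leP y 0.
  have -> : k \_ `]-oo, y] = cst 0.
    apply/funext => z; rewrite patchE; case: ifPn => //.
    rewrite inE /= in_itv /= => zy; apply: kM; apply: (le_trans My).
    by rewrite !ler0_norm ?lerN2 // (le_trans zy).
  by rewrite Rintegral_cst // mul0r.
have -> // : k \_ `]-oo, y] = k.
apply/funext => z; rewrite patchE; case: ifPn => // /negP.
rewrite inE /= in_itv /= => /negP; rewrite -ltNge => yz.
by apply/esym/kM; apply: (le_trans My); rewrite !gtr0_norm ?ltW // (lt_trans y0).
Qed.

End compact_support.

Section stein.
Context {R : realType}.
Local Notation mu := (@lebesgue_measure R).
Variables (T : nat -> finType) (P : forall N, T N -> R) (x : forall N, T N -> R).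
Hypothesis hP : forall N, is_dist (@P N).
Variables (c e : R) (d : nat).
Hypotheses (c0 : 0 < c) (od : ~~ odd d) (d4 : (4 <= d)%N).
Local Notation w := (edens c e d).
Local Notation V' y := (c * (d%:R * y ^+ d.-1) - e).

Hypothesis stein_id : forall (G dG : R -> R) M,
  (forall y : R, is_derive y (1 : R) G (dG y)) -> continuous dG -> vanishes_beyond M G ->
  fexp (@P N) (fun X => dG (x X) - V' (x X) * G (x X)) @[N --> \oo] --> (0 : R).

(** With [K] a primitive of [k], the test function [K / w] satisfies
    [(K / w)' - V' * (K / w) = k / w], since [w' = - V' * w]. *)
Lemma stein_bump (k : R -> R) M : continuous k -> vanishes_beyond M k ->
  \int[mu]_y k y = 0 ->
  fexp (@P N) (fun X => k (x X) / w (x X)) @[N --> \oo] --> (0 : R).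
Proof.
move=> ck kM k0; have [K dK KM] := compact_primitive ck kM k0.
pose U y := expR (c * y ^+ d - e * y).
have dU (y : R) : is_derive y (1 : R) U (U y * V' y).
  apply: (@dv_exp _ (fun y => c * y ^+ d - e * y)).
  by apply: dvB; [apply: dvZ; exact: dvX | apply: dv_eq (dvZ _ (dv_id _)) _; rewrite mulr1].
have Uw y : U y * w y = 1.
  by rewrite /U /edens -expRD -[RHS]expR0; congr expR; ring.
pose dG y := k y * U y + K y * (U y * V' y).
have ctK : continuous K by move=> y; exact: dv_continuous (dK y).
have ctU : continuous U by move=> y; exact: dv_continuous (dU y).
have ctV : continuous (fun y : R => V' y).
  apply: ctB; last exact: ct_cst.
  apply: ctM; first exact: ct_cst.
  by apply: ctM; [exact: ct_cst | exact: ctX].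
have := @stein_id (fun y => K y * U y) dG M.
have -> : (fun N => fexp (@P N) (fun X => dG (x X) - V' (x X) * (K (x X) * U (x X)))) =
    (fun N => fexp (@P N) (fun X => k (x X) / w (x X))).
  apply/funext => N; congr fexp; apply/funext => X.
  rewrite /dG; have wn0 : w (x X) != 0 by rewrite gt_eqF // edens_gt0.
  by apply: (mulIf wn0); rewrite divfK // -[RHS]mulr1 -(Uw (x X)); ring.
apply.
- by move=> y; exact: dvM.
- by apply: ctD; apply: ctM => //; exact: ctM.
- by move=> y /KM ->; rewrite mul0r.
Qed.

Lemma measurable_compact (F : R -> R) M : continuous F -> vanishes_beyond M F ->
  mu.-integrable setT (EFin \o (fun y => F y * w y)).
Proof.
move=> cF FM; apply: (@integrable_compact _ _ M).
  by apply: ctM => //; exact: ct_edens.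
by move=> y /FM ->; rewrite mul0r.
Qed.

(** The combination of [F * w] and [F0 * w] whose integral is zero is fed to
    [stein_bump]; comparing with a cutoff [F0] close to 1 will determine the limit. *)
Lemma stein_pair (F F0 : R -> R) M : continuous F -> continuous F0 ->
  vanishes_beyond M F -> vanishes_beyond M F0 ->
  fexp (@P N) (fun X => F (x X)) * (\int[mu]_y (F0 y * w y)) -
  fexp (@P N) (fun X => F0 (x X)) * (\int[mu]_y (F y * w y)) @[N --> \oo] --> (0 : R).
Proof.
move=> cF cF0 FM F0M.
have Fi := measurable_compact cF FM; have F0i := measurable_compact cF0 F0M.
set a := \int[mu]_y (F y * w y); set a0 := \int[mu]_y (F0 y * w y).
pose k y := a0 * (F y * w y) - a * (F0 y * w y).
have cw : continuous w by exact: ct_edens.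
have := @stein_bump k M.
have -> : (fun N => fexp (@P N) (fun X => k (x X) / w (x X))) =
   (fun N => fexp (@P N) (fun X => F (x X)) * a0 - fexp (@P N) (fun X => F0 (x X)) * a).
  apply/funext => N; rewrite mulrC [_ * a]mulrC -!fexpZ -fexpB; congr fexp.
  apply/funext => X; rewrite /k; field.
  by rewrite gt_eqF // edens_gt0.
apply.
- by apply: ctB; apply: ctM; try exact: ct_cst; exact: ctM.
- by move=> y My; rewrite /k FM // F0M // !mul0r !mulr0 subrr.
- rewrite /k RintegralB //; last 2 first.
  + by have := @integrableZl _ _ _ mu setT measurableT a0 _ Fi.
  + by have := @integrableZl _ _ _ mu setT measurableT a _ F0i.
  by rewrite !RintegralZl // -/a -/a0 mulrC subrr.
Qed.

Definition cutoff (n : nat) (y : R) : R := clamp (n%:R + 1 - `|y|).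

Lemma ct_cutoff n : continuous (cutoff n).
Proof.
apply: (ct_comp _ ct_clamp).
by apply: ctB; [exact: ct_cst | exact: ct_norm].
Qed.

Lemma cutoff_vanishes n : vanishes_beyond (n%:R + 1) (cutoff n).
Proof. by move=> y ny; rewrite /cutoff; case: clampP => //; lra. Qed.

(** Quadratic growth, measured against fourth moments, gains a factor [1 / n] beyond [n]. *)
Lemma cutoff_error (F : R -> R) C n y : (forall y, `|F y| <= C * (1 + y ^+ 2)) ->
  `|F y - F y * cutoff n y| <= 4 * C / n.+1%:R * (1 + y ^+ 4).
Proof.
move=> FC; have C0 : 0 <= C.
  by have := le_trans (normr_ge0 _) (FC 0); rewrite expr0n addr0 mulr1.
have n0 : 0 < n.+1%:R :> R by rewrite ltr0n.
have A0 : 0 <= 4 * C / n.+1%:R by rewrite divr_ge0 // mulr_ge0.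
have y4 : 0 <= 1 + y ^+ 4 by rewrite addr_ge0 // exprn_even_ge0.
have [yn|yn] := leP `|y| n%:R.
  rewrite /cutoff; case: clampP => [|h|_]; try lra.
    have -> : n%:R + 1 - `|y| = 1 by lra.
    by rewrite mulr1 subrr normr0 mulr_ge0.
  by rewrite mulr1 subrr normr0 mulr_ge0.
have -> : F y - F y * cutoff n y = F y * (1 - cutoff n y) by ring.
rewrite normrM; apply: (@le_trans _ _ (C * (1 + y ^+ 2))).
  rewrite -[leRHS]mulr1; apply: ler_pM => //.
  by rewrite ger0_norm ?subr_ge0 ?clamp_le1 // lerBlDr lerDl clamp_ge0.
rewrite -(ler_pM2r n0).
have -> : 4 * C / n.+1%:R * (1 + y ^+ 4) * n.+1%:R = C * (4 * (1 + y ^+ 4)).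
  by field; rewrite gt_eqF.
rewrite -mulrA ler_wpM2l //.
apply: (@le_trans _ _ ((1 + y ^+ 2) * (1 + `|y|))).
  by rewrite ler_wpM2l ?addr_ge0 ?sqr_ge0 // -natr1 addrC lerD2l ltW.
rewrite (_ : y ^+ 4 = `|y| ^+ 4) ?[in leLHS](_ : y ^+ 2 = `|y| ^+ 2); last 2 first.
- by rewrite real_normK ?num_real.
- by rewrite -[4%N]/(2 * 2)%N !exprM real_normK ?num_real.
have := normr_ge0 y; set u := `|y| => u0.
have [u1|u1] := leP u 1.
  have : u ^+ 2 <= 1 by rewrite exprn_ile1.
  have : u * u ^+ 2 <= 1 by rewrite -exprS exprn_ile1.
  have : 0 <= u ^+ 4 by exact: exprn_ge0.
  lra.
have u1' := ltW u1.
have : u <= u ^+ 4 by rewrite -{1}[u]expr1 ler_weXn2l.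
have : u ^+ 2 <= u ^+ 4 by rewrite ler_weXn2l.
have : u * u ^+ 2 <= u ^+ 4 by rewrite -exprS ler_weXn2l.
lra.
Qed.

Lemma quartic_bound (y : R) : 1 + y ^+ 2 <= 2 * (1 + y ^+ 4).
Proof.
have -> : y ^+ 4 = (y ^+ 2) ^+ 2 by rewrite -exprM.
have := sqr_ge0 y; have := sqr_ge0 (y ^+ 2 - 1); nra.
Qed.

Variable C4 : R.
Hypothesis moment4 : \forall N \near \oo, fexp (@P N) (fun X => x X ^+ 4) <= C4.

Lemma fexp_error (F1 F2 : R -> R) A N : fexp (@P N) (fun X => x X ^+ 4) <= C4 ->
  0 <= A -> (forall y, `|F1 y - F2 y| <= A * (1 + y ^+ 4)) ->
  `|fexp (@P N) (fun X => F1 (x X)) - fexp (@P N) (fun X => F2 (x X))| <= A * (1 + C4).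
Proof.
move=> m4 A0 HF; rewrite -fexpB.
apply: (le_trans (fexp_norm (hP N) _)).
apply: (le_trans (le_fexp (hP N) (fun X => HF (x X)))).
rewrite fexpZ ler_wpM2l // (fexpD (@P N) (fun=> 1)) fexp_cst //.
by rewrite lerD2l.
Qed.

Local Notation I4 := (\int[mu]_y ((1 + y ^+ 4) * w y)).

Lemma integrable_growth2 (F : R -> R) C : continuous F ->
  (forall y, `|F y| <= C * (1 + y ^+ 2)) ->
  mu.-integrable setT (EFin \o (fun y => F y * w y)).
Proof.
move=> cF FC; have C0 : 0 <= C.
  by have := le_trans (normr_ge0 _) (FC 0); rewrite expr0n addr0 mulr1.
apply: (@integrable_edens _ _ _ _ c0 od d4 F C); first exact: measurable_ct.
move=> y; apply: le_trans (FC y) _; rewrite ler_wpM2l //.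
have := sqr_ge0 y; nra.
Qed.

Lemma integrable_growth4 : mu.-integrable setT (EFin \o (fun y => (1 + y ^+ 4) * w y)).
Proof.
apply: (@integrable_edens _ _ _ _ c0 od d4 _ 1).
  by apply: measurable_ct; apply: ctD; [exact: ct_cst | exact: ctX].
move=> y; have -> : y ^+ 4 = (y ^+ 2) ^+ 2 by rewrite -exprM.
have := sqr_ge0 y; move: (y ^+ 2) => u u0.
by rewrite mul1r ger0_norm; nra.
Qed.

Lemma Rintegral_error (F1 F2 : R -> R) A :
  mu.-integrable setT (EFin \o (fun y => F1 y * w y)) ->
  mu.-integrable setT (EFin \o (fun y => F2 y * w y)) ->
  (forall y, `|F1 y - F2 y| <= A * (1 + y ^+ 4)) ->
  `|\int[mu]_y (F1 y * w y) - \int[mu]_y (F2 y * w y)| <= A * I4.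
Proof.
move=> i1 i2 HF; rewrite -RintegralB //.
have i12 : mu.-integrable setT (EFin \o (fun y => F1 y * w y - F2 y * w y)).
  by have := integrableB measurableT i1 i2.
apply: (le_trans (le_normr_Rintegral measurableT i12)).
rewrite -RintegralZl //; last exact: integrable_growth4.
apply: le_Rintegral => //.
- by have := integrable_norm i12.
- by have := @integrableZl _ _ _ mu setT measurableT A _ integrable_growth4.
- move=> y _; rewrite -mulrBl normrM (ger0_norm (edens_ge0 _ _ _ _)) mulrA.
  by rewrite ler_wpM2r ?edens_ge0.
Qed.

Lemma sum5_le (u1 u2 u3 u4 u5 b1 b2 b3 b5 eps : R) : `|u1| <= b1 -> `|u2| <= b2 ->
  `|u3| <= b3 -> `|u4| <= eps / 2 -> `|u5| <= b5 -> b1 + b2 + b3 + b5 <= eps / 2 ->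
  `|u1 + u2 + u4 - u3 - u5| <= eps.
Proof.
rewrite !ler_norml => /andP[? ?] /andP[? ?] /andP[? ?] /andP[? ?] /andP[? ?] ?.
by apply/andP; split; lra.
Qed.

(** Stein's identity, asymptotic along the laws [P], characterizes their limit: it gives
    the limit of every compactly supported continuous function up to a common factor
    ([stein_pair]), the factor is found from a cutoff close to 1, and the fourth moments
    remove the cutoff. *)
Theorem stein_cvg (F : R -> R) C : continuous F ->
  (forall y, `|F y| <= C * (1 + y ^+ 2)) ->
  fexp (@P N) (fun X => F (x X)) @[N --> \oo] -->
  (\int[mu]_y (F y * w y)) / \int[mu]_y w y.
Proof.
move=> cF FC; have C0 : 0 <= C.
  by have := le_trans (normr_ge0 _) (FC 0); rewrite expr0n addr0 mulr1.
have Fi := integrable_growth2 cF FC.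
have one1 y : `|1 : R| <= 1 * (1 + y ^+ 2) by rewrite normr1 mul1r lerDl sqr_ge0.
have wi := integrable_growth2 (@ct_cst _ _ 1) one1.
have Z0 : 0 < \int[mu]_y w y by exact: Rintegral_edens_gt0.
have wE : \int[mu]_y (1 * w y) = \int[mu]_y w y.
  by apply: eq_Rintegral => y _; rewrite mul1r.
set Z := \int[mu]_y w y in Z0 wE *; set a := \int[mu]_y (F y * w y).
have I40 : 0 <= I4.
  apply: Rintegral_ge0 => y _; rewrite mulr_ge0 ?edens_ge0 //.
  by rewrite addr_ge0 // exprn_even_ge0.
have D0 : 0 <= 1 + `|C4| by rewrite addr_ge0.
pose K := 4 * C * (1 + `|C4|) * Z + 2 * C * (1 + `|C4|) * (4 * I4) +
   4 * (1 + `|C4|) * (2 * C * I4) + 4 * C * I4.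
have K0 : 0 <= K by rewrite /K !addr_ge0 // !mulr_ge0 // ltW.
suff lim0 : fexp (@P N) (fun X => F (x X)) * Z - a @[N --> \oo] --> (0 : R).
  have -> : a / Z = (0 + a) / Z by rewrite add0r.
  have -> : (fun N => fexp (@P N) (fun X => F (x X))) =
      (fun N => ((fexp (@P N) (fun X => F (x X)) * Z - a) + a) / Z).
    by apply/funext => N; rewrite subrK mulfK // gt_eqF.
  by apply: cvgM; [apply: cvgD => //; exact: cvg_cst | exact: cvg_cst].
apply/cvgr0Pnorm_le => eps eps0.
pose n := Num.truncn (2 * K / eps).
have n0 : 0 < n.+1%:R :> R by rewrite ltr0n.
have Kn : K / n.+1%:R <= eps / 2.
  rewrite ler_pdivrMr // -ler_pdivrMl; last by rewrite divr_gt0.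
  rewrite invf_div mulrC mulrA [K * 2]mulrC -mulrA mulrA.
  by apply: ltW; exact: truncnS_gt.
pose Fn y := F y * cutoff n y.
have cFn : continuous Fn by apply: ctM => //; exact: ct_cutoff.
have Fnv : vanishes_beyond (n%:R + 1) Fn.
  by move=> y ny; rewrite /Fn cutoff_vanishes ?mulr0.
have Fn_le y : `|Fn y| <= C * (1 + y ^+ 2).
  rewrite normrM -[leRHS]mulr1; apply: ler_pM => //.
  by rewrite ger0_norm ?clamp_ge0 ?clamp_le1.
have cut_le y : `|cutoff n y| <= 1 * (1 + y ^+ 2).
  by rewrite ger0_norm ?clamp_ge0 // mul1r (le_trans (clamp_le1 _)) // lerDl sqr_ge0.
have Fni := integrable_growth2 cFn Fn_le.
have cuti := integrable_growth2 (@ct_cutoff n) cut_le.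
have errF y := cutoff_error n y FC.
have err1 y : `|1 - cutoff n y| <= 4 / n.+1%:R * (1 + y ^+ 4).
  have := cutoff_error n y one1; rewrite mul1r.
  by rewrite mulr1.
have A0 : 0 <= 4 * C / n.+1%:R by rewrite divr_ge0 // mulr_ge0.
have A1 : 0 <= 4 / n.+1%:R :> R by rewrite divr_ge0.
have aerr := Rintegral_error Fi Fni errF.
have Zerr := Rintegral_error wi cuti err1.
rewrite wE -/a in aerr Zerr.
set an := \int[mu]_y (Fn y * w y) in aerr *.
set Zn := \int[mu]_y (cutoff n y * w y) in Zerr *.
have an_le : `|an| <= 2 * C * I4.
  have := @Rintegral_error Fn (fun=> 0) (2 * C) Fni.
  have z0 : mu.-integrable setT (EFin \o (fun y => 0 * w y)).
    by rewrite (_ : _ \o _ = cst 0%E); [exact: integrable0 | apply/funext => y /=; rewrite mul0r].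
  have -> : \int[mu]_y (0 * w y) = 0.
    rewrite (_ : (fun y => _) = cst 0); last by apply/funext => y; rewrite mul0r.
    by rewrite Rintegral_cst // mul0r.
  rewrite subr0; apply => // y; rewrite subr0; apply: (le_trans (Fn_le y)).
  by rewrite [2 * C]mulrC -mulrA ler_wpM2l // quartic_bound.
near=> N.
have m4 : fexp (@P N) (fun X => x X ^+ 4) <= C4 by near: N.
have mC : 1 + C4 <= 1 + `|C4| by rewrite lerD2l ler_norm.
have eF := le_trans (fexp_error m4 A0 errF) (ler_wpM2l A0 mC).
have e1 := le_trans (fexp_error m4 A1 err1) (ler_wpM2l A1 mC).
have EFn : `|fexp (@P N) (fun X => Fn (x X))| <= 2 * C * (1 + `|C4|).
  have C20 : 0 <= 2 * C by rewrite mulr_ge0.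
  have := @fexp_error Fn (fun=> 0) (2 * C) N m4 C20.
  rewrite fexp_cst // subr0 => H; apply: le_trans (H _) (ler_wpM2l C20 mC) => y.
  rewrite subr0; apply: (le_trans (Fn_le y)).
  by rewrite [2 * C]mulrC -mulrA ler_wpM2l // quartic_bound.
have pair : `|fexp (@P N) (fun X => Fn (x X)) * Zn -
    fexp (@P N) (fun X => cutoff n (x X)) * an| <= eps / 2.
  near: N; have := stein_pair cFn (@ct_cutoff n) Fnv (@cutoff_vanishes n).
  by move/cvgr0Pnorm_le; apply; rewrite divr_gt0.
rewrite fexp_cst // in e1.
set f := fexp _ _ in eF *; set fn := fexp (@P N) (fun X => Fn (x X)) in eF EFn pair *.
set g := fexp _ _ in e1 pair.
have -> : f * Z - a = (f - fn) * Z + fn * (Z - Zn) + (fn * Zn - g * an) -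
   (1 - g) * an - (a - an) by ring.
have t1 : `|(f - fn) * Z| <= 4 * C / n.+1%:R * (1 + `|C4|) * Z.
  by rewrite normrM (gtr0_norm Z0) ler_pM2r.
have t2 : `|fn * (Z - Zn)| <= 2 * C * (1 + `|C4|) * (4 / n.+1%:R * I4).
  by rewrite normrM; apply: ler_pM.
have t3 : `|(1 - g) * an| <= 4 / n.+1%:R * (1 + `|C4|) * (2 * C * I4).
  by rewrite normrM; apply: ler_pM.
have KE : K / n.+1%:R = 4 * C / n.+1%:R * (1 + `|C4|) * Z +
   2 * C * (1 + `|C4|) * (4 / n.+1%:R * I4) +
   4 / n.+1%:R * (1 + `|C4|) * (2 * C * I4) + 4 * C / n.+1%:R * I4.
  by rewrite /K; field; rewrite gt_eqF.
by rewrite KE in Kn; exact: (sum5_le t1 t2 t3 pair aerr Kn).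
Unshelve. all: end_near. Qed.

End stein.

(** * Limits of distribution functions *)

Lemma sandwich (R : realType) (b eu el u l a eps : R) : b <= eu + eps / 3 ->
  el - eps / 3 <= b -> `|u - eu| <= eps / 3 -> `|l - el| <= eps / 3 ->
  u - l <= eps / 3 -> a <= u -> l <= a -> `|a - b| <= eps.
Proof.
rewrite !ler_norml => ? ? /andP[? ?] /andP[? ?] ? ? ?.
by apply/andP; split; lra.
Qed.

Section distribution_functions.
Context {R : realType}.
Local Notation mu := (@lebesgue_measure R).
Variables (c e : R) (d : nat).
Hypotheses (c0 : 0 < c) (od : ~~ odd d) (d4 : (4 <= d)%N).
Local Notation w := (edens c e d).
Variables (f : R -> R) (M : R).
Hypotheses (cf : continuous f) (fM : mu [set y | f y = M] = 0%E).

Definition ramp_above (n : nat) (u : R) : R := clamp (1 - u * n.+1%:R).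
Definition ramp_below (n : nat) (u : R) : R := clamp (- (u * n.+1%:R)).

Lemma ramp_above_ge n (u : R) : (u <= 0)%R%:R <= ramp_above n u.
Proof.
have [u0|u0] := leP u 0; rewrite /ramp_above ?clamp_ge0 //.
have : u * n.+1%:R <= 0 by rewrite mulr_le0_ge0.
by rewrite -[true%:R]/(1 : R); case: clampP => //; lra.
Qed.

Lemma ramp_below_le n (u : R) : ramp_below n u <= (u <= 0)%R%:R.
Proof.
have [u0|u0] := leP u 0; rewrite /ramp_below ?clamp_le1 //.
have : 0 <= u * n.+1%:R by rewrite mulr_ge0 // ltW.
by rewrite -[false%:R]/(0 : R); case: clampP => //; lra.
Qed.

Lemma ct_ramps n : continuous (fun y => ramp_above n (f y - M)) /\
  continuous (fun y => ramp_below n (f y - M)).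
Proof.
have cu : continuous (fun y => (f y - M) * n.+1%:R).
  by apply: ctM; [apply: ctB => //; exact: ct_cst | exact: ct_cst].
split; apply: (ct_comp _ (@ct_clamp R)).
  by apply: ctB => //; exact: ct_cst.
by move=> y; apply: cvgN; exact: cu.
Qed.

Lemma clamp_growth (g : R -> R) y : `|clamp (g y)| <= 1 * (1 + y ^+ 2).
Proof.
by rewrite ger0_norm ?clamp_ge0 // mul1r (le_trans (clamp_le1 _)) // lerDl sqr_ge0.
Qed.

Lemma ramp_gap_cvg :
  \int[mu]_y ((ramp_above n (f y - M) - ramp_below n (f y - M)) * w y) @[n --> \oo]
    --> (0 : R).
Proof.
pose h n y := (ramp_above n (f y - M) - ramp_below n (f y - M)) * w y.
have wi := integrable_edens1 e c0 od d4.
have ch n : continuous (h n).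
  apply: ctM; last exact: ct_edens.
  by apply: ctB; have [] := ct_ramps n.
have hw n y : `|h n y| <= w y.
  rewrite normrM (ger0_norm (edens_ge0 _ _ _ _)) ler_piMl ?edens_ge0 //.
  have := clamp_ge0 (1 - (f y - M) * n.+1%:R); have := clamp_le1 (1 - (f y - M) * n.+1%:R).
  have := clamp_ge0 (- ((f y - M) * n.+1%:R)); have := clamp_le1 (- ((f y - M) * n.+1%:R)).
  by rewrite /ramp_above /ramp_below ler_norml => *; apply/andP; split; lra.
have mA : measurable [set y | f y = M].
  have -> : [set y | f y = M] = f @^-1` [set M] by [].
  by rewrite -[X in measurable X]setTI; apply: (measurable_ct cf).
have hz y : f y <> M -> h n y @[n --> \oo] --> (0 : R).
  move=> fy; have r0 : 0 < `|f y - M| by rewrite normr_gt0 subr_eq0; exact/eqP.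
  apply/cvgr0Pnorm_le => eps eps0; near=> n.
  have big : 1 <= `|f y - M| * n.+1%:R.
    rewrite mulrC -ler_pdivrMr // div1r.
    apply: (@le_trans _ _ n%:R); last by rewrite ler_nat.
    by near: n; exact: nbhs_infty_ger.
  suff -> : h n y = 0 by rewrite normr0 ltW.
  rewrite /h /ramp_above /ramp_below.
  have [fM0|fM0] := leP (f y - M) 0.
    rewrite ler0_norm // mulNr in big.
    by rewrite clamp1 ?clamp1 ?subrr ?mul0r //; lra.
  rewrite gtr0_norm // in big.
  by rewrite !clamp0 ?subrr ?mul0r //; lra.
have [] := @dominated_convergence _ _ _ mu setT measurableT
  (fun n => EFin \o h n) (cst 0%E) (EFin \o w).
- by move=> n; apply/measurable_EFinP; exact: measurable_ct.
- exact: measurable_cst.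
- exists [set y | f y = M]; split => // y /= Hy.
  apply: contrapT => fy; apply: Hy => _.
  by apply: cvg_EFin; [exact: nearW | exact: hz].
- exact: wi.
- by apply: aeW => y n _; rewrite lee_fin.
move=> _ _; rewrite integral_cst // mul0e => lim.
exact: (fine_cvg lim).
Unshelve. all: end_near. Qed.

Variables (T : nat -> finType) (P : forall N, T N -> R) (x : forall N, T N -> R).
Hypothesis hP : forall N, is_dist (@P N).
Hypothesis cvgF : forall (F : R -> R) C, continuous F ->
  (forall y, `|F y| <= C * (1 + y ^+ 2)) ->
  fexp (@P N) (fun X => F (x X)) @[N --> \oo] -->
  (\int[mu]_y (F y * w y)) / \int[mu]_y w y.
Variables (v : forall N, T N -> R) (MN : nat -> R).
Hypothesis vf : fexp (@P N) (fun X => `|v X - f (x X)|) @[N --> \oo] --> (0 : R).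
Hypothesis MNM : MN N @[N --> \oo] --> M.

(** The indicator of [v X <= MN N] is squeezed between continuous ramps in [f (x X) - M];
    they close in on the limit because the level set [f = M] is negligible. *)
Theorem cdf_cvg : fexp (@P N) (fun X => (v X <= MN N)%R%:R) @[N --> \oo] -->
  (\int[mu]_(y in [set y | f y <= M]) w y) / \int[mu]_y w y.
Proof.
pose up n y := ramp_above n (f y - M); pose lo n y := ramp_below n (f y - M).
have wi := integrable_edens1 e c0 od d4.
have Z0 : 0 < \int[mu]_y w y by exact: Rintegral_edens_gt0.
set Z := \int[mu]_y w y in Z0 *.
have mA : measurable [set y | f y <= M].
  have -> : [set y | f y <= M] = f @^-1` `]-oo, M]%classic.
    by apply/seteqP; split => y /=; rewrite in_itv.
  by rewrite -[X in measurable X]setTI; apply: (measurable_ct cf).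
have indE : \int[mu]_(y in [set y | f y <= M]) w y =
    \int[mu]_y ((f y - M <= 0)%R%:R * w y).
  rewrite Rintegral_mkcond; apply: eq_Rintegral => y _; rewrite patchE subr_le0.
  by case: ifPn; [rewrite inE /= => ->; rewrite mul1r |
                  rewrite notin_setE /= => /negP/negbTE ->; rewrite mul0r].
set a := \int[mu]_(y in _) w y in indE *.
have rampi g : continuous (fun y : R => clamp (g y)) ->
    mu.-integrable setT (EFin \o (fun y => clamp (g y) * w y)).
  move=> cg; apply: (integrable_growth2 e c0 od d4 cg); exact: clamp_growth.
have upi n : mu.-integrable setT (EFin \o (fun y => up n y * w y)).
  by apply: rampi; have [] := ct_ramps n.
have loi n : mu.-integrable setT (EFin \o (fun y => lo n y * w y)).
  by apply: rampi; have [] := ct_ramps n.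
have indi : mu.-integrable setT (EFin \o (fun y => (f y - M <= 0)%R%:R * w y)).
  apply: (integrable_edens e c0 od d4 (C := 1)).
    rewrite (_ : (fun y => _) = \1_[set y | f y <= M]); first exact: measurable_indic.
    apply/funext => y; rewrite indicE subr_le0; congr (nat_of_bool _)%:R.
    by apply/idP/idP; rewrite inE.
  move=> y; rewrite mul1r; apply: (@le_trans _ _ 1); first by rewrite normr_nat lern1 leq_b1.
  by have := sqr_ge0 y; nra.
have a_up n : a <= \int[mu]_y (up n y * w y).
  rewrite indE; apply: le_Rintegral => // y _; rewrite ler_wpM2r ?edens_ge0 //.
  exact: ramp_above_ge.
have lo_a n : \int[mu]_y (lo n y * w y) <= a.
  rewrite indE; apply: le_Rintegral => // y _; rewrite ler_wpM2r ?edens_ge0 //.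
  exact: ramp_below_le.
have gapE n : \int[mu]_y ((up n y - lo n y) * w y) =
    \int[mu]_y (up n y * w y) - \int[mu]_y (lo n y * w y).
  by rewrite -RintegralB //; apply: eq_Rintegral => y _; rewrite mulrBl.
apply/cvgrPdist_le => eps eps0.
have e20 : 0 < eps * Z / 3 by rewrite divr_gt0 // mulr_gt0.
have [n Hn] : exists n, \int[mu]_y ((up n y - lo n y) * w y) <= eps * Z / 3.
  move/cvgr0Pnorm_le: ramp_gap_cvg => /(_ _ e20) [n _ Hn]; exists n.
  by apply: le_trans (ler_norm _) _; apply: Hn => /=.
have [cup clo] := ct_ramps n.
have Eup := cvgF cup (clamp_growth _); have Elo := cvgF clo (clamp_growth _).
have k0 : 0 < n.+1%:R :> R by rewrite ltr0n.
have e3 : 0 < eps / 3 by rewrite divr_gt0.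
have e6 : 0 < eps / 6 / n.+1%:R by rewrite !divr_gt0.
move/cvgrPdist_le: Eup => /(_ _ e3) Eup; move/cvgrPdist_le: Elo => /(_ _ e3) Elo.
move/cvgr0Pnorm_le: vf => /(_ _ e6) Ev; move/cvgrPdist_le: MNM => /(_ _ e6) EM.
near=> N.
have Eup' : `|\int[mu]_y (up n y * w y) / Z - fexp (@P N) (fun X => up n (x X))| <= eps / 3.
  by near: N; exact: Eup.
have Elo' : `|\int[mu]_y (lo n y * w y) / Z - fexp (@P N) (fun X => lo n (x X))| <= eps / 3.
  by near: N; exact: Elo.
have Ev' : `|fexp (@P N) (fun X => `|v X - f (x X)|)| <= eps / 6 / n.+1%:R by near: N; exact: Ev.
have EM' : `|M - MN N| <= eps / 6 / n.+1%:R by near: N; exact: EM.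
pose err (X : T N) := n.+1%:R * (`|v X - f (x X)| + `|M - MN N|).
have lip (X : T N) b : `|clamp (b - (v X - MN N) * n.+1%:R) -
    clamp (b - (f (x X) - M) * n.+1%:R)| <= err X.
  apply: le_trans (clamp_lipschitz _ _) _.
  have -> : b - (v X - MN N) * n.+1%:R - (b - (f (x X) - M) * n.+1%:R) =
    n.+1%:R * (- ((v X - f (x X)) + (M - MN N))) by ring.
  by rewrite normrM (gtr0_norm k0) ler_pM2l // normrN ler_normD.
have errE : fexp (@P N) err <= eps / 3.
  rewrite fexpZ fexpD fexp_cst //.
  have : fexp (@P N) (fun X => `|v X - f (x X)|) + `|M - MN N| <= eps / 3 / n.+1%:R.
    have -> : eps / 3 / n.+1%:R = eps / 6 / n.+1%:R + eps / 6 / n.+1%:R by field; rewrite gt_eqF.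
    by apply: lerD => //; apply: le_trans Ev'; exact: ler_norm.
  by rewrite -(ler_pM2l k0) mulrCA divff ?mulr1 // gt_eqF.
have hi_le : fexp (@P N) (fun X => (v X <= MN N)%R%:R) <=
    fexp (@P N) (fun X => up n (x X)) + eps / 3.
  apply: (@le_trans _ _ (fexp (@P N) (fun X => up n (x X) + err X))).
    apply: le_fexp => // X; have := lip X 1; rewrite ler_norml => /andP[_ h1].
    have := ramp_above_ge n (v X - MN N); rewrite subr_le0 /ramp_above /up /ramp_above; lra.
  by rewrite fexpD lerD2l.
have lo_le : fexp (@P N) (fun X => lo n (x X)) - eps / 3 <=
    fexp (@P N) (fun X => (v X <= MN N)%R%:R).
  apply: (@le_trans _ _ (fexp (@P N) (fun X => lo n (x X) - err X))).
    by rewrite fexpB lerB.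
  apply: le_fexp => // X; have := lip X 0; rewrite !sub0r ler_norml => /andP[h1 _].
  have := ramp_below_le n (v X - MN N); rewrite subr_le0 /ramp_below /lo /ramp_below; lra.
have := a_up n; have := lo_a n; move: Hn; rewrite gapE.
move: Eup' Elo'; set U := Rintegral _ _ _; set L := Rintegral _ _ _.
set b := fexp _ _ in hi_le lo_le *.
move=> {}Eup' {}Elo' H1 H2 H3.
have H4 : U / Z - L / Z <= eps / 3.
  rewrite -mulrBl ler_pdivrMr //; apply: le_trans H1 _.
  by rewrite le_eqVlt; apply/orP; left; apply/eqP; ring.
have H5 : a / Z <= U / Z by rewrite ler_pM2r ?invr_gt0.
have H6 : L / Z <= a / Z by rewrite ler_pM2r ?invr_gt0.
exact: (sandwich hi_le lo_le Eup' Elo' H4 H5 H6).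
Unshelve. all: end_near. Qed.

End distribution_functions.

(** * Convergence in distribution on the extended line *)

Section weak_convergence.
Context {R : realType}.

Definition stepf (c0 : R) (l : seq (R * R)) (y : \bar R) : R :=
  c0 + \sum_(a <- l) a.1 * (y <= a.2%:E)%E%:R.

(** Gluing: [stepf c0 l] up to [t], the value [v] beyond. *)
Lemma stepf_glue c0 l (t v : R) : exists l', forall y,
  stepf v l' y = if (y <= t%:E)%E then stepf c0 l y else v.
Proof.
exists ((c0 - v, t) :: [seq (a.1, Num.min a.2 t) | a <- l]) => y.
rewrite /stepf big_cons big_map /=.
have E a : (y <= (Num.min a t)%:E)%E = (y <= a%:E)%E && (y <= t%:E)%E.
  by rewrite EFin_min le_min.
under eq_bigr do rewrite E.
case: ifP => yt.
  under eq_bigr do rewrite andbT.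
  by rewrite -[true%:R]/(1 : R); ring.
rewrite big1 => [|a _]; last by rewrite andbF mulr0.
by rewrite mulr0 !addr0.
Qed.

(** The set of [t] such that [g] is uniformly approximated below [t] is an interval that
    contains a neighbourhood of [-oo]; continuity of [g] at its supremum would extend it
    beyond, so it reaches a neighbourhood of [+oo]. *)
Lemma stepf_approx (g : \bar R -> R) (eps : R) : continuous g -> 0 < eps ->
  exists c0 l, forall y, `|g y - stepf c0 l y| <= eps.
Proof.
move=> cg e0.
pose P t := exists c0 l, forall y, (y <= t%:E)%E -> `|g y - stepf c0 l y| <= eps.
have /cvgrPdist_le/(_ _ e0) [B [_ HB]] := cg -oo%E.
have /cvgrPdist_le/(_ _ e0) [A [_ HA]] := cg +oo%E.
have PB : P (B - 1).
  exists (g -oo%E), [::] => y yB; rewrite /stepf big_nil addr0 distrC.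
  by apply: HB; apply: (le_lt_trans yB); rewrite lte_fin ltrBlDr ltrDl.
have Pmono t t' : t' <= t -> P t -> P t'.
  move=> tt' [c0 [l H]]; exists c0, l => y yt'; apply: H.
  by apply: (le_trans yt'); rewrite lee_fin.
have glue t v t' : P t -> (forall y, (t%:E < y)%E -> (y <= t')%E -> `|g y - v| <= eps) ->
    exists c0 l, forall y, (y <= t')%E -> `|g y - stepf c0 l y| <= eps.
  move=> [c0 [l H]] Hv; have [l' Hl'] := stepf_glue c0 l t v.
  exists v, l' => y yt'; rewrite Hl'; case: ifPn => [|]; first exact: H.
  by rewrite -ltNge => /Hv; apply.
have PA : P A.
  apply: contrapT => nPA.
  pose S := [set t | P t].
  have supS : has_sup S.
    split; first by exists (B - 1).
    exists A => t St; rewrite leNgt; apply/negP => At; apply: nPA.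
    exact: Pmono (ltW At) St.
  pose u := sup S.
  have /cvgrPdist_le/(_ _ e0) := cg u%:E.
  rewrite near_simpl => -[d /= d0 Hd].
  have [t St tu] := sup_adherent d0 supS.
  have : P (u + d / 2).
    apply: (glue t (g u%:E)) => // y ty yu; rewrite distrC.
    case: y ty yu => [y||] //; rewrite lte_fin lee_fin => ty yu.
    apply: Hd => /=; rewrite /ball /= ltr_norml.
    by apply/andP; split; rewrite /u in yu tu *; lra.
  move=> /(ub_le_sup supS.2); rewrite -/u; lra.
have [c0 [l H]] : exists c0 l, forall y, (y <= +oo)%E -> `|g y - stepf c0 l y| <= eps.
  by apply: (glue A (g +oo%E)) => // y Ay _; rewrite distrC; exact: HA.
by exists c0, l => y; apply: H; rewrite leey.
Qed.

Lemma measurable_stepf c0 l : measurable_fun setT (stepf c0 l).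
Proof.
apply: measurable_funD; first exact: measurable_cst.
elim: l => [|a l IH].
  by under eq_fun do rewrite big_nil; exact: measurable_cst.
under eq_fun do rewrite big_cons; apply: measurable_funD => //.
apply: measurable_funM; first exact: measurable_cst.
rewrite (_ : (fun y => _) = \1_[set y : \bar R | (y <= a.2%:E)%E]).
  apply: measurable_indic.
  have -> : [set y : \bar R | (y <= a.2%:E)%E] = `]-oo, a.2%:E]%classic.
    by apply/seteqP; split => y /=; rewrite in_itv.
  exact: emeasurable_itv.
by apply/funext => y; rewrite indicE; congr (nat_of_bool _)%:R; apply/idP/idP; rewrite inE.
Qed.

Lemma measurable_continuous_ereal (g : \bar R -> R) : continuous g -> measurable_fun setT g.
Proof.
move=> cg.
have H n : exists s : R * seq (R * R), forall y, `|g y - stepf s.1 s.2 y| <= n.+1%:R^-1.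
  have [|c0 [l Hl]] := @stepf_approx g n.+1%:R^-1 cg; first by rewrite invr_gt0.
  by exists (c0, l).
pose s n := projT1 (cid (H n)).
have Hs n y : `|g y - stepf (s n).1 (s n).2 y| <= n.+1%:R^-1 := projT2 (cid (H n)) y.
apply: (@measurable_fun_cvg _ _ _ setT (fun n => stepf (s n).1 (s n).2)).
- by move=> n; exact: measurable_stepf.
- move=> y _; apply/cvgrPdist_le => e e0; near=> n.
  apply: le_trans (Hs n y) _; near: n.
  by apply: filterS (near_infty_natSinv_lt (PosNum e0)) => k /ltW.
Unshelve. all: end_near. Qed.

Variables (T : nat -> finType) (P : forall N, T N -> R) (Y : forall N, T N -> \bar R).
Hypothesis hP : forall N, is_dist (@P N).
Variable mu : {measure set (\bar R) -> \bar R}.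
Hypothesis muT : mu setT = 1%E.
Hypothesis cdfY : forall t : R, fexp (@P N) (fun X => (Y X <= t%:E)%E%:R) @[N --> \oo] -->
  fine (mu [set y | (y <= t%:E)%E]).

(** Expectations of step functions are combinations of distribution functions. *)
Theorem weak_cvg (g : \bar R -> R) : continuous g -> (exists M, forall y, `|g y| <= M) ->
  fexp (@P N) (fun X => g (Y X)) @[N --> \oo] --> fine (\int[mu]_y (g y)%:E)%E.
Proof.
move=> cg [M gM].
have mg := measurable_continuous_ereal cg.
have bi (f : \bar R -> R) K : measurable_fun setT f -> (forall y, `|f y| <= K) ->
    mu.-integrable setT (EFin \o f).
  move=> mf fK; apply: measurable_bounded_integrable => //; first by rewrite muT ltry.
  exists K; split; first exact: num_real.
  by move=> K' KK' y _; apply: le_trans (fK y) (ltW KK').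
have gi := bi g M mg gM.
have RintE f : fine (\int[mu]_y (f y)%:E)%E = \int[mu]_y f y by [].
rewrite RintE.
have mset t : measurable [set y : \bar R | (y <= t%:E)%E].
  have -> : [set y : \bar R | (y <= t%:E)%E] = `]-oo, t%:E]%classic.
    by apply/seteqP; split => y /=; rewrite in_itv.
  exact: emeasurable_itv.
have step c0 l : fexp (@P N) (fun X => stepf c0 l (Y X)) @[N --> \oo] -->
    \int[mu]_y stepf c0 l y /\ mu.-integrable setT (EFin \o stepf c0 l).
  elim: l => [|a l [IH1 IH2]].
    have -> : stepf c0 [::] = fun=> c0.
      by apply/funext => y; rewrite /stepf big_nil addr0.
    split; last by apply: (bi _ `|c0|); [exact: measurable_cst | move=> _; exact: lexx].
    rewrite Rintegral_cst // muT /= mulr1.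
    by under eq_fun do rewrite fexp_cst //; exact: cvg_cst.
  pose ind y : R := (y <= a.2%:E)%E%:R.
  have sE : stepf c0 (a :: l) = fun y => a.1 * ind y + stepf c0 l y.
    by apply/funext => y; rewrite /stepf big_cons /ind; ring.
  have indE : ind = \1_[set y | (y <= a.2%:E)%E].
    by apply/funext => y; rewrite indicE; congr (nat_of_bool _)%:R; apply/idP/idP; rewrite inE.
  have indi : mu.-integrable setT (EFin \o ind).
    apply: (bi _ 1); first by rewrite indE; exact: measurable_indic.
    by move=> y; rewrite normr_nat lern1 leq_b1.
  have aindi : mu.-integrable setT (EFin \o (fun y => a.1 * ind y)).
    by have := @integrableZl _ _ _ mu setT measurableT a.1 _ indi.
  rewrite sE; split; last by have := integrableD measurableT aindi IH2.
  rewrite RintegralD // RintegralZl //.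
  have -> : \int[mu]_y ind y = fine (mu [set y | (y <= a.2%:E)%E]).
    by rewrite indE /Rintegral integral_indic // setIT.
  under eq_fun do rewrite fexpD fexpZ.
  by apply: cvgD => //; apply: cvgM; [exact: cvg_cst | exact: cdfY].
apply/cvgrPdist_le => e e0.
have e3 : 0 < e / 3 by rewrite divr_gt0.
have [c0 [l Hl]] := stepf_approx cg e3.
have [/cvgrPdist_le/(_ _ e3) cs si] := step c0 l.
have dI : `|\int[mu]_y g y - \int[mu]_y stepf c0 l y| <= e / 3.
  rewrite -RintegralB //.
  have di : mu.-integrable setT (EFin \o (fun y => g y - stepf c0 l y)).
    by have := integrableB measurableT gi si.
  apply: (le_trans (le_normr_Rintegral measurableT di)).
  have -> : e / 3 = \int[mu]_y (cst (e / 3) y) by rewrite Rintegral_cst // muT mulr1.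
  apply: le_Rintegral => //.
  - by have := integrable_norm di.
  - by apply: (bi (cst (e / 3)) `|e / 3|); first exact: measurable_cst.
near=> N.
have dE : `|fexp (@P N) (fun X => g (Y X)) - fexp (@P N) (fun X => stepf c0 l (Y X))| <= e / 3.
  rewrite -fexpB; apply: (le_trans (fexp_norm (hP N) _)).
  by apply: fexp_le_cst.
have dN : `|\int[mu]_y stepf c0 l y - fexp (@P N) (fun X => stepf c0 l (Y X))| <= e / 3.
  by near: N.
move: dI dE dN; rewrite !ler_norml => /andP[? ?] /andP[? ?] /andP[? ?].
by apply/andP; split; lra.
Unshelve. all: end_near. Qed.

End weak_convergence.

(** * Limits at infinity and limits on the line *)

Section limit_kinds.
Context {R : realType}.
Variables (T : nat -> finType) (P : forall N, T N -> R) (Y : forall N, T N -> \bar R).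
Hypothesis hP : forall N, is_dist (@P N).

Lemma infty_mixture_measure (a : R) : 0 <= a <= 1 ->
  exists2 m : {measure set (\bar R) -> \bar R}, infty_mixture a = m & m setT = 1%E.
Proof.
move=> /andP[a0 a1]; have b0 : 0 <= 1 - a by rewrite subr_ge0.
exists (measure_add (mscale (NngNum a0) (\d_(-oo%E : \bar R)))
  (mscale (NngNum b0) (\d_(+oo%E : \bar R)))).
  by apply/funext => A; rewrite /measure_add /= /msum 2!big_ord_recl /= big_ord0 adde0.
rewrite /measure_add /= /msum 2!big_ord_recl /= big_ord0 adde0 /mscale /= !diracE !in_setT /= !mule1 -EFinD; congr EFin.
by ring.
Qed.

(** A distribution function with the same limit at every [t] leaves no mass on the line. *)
Lemma mixture_cvg (a : R) : 0 <= a <= 1 ->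
  (forall t : R, fexp (@P N) (fun X => (Y X <= t%:E)%E%:R) @[N --> \oo] --> a) ->
  forall g : \bar R -> R, continuous g -> (exists M, forall y, `|g y| <= M) ->
  fexp (@P N) (fun X => g (Y X)) @[N --> \oo] -->
    fine (\int[infty_mixture a]_y (g y)%:E)%E.
Proof.
move=> a01 cdfY g cg gM; have [m mE m1] := infty_mixture_measure a01.
rewrite mE; apply: weak_cvg => // t; rewrite -mE /infty_mixture.
have -> // : fine (a%:E * \d_(-oo) [set y : \bar R | (y <= t%:E)%E] +
    (1 - a)%:E * \d_(+oo) [set y : \bar R | (y <= t%:E)%E])%E = a.
rewrite !diracE mem_set /=; last by rewrite leNye.
rewrite memNset; last by rewrite /= leye_eq.
by rewrite /= mulr1 mulr0 addr0.
Qed.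

Lemma real_law_cvg (L1 : probability (measurableTypeR R) R) (F : R -> R) :
  (forall t : R, L1 `]-oo, t]%classic = (F t)%:E) ->
  (forall t : R, fexp (@P N) (fun X => (Y X <= t%:E)%E%:R) @[N --> \oo] --> F t) ->
  forall g : \bar R -> R, continuous g -> (exists M, forall y, `|g y| <= M) ->
  fexp (@P N) (fun X => g (Y X)) @[N --> \oo] -->
    fine (\int[pushforward L1 (@EFin R : measurableTypeR R -> \bar R)]_y (g y)%:E)%E.
Proof.
move=> L1F cdfY g cg gM.
have mE : measurable_fun setT (@EFin R : measurableTypeR R -> \bar R) by exact: EFin_measurable.
pose f : {mfun (measurableTypeR R) >-> \bar R} := HB.pack (@EFin R : measurableTypeR R -> \bar R)
   (isMeasurableFun.Build _ _ _ _ _ mE).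
have := @weak_cvg _ T P Y hP (pushforward L1 f).
apply => //.
  exact: (@probability_setT _ _ _ L1).
move=> t; rewrite /pushforward.
have E : f @^-1` [set y : \bar R | (y <= t%:E)%E] = `]-oo, t]%classic.
  by apply/seteqP; split => y /=; rewrite in_itv /= lee_fin.
by rewrite [fine _](_ : _ = F t) // -[RHS]/(fine (F t)%:E) -L1F -E.
Qed.

Lemma probability_of_cdf (F : R -> R) : {homo F : x y / x <= y} -> continuous F ->
  F x @[x --> -oo] --> (0 : R) -> F x @[x --> +oo] --> (1 : R) ->
  exists L1 : probability (measurableTypeR R) R,
    forall t : R, L1 `]-oo, t]%classic = (F t)%:E.
Proof.
move=> ndF cF F0 F1.
pose c1 : cumulative R R := HB.pack F
  (isCumulative.Build R _ R F ndF (right_continuousW cF)).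
pose c2 : cumulativeBounded (0 : R) (1 : R) := HB.pack F (Cumulative.class c1)
  (isCumulativeBounded.Build R 0 1 F F0 F1).
exists (lebesgue_stieltjes_measure c2) => t.
exact: (cdf_lebesgue_stieltjes_id c2 t).
Qed.

End limit_kinds.

(** * The mean of a tilted density *)

Section tilted_mean.
Context {R : realType}.
Local Notation mu := (@lebesgue_measure R).
Variables (c : R) (d : nat).
Hypotheses (c0 : 0 < c) (od : ~~ odd d) (d4 : (4 <= d)%N).
Local Notation w e := (edens c e d).

Definition emean (e : R) : R := (\int[mu]_x (x * w e x)) / \int[mu]_x w e x.

Let Z0 e : 0 < \int[mu]_x w e x.
Proof. exact: Rintegral_edens_gt0. Qed.

Let w1 e : mu.-integrable setT (EFin \o (w e)).
Proof. exact: integrable_edens1. Qed.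

Lemma affine_growth (K : R) x : `|x - K| <= (1 + `|K|) * (1 + x ^+ 2).
Proof.
have h1 : `|x| <= 1 + x ^+ 2.
  rewrite -(real_normK (num_real x)); have := normr_ge0 x; move: `|x| => u u0.
  by have := sqr_ge0 (u - 1); nra.
have h2 : 0 <= `|K| * x ^+ 2 by rewrite mulr_ge0 ?sqr_ge0.
apply: le_trans (ler_normB _ _) _; lra.
Qed.

Let wa e K : mu.-integrable setT (EFin \o (fun x => (x - K) * w e x)).
Proof.
apply: (integrable_growth2 e c0 od d4 _ (affine_growth K)).
by apply: ctB; [exact: ct_id | exact: ct_cst].
Qed.

Let wx e : mu.-integrable setT (EFin \o (fun x => x * w e x)).
Proof. by have := wa e 0; under eq_fun do rewrite subr0. Qed.

Lemma integral_centered e K :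
  \int[mu]_x ((x - K) * w e x) = (emean e - K) * \int[mu]_x w e x.
Proof.
under eq_Rintegral do rewrite mulrBl.
rewrite RintegralB //; last by have := @integrableZl _ _ _ mu setT measurableT K _ (w1 e).
by rewrite RintegralZl // /emean mulrBl divfK // gt_eqF.
Qed.

Lemma emean_ge e K : 0 <= \int[mu]_x ((x - K) * w e x) -> K <= emean e.
Proof. by rewrite integral_centered pmulr_lge0 // subr_ge0. Qed.

(** A tilt multiplies the centred integrand [u] by [expR (a * u) >= 1] where [u >= 0]
    and by at most 1 where [u <= 0]. *)
Lemma tilt_edens e e' K x :
  (x - K) * w e' x = expR ((e' - e) * K) * (((x - K) * expR ((e' - e) * (x - K))) * w e x).
Proof.
have -> : w e' x = expR ((e' - e) * K) * expR ((e' - e) * (x - K)) * w e x.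
  by rewrite /edens -!expRD; congr expR; ring.
ring.
Qed.

Lemma mul_expR_ge (a u : R) : 0 <= a -> u <= u * expR (a * u).
Proof.
move=> a0; have [u0|u0] := leP 0 u.
  by rewrite ler_peMr // -expR0 ler_expR mulr_ge0.
rewrite -subr_ge0 (_ : _ - u = u * (expR (a * u) - 1)); last by ring.
apply: mulr_le0; first exact: ltW.
by rewrite subr_le0 -expR0 ler_expR mulr_ge0_le0 // ltW.
Qed.

Lemma emean_nondecreasing : {homo emean : e e' / e <= e'}.
Proof.
move=> e e' ee'; apply: emean_ge; set K := emean e.
apply: (@le_trans _ _ (expR ((e' - e) * K) * \int[mu]_x ((x - K) * w e x))).
  by rewrite integral_centered subrr mul0r mulr0.
rewrite -RintegralZl //; apply: le_Rintegral => //.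
  by have := @integrableZl _ _ _ mu setT measurableT (expR ((e' - e) * K)) _ (wa e K).
move=> x _; rewrite (tilt_edens e e' K x) ler_pM2l ?expR_gt0 // ler_wpM2r ?edens_ge0 //.
by apply: mul_expR_ge; rewrite subr_ge0.
Qed.

(** Under a strong tilt the interval between [K + 1] and [K + 2] outweighs everything below
    [K]. *)
Lemma emean_unbounded K : exists2 E, 0 <= E & forall e, E <= e -> K <= emean e.
Proof.
pose phi e x := (x - K) * expR (e * (x - K)) * w 0 x.
have phiE e x : (x - K) * w e x = expR (e * K) * phi e x.
  by rewrite (tilt_edens 0) subr0.
have phii e : mu.-integrable setT (EFin \o phi e).
  have -> : phi e = fun x => expR (- (e * K)) * ((x - K) * w e x).
    by apply/funext => x; rewrite phiE mulrA -expRD addNr expR0 mul1r.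
  by have := @integrableZl _ _ _ mu setT measurableT (expR (- (e * K))) _ (wa e K).
pose psi x := `|x - K| * w 0 x.
have psii : mu.-integrable setT (EFin \o psi).
  have := integrable_norm (wa 0 K); congr (_.-integrable _ _); apply/funext => x /=.
  by rewrite normrM (ger0_norm (edens_ge0 _ _ _ _)).
set A := \int[mu]_x psi x.
have A0 : 0 <= A by apply: Rintegral_ge0 => x _; rewrite mulr_ge0 ?edens_ge0.
have [m m0 Hm] : exists2 m, 0 < m & forall x, K + 1 <= x <= K + 2 -> m <= w 0 x.
  have K12 : K + 1 <= K + 2 by lra.
  have cw : {within `[K + 1, K + 2], continuous (w 0)}.
    by apply: continuous_subspaceT; exact: ct_edens.
  have [x0 _ Hx0] := EVT_min K12 cw.
  exists (w 0 x0) => [|x Hx]; first exact: edens_gt0.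
  by apply: Hx0; rewrite in_itv.
exists (A / m) => [|e Ae]; first by rewrite divr_ge0 // ltW.
have e0 : 0 <= e by apply: le_trans Ae; rewrite divr_ge0 // ltW.
apply: emean_ge; under eq_Rintegral do rewrite phiE.
rewrite RintegralZl // pmulr_rge0 ?expR_gt0 //.
have sumi : mu.-integrable setT (EFin \o (fun x => phi e x + psi x)).
  by have := integrableD measurableT (phii e) psii.
have := @Rintegral_ge_itv R (fun x => phi e x + psi x) (K + 1) (K + 2) (e * m).
rewrite RintegralD // -/A => H.
suff : e * m - A <= \int[mu]_x phi e x.
  by apply: le_trans; rewrite subr_ge0 -ler_pdivrMr.
rewrite lerBlDr; apply: le_trans (H _ _ _ _) => //.
- by rewrite (_ : K + 2 - (K + 1) = 1) ?mulr1 //; lra.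
- by lra.
- move=> x; rewrite /phi /psi -mulrDl mulr_ge0 ?edens_ge0 // -lerBlDr sub0r.
  by apply: le_trans (mul_expR_ge _ e0); rewrite lerNl -normrN ler_norm.
- move=> x /andP[x1 x2]; have Kx : K + 1 <= x <= K + 2 by rewrite x1.
  rewrite /phi /psi -mulrDl; apply: ler_pM => //; first exact: ltW.
    have u1 : 1 <= x - K by lra.
    have h1 : e <= e * (x - K) by rewrite ler_peMr.
    have h2 := expR_ge1Dx (e * (x - K)).
    have h3 : expR (e * (x - K)) <= (x - K) * expR (e * (x - K)).
      by rewrite ler_peMl // expR_ge0.
    have := normr_ge0 (x - K); lra.
  exact: Hm.
Qed.

Lemma Rintegral_oppr (f : R -> R) : mu.-integrable setT (EFin \o f) ->
  \int[mu]_x f (- x) = \int[mu]_x f x.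
Proof.
move=> fi; rewrite /Rintegral; congr fine.
have mN : measurable_fun setT (-%R : measurableTypeR R -> measurableTypeR R).
  by apply: measurable_ct => x; apply: cvgN; exact: cvg_id.
have fNi : mu.-integrable setT ((EFin \o f) \o -%R).
  apply/integrableP; split.
    by apply: measurableT_comp; first exact: (measurable_int mu fi).
  rewrite -(@ge0_integral_pushforward _ _ (measurableTypeR R) (measurableTypeR R) R -%R mN mu setT
    (fun x => `|(f x)%:E|%E)) //=; last first.
    have mf : measurable_fun setT f.
      by apply/measurable_EFinP; exact: (measurable_int mu fi).
    by apply/measurable_EFinP; apply: measurableT_comp.
  rewrite (_ : (\int[_]_x _)%E = (\int[mu]_x `|(f x)%:E|)%E).
    by have /integrableP[_] := fi.
  by apply: eq_measure_integral => A mA _; exact: lebesgue_measureN.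
rewrite -(@integral_pushforward _ _ (measurableTypeR R) (measurableTypeR R) R -%R mN mu setT (EFin \o f)) //=; last first.
  exact: (measurable_int mu fi).
by apply: eq_measure_integral => A mA _; exact: lebesgue_measureN.
Qed.

Lemma edens_even e x : w e (- x) = w (- e) x.
Proof.
rewrite /edens; congr expR; rewrite mulrN -mulNr; congr (- (c * _) + _).
by rewrite -[- x]mulN1r exprMn -signr_odd (negPf od) expr0 mul1r.
Qed.

Lemma emean_odd e : emean (- e) = - emean e.
Proof.
rewrite /emean -(Rintegral_oppr (wx (- e))) -(Rintegral_oppr (w1 (- e))).
under eq_Rintegral do rewrite edens_even opprK mulNr -mulN1r.
under [X in _ / X]eq_Rintegral do rewrite edens_even opprK.
by rewrite RintegralZl // mulN1r mulNr.
Qed.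

Lemma expR_lipschitz (a b : R) : `|expR a - expR b| <= `|a - b| * (expR a + expR b).
Proof.
wlog ba : a b / b <= a.
  by move=> H; have [/H//|/ltW/H] := leP b a; rewrite distrC [expR b + _]addrC (distrC b).
rewrite !ger0_norm ?subr_ge0 ?ler_expR //.
have -> : expR b = expR a * expR (b - a) by rewrite -expRD; congr expR; ring.
have h1 := expR_ge1Dx (b - a); have a0 := expR_ge0 a.
have h2 : 0 <= (a - b) * (expR a * expR (b - a)).
  by rewrite !mulr_ge0 ?expR_ge0 // subr_ge0.
have h3 : expR a * (1 + (b - a)) <= expR a * expR (b - a) by rewrite ler_wpM2l.
lra.
Qed.

Lemma continuous_tilt (f : R -> R) : measurable_fun setT f ->
  (forall x, `|f x| <= 1 + `|x|) -> continuous (fun e => \int[mu]_x (f x * w e x)).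
Proof.
move=> mf fg e; pose E := `|e| + 1.
have E0 : 0 <= E by rewrite addr_ge0.
have [C C0 HC] := edens_bound c0 od d4 E0.
have poly (x : R) : (1 + `|x|) * `|x| <= (1 + x ^+ 2) ^+ 2.
  rewrite -(real_normK (num_real x)); have := normr_ge0 x; move: `|x| => u u0.
  by have := sqr_ge0 (u - 1); have := sqr_ge0 u; nra.
have fC (x : R) : `|f x| <= 2 * (1 + x ^+ 2) ^+ 2.
  apply: (le_trans (fg x)).
  rewrite -(real_normK (num_real x)); have := normr_ge0 x; move: `|x| => u u0.
  by have := sqr_ge0 (u - 1); have := sqr_ge0 u; nra.
have fi e' : mu.-integrable setT (EFin \o (fun x => f x * w e' x)).
  exact: (integrable_edens e' c0 od d4 mf fC).
have gi : mu.-integrable setT (EFin \o @gauss_fun R) := integrableT_gauss.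
pose I := \int[mu]_x @gauss_fun R x.
have I0 : 0 <= I by apply: Rintegral_ge0 => x _; exact: gauss_fun_ge0.
have D0 : 0 < 2 * C * I + 1 by rewrite ltr_wpDl // !mulr_ge0 // ltW.
apply/cvgrPdist_le => eps eps0.
have del0 : 0 < Num.min 1 (eps / (2 * C * I + 1)) by rewrite lt_min ltr01 divr_gt0.
have /cvgrPdist_le/(_ _ del0) Hnear := @ct_id R e.
near=> e'.
have ee' : `|e - e'| <= Num.min 1 (eps / (2 * C * I + 1)).
  by near: e'; exact: Hnear.
have {ee'}[ee1 ee2] : `|e - e'| <= 1 /\ `|e - e'| <= eps / (2 * C * I + 1).
  by move: ee'; rewrite le_min => /andP[].
have eE : `|e| <= E by rewrite lerDl.
have e'E : `|e'| <= E.
  have -> : e' = e - (e - e') by ring.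
  by apply: le_trans (ler_normB _ _) _; rewrite lerD2l.
rewrite -RintegralB //.
have di : mu.-integrable setT (EFin \o (fun x => f x * w e x - f x * w e' x)).
  by have := integrableB measurableT (fi e) (fi e').
apply: (le_trans (le_normr_Rintegral measurableT di)).
apply: (@le_trans _ _ (\int[mu]_x ((`|e - e'| * (2 * C)) * @gauss_fun R x))).
  apply: le_Rintegral => //.
  - by have := integrable_norm di.
  - by have := @integrableZl _ _ _ mu setT measurableT (`|e - e'| * (2 * C)) _ gi.
  move=> x _; rewrite -mulrBr normrM.
  apply: (@le_trans _ _ ((1 + `|x|) * (`|e - e'| * `|x| * (w e x + w e' x)))).
    apply: ler_pM => //; rewrite /edens; apply: le_trans (expR_lipschitz _ _) _.
    rewrite -normrM le_eqVlt; apply/orP; left; apply/eqP.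
    by congr (`|_| * _); ring.
  have -> : (1 + `|x|) * (`|e - e'| * `|x| * (w e x + w e' x)) =
      `|e - e'| * (((1 + `|x|) * `|x|) * (w e x + w e' x)) by ring.
  rewrite -[leRHS]mulrA ler_wpM2l //.
  apply: (@le_trans _ _ ((1 + x ^+ 2) ^+ 2 * (w e x + w e' x))).
    by rewrite ler_wpM2r // addr_ge0 ?edens_ge0.
  by have := HC x e eE; have := HC x e' e'E; lra.
rewrite RintegralZl // -/I.
have : `|e - e'| * (2 * C * I + 1) <= eps by rewrite -ler_pdivlMr.
have := normr_ge0 (e - e'); lra.
Unshelve. all: end_near. Qed.

Lemma emean_continuous : continuous emean.
Proof.
apply: ctM.
  apply: (continuous_tilt (f := id)); first exact: measurable_id.
  by move=> x; rewrite lerDr.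
have H : continuous (fun e => \int[mu]_x (1 * w e x)).
  apply: continuous_tilt; first exact: measurable_cst.
  by move=> x; rewrite normr1 lerDl.
have E e : \int[mu]_x (1 * w e x) = \int[mu]_x w e x.
  by apply: eq_Rintegral => x _; rewrite mul1r.
move=> e; apply: cvgV; first by rewrite gt_eqF.
by under eq_fun do rewrite -E; rewrite -E; exact: H.
Qed.

Definition ecdf (e t : R) : R := (\int[mu]_(x in `]-oo, t]) w e x) / \int[mu]_x w e x.

Let wA e (A : set (measurableTypeR R)) : measurable A -> mu.-integrable A (EFin \o w e).
Proof. by move=> mA; exact: integrableS (w1 e). Qed.

Let wpatch e (A : set (measurableTypeR R)) : measurable A ->
  mu.-integrable setT (EFin \o (w e \_ A)).
Proof.
move=> mA; have := (integrable_mkcond (mu := mu) (EFin \o w e) mA).1 (wA e mA).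
by rewrite restrict_EFin.
Qed.

Lemma le_integral_set e (A B : set (measurableTypeR R)) : measurable A -> measurable B ->
  A `<=` B -> \int[mu]_(x in A) w e x <= \int[mu]_(x in B) w e x.
Proof.
move=> mA mB AB; rewrite Rintegral_mkcond [leRHS]Rintegral_mkcond.
apply: le_Rintegral => //; try exact: wpatch.
move=> x _; rewrite !patchE; case: ifPn => [|_].
  by rewrite inE => /AB xB; rewrite ifT // inE.
by case: ifP => _ //; rewrite edens_ge0.
Qed.

Lemma ecdf_nondecreasing e : {homo ecdf e : x y / x <= y}.
Proof.
move=> x y xy; rewrite /ecdf ler_pM2r ?invr_gt0 //; apply: le_integral_set => //.
exact: subset_itvl.
Qed.

Lemma ecdf_continuous e : continuous (ecdf e).
Proof.
apply: ctM; last exact: ct_cst.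
move=> y; have [|||K1 K2] := @continuous_FTC1 R (w e) -oo%O y (y + 1) _ _ _
  (@ct_edens R c e d y).
- by rewrite ltrDl.
- exact: wA.
- by rewrite ltNyr.
exact: (dv_continuous (DeriveDef K1 erefl)).
Qed.

Let wx2 e : mu.-integrable setT (EFin \o (fun x => x ^+ 2 * w e x)).
Proof.
apply: (@integrable_growth2 R c e d c0 od d4 (fun x => x ^+ 2) 1); first exact: ctX.
by move=> x; rewrite mul1r ger0_norm ?sqr_ge0 // lerDr.
Qed.

(** Chebyshev's inequality for the tilted density. *)
Lemma tail_le e (A : set (measurableTypeR R)) y : measurable A -> y != 0 ->
  (forall x, A x -> y ^+ 2 <= x ^+ 2) ->
  \int[mu]_(x in A) w e x <= (\int[mu]_x (x ^+ 2 * w e x)) / y ^+ 2.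
Proof.
move=> mA y0 HA; have y20 : 0 < y ^+ 2 by rewrite lt_neqAle sqr_ge0 eq_sym sqrf_eq0 y0.
rewrite ler_pdivlMr // mulrC -RintegralZl //; last exact: wA.
rewrite Rintegral_mkcond; apply: le_Rintegral => //.
  have := @integrableZl _ _ _ mu setT measurableT (y ^+ 2) _ (wpatch e mA).
  congr (_.-integrable _ _); apply/funext => x /=; rewrite -EFinM; congr EFin.
  by rewrite !patchE; case: ifP; rewrite ?mulr0.
move=> x _; rewrite patchE; case: ifPn => [|_].
  by rewrite inE => /HA yx; rewrite ler_wpM2r ?edens_ge0.
by rewrite mulr_ge0 ?sqr_ge0 ?edens_ge0.
Qed.

Lemma inv_sqr_small (A eps : R) : 0 <= A -> 0 < eps ->
  exists2 M, 0 < M & forall y, M <= `|y| -> A / y ^+ 2 <= eps.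
Proof.
move=> A0 eps0; exists (1 + A / eps) => [|y My]; first by rewrite ltr_pwDl // divr_ge0 // ltW.
have Ae : 0 <= A / eps by rewrite divr_ge0 // ltW.
have y1 : 1 <= `|y| by lra.
have y20 : 0 < y ^+ 2 by rewrite -real_normK ?num_real // exprn_gt0 //; lra.
rewrite ler_pdivrMr // mulrC -ler_pdivrMr //.
rewrite -(real_normK (num_real y)) expr2.
have : 1 * `|y| <= `|y| * `|y| by rewrite ler_wpM2r.
lra.
Qed.

Lemma ecdf_Ny e : ecdf e x @[x --> -oo] --> (0 : R).
Proof.
apply/cvgr0Pnorm_le => eps eps0.
set A := (\int[mu]_x (x ^+ 2 * w e x)).
have A0 : 0 <= A by apply: Rintegral_ge0 => x _; rewrite mulr_ge0 ?sqr_ge0 ?edens_ge0.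
have [M M0 HM] := inv_sqr_small A0 (mulr_gt0 eps0 (Z0 e)).
near=> y.
have yM : y <= - M by near: y; apply: nbhs_ninfty_le; rewrite num_real.
have y0 : y < 0 by lra.
rewrite ger0_norm; last first.
  by apply: divr_ge0; [apply: Rintegral_ge0 => x _; exact: edens_ge0 | exact: ltW].
rewrite /ecdf ler_pdivrMr //.
apply: (@le_trans _ _ (A / y ^+ 2)); last by apply: HM; rewrite ltr0_norm //; lra.
apply: tail_le => //; first by rewrite lt_eqF.
by move=> x /=; rewrite in_itv /= => xy; nra.
Unshelve. all: end_near. Qed.

Lemma ecdf_split e t :
  \int[mu]_x w e x = \int[mu]_(x in `]-oo, t]) w e x + \int[mu]_(x in `]t, +oo[) w e x.
Proof.
rewrite -Rintegral_setU //; last 2 first.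
- by rewrite -setCitvl setUv; exact: w1.
- by rewrite -setCitvl; exact/disj_setPCl.
by rewrite -setCitvl setUv.
Qed.

Lemma ecdf_y e : ecdf e x @[x --> +oo] --> (1 : R).
Proof.
apply/cvgrPdist_le => eps eps0.
set A := (\int[mu]_x (x ^+ 2 * w e x)).
have A0 : 0 <= A by apply: Rintegral_ge0 => x _; rewrite mulr_ge0 ?sqr_ge0 ?edens_ge0.
have [M M0 HM] := inv_sqr_small A0 (mulr_gt0 eps0 (Z0 e)).
near=> y.
have yM : M <= y by near: y; apply: nbhs_pinfty_ge; rewrite num_real.
have y0 : 0 < y by lra.
have -> : 1 - ecdf e y = (\int[mu]_(x in `]y, +oo[) w e x) / \int[mu]_x w e x.
  by rewrite /ecdf -(divff (lt0r_neq0 (Z0 e))) -mulrBl [X in (X - _) / _](ecdf_split e y) addrAC subrr add0r.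
rewrite ger0_norm; last first.
  by apply: divr_ge0; [apply: Rintegral_ge0 => x _; exact: edens_ge0 | exact: ltW].
rewrite ler_pdivrMr //.
apply: (@le_trans _ _ (A / y ^+ 2)); last by apply: HM; rewrite gtr0_norm.
apply: tail_le => //; first by rewrite gt_eqF.
by move=> x /=; rewrite in_itv /= andbT => xy; nra.
Unshelve. all: end_near. Qed.

Lemma ecdf_reflect t :
  (\int[mu]_(x in [set x | t <= x]) w 0 x) / \int[mu]_x w 0 x = ecdf 0 (- t).
Proof.
congr (_ / _).
have -> : [set x | t <= x] = `[t, +oo[%classic.
  by apply/seteqP; split => x /=; rewrite in_itv /= andbT.
rewrite Rintegral_mkcond [RHS]Rintegral_mkcond -Rintegral_oppr; last exact: wpatch.
apply: eq_Rintegral => x _; rewrite !patchE edens_even oppr0.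
have -> : (- x \in `[t, +oo[%classic) = (x \in `]-oo, - t]%classic); last by [].
by apply/idP/idP; rewrite !inE /= !in_itv /= andbT lerNr.
Qed.

(** The composition is monotone and continuous, and its limits are 0 and 1 because the
    mean of the tilt is odd and tends to infinity with it. *)
Lemma ecdf_emean_probability k : k < 0 ->
  exists L1 : probability (measurableTypeR R) R,
    forall t : R, L1 `]-oo, t]%classic = (ecdf 0 (- emean (t * k)))%:E.
Proof.
move=> k0; have FE t : - emean (t * k) = emean (- k * t).
  by rewrite -emean_odd; congr emean; ring.
have [L1 HL1] : exists L1 : probability (measurableTypeR R) R,
    forall t : R, L1 `]-oo, t]%classic = (ecdf 0 (emean (- k * t)))%:E.
  apply: probability_of_cdf.
  - move=> x y xy; apply/ecdf_nondecreasing/emean_nondecreasing.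
    by rewrite ler_wpM2l // oppr_ge0 ltW.
  - apply: ct_comp; last exact: ecdf_continuous.
    apply: (ct_comp _ emean_continuous).
    by apply: ctM; [exact: ct_cst | exact: ct_id].
  - apply: (@cvg_comp _ _ _ (fun t => emean (- k * t)) (ecdf 0)); last exact: ecdf_Ny.
    apply/cvgrNyPle => M; have [E E0 HE] := emean_unbounded (- M).
    near=> t; have tE : t <= - (E / - k).
      by near: t; apply: nbhs_ninfty_le; rewrite num_real.
    rewrite -[_ * t]opprK emean_odd lerNl; apply: HE.
    by rewrite -mulrN -ler_pdivrMl ?oppr_gt0 // mulrC lerNr.
  - apply: (@cvg_comp _ _ _ (fun t => emean (- k * t)) (ecdf 0)); last exact: ecdf_y.
    apply/cvgryPge => M; have [E E0 HE] := emean_unbounded M.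
    near=> t; have tE : E / - k <= t.
      by near: t; apply: nbhs_pinfty_ge; rewrite num_real.
    by apply: HE; rewrite -ler_pdivrMl ?oppr_gt0 // mulrC.
by exists L1 => t; rewrite HL1 FE.
Unshelve. all: end_near. Qed.

End tilted_mean.

(** * Orders of vanishing at the origin *)

Section asym.
Context {R : realType}.
Implicit Types (f g df : R -> R) (c : R) (n : nat).

(** [f x = c * x ^+ n + o (x ^+ n)] at 0. *)
Definition asym f c n := forall e, 0 < e ->
  exists2 d, 0 < d & forall x, `|x| < d -> `|f x - c * x ^+ n| <= e * `|x| ^+ n.

Lemma asym_continuous f : {for 0, continuous f} -> asym f (f 0) 0.
Proof.
move=> cf e e0; have /cvgrPdist_le/(_ _ e0) [d /= d0 Hd] := cf.
exists d => // x xd; rewrite !expr0 !mulr1 distrC; apply: Hd.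
by rewrite /ball /= sub0r normrN.
Qed.

Lemma asym_primitive f df c n : f 0 = 0 ->
  (exists2 d, 0 < d & forall x, `|x| < d -> is_derive x (1 : R) f (df x)) ->
  asym df c n -> asym f (c / n.+1%:R) n.+1.
Proof.
move=> f0 [d1 d10 Hf] Hdf e e0; have [d2 d20 H] := Hdf e e0.
exists (Num.min d1 d2) => [|x]; first by rewrite lt_min d10.
rewrite lt_min => /andP[x1 x2].
have n0 : n.+1%:R != 0 :> R by rewrite pnatr_eq0.
pose psi y := f y - c / n.+1%:R * y ^+ n.+1.
have between y : Num.min 0 x <= y <= Num.max 0 x -> `|y| <= `|x|.
  by case: (leP 0 x) => x0 /andP[y1 y2]; [rewrite !ger0_norm // (le_trans y1) |
     rewrite !ler0_norm ?lerN2 // ?ltW // ltW].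
have [y Hy|y /between yx] := @dv_MVT R psi (fun y => df y - c * y ^+ n) 0 x.
  apply: dvB; first by apply: Hf; apply: le_lt_trans x1; exact: between.
  by apply: dv_eq (dvZ _ (dvX _ _)) _; rewrite /=; field.
rewrite /psi f0 expr0n mulr0 subrr !subr0 => ->.
rewrite normrM exprS mulrA [e * _]mulrC -mulrA mulrC ler_wpM2l //.
apply: le_trans (H y (le_lt_trans yx x2)) _.
by rewrite ler_wpM2l ?(ltW e0) // lerXn2r.
Qed.

Lemma asym_le0 f c n : asym f c n ->
  (exists2 d, 0 < d & forall x, `|x| < d -> f x <= 0) -> c <= 0.
Proof.
move=> Hf [d d0 fle]; rewrite leNgt; apply/negP => c0.
have c2 : 0 < c / 2 by rewrite divr_gt0.
have [d2 d20 H] := Hf _ c2.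
pose x := Num.min d d2 / 2.
have m0 : 0 < Num.min d d2 by rewrite lt_min d0.
have x0 : 0 < x by rewrite divr_gt0.
have xm : x < Num.min d d2 by rewrite /x; lra.
have xd : `|x| < d by rewrite gtr0_norm // (lt_le_trans xm) // ge_min lexx.
have xd2 : `|x| < d2 by rewrite gtr0_norm // (lt_le_trans xm) // ge_min lexx orbT.
have := H x xd2; have := fle x xd; rewrite (gtr0_norm x0) ler_norml => h1 /andP[h2 _].
have : 0 < c / 2 * x ^+ n by rewrite mulr_gt0 // exprn_gt0.
lra.
Qed.

Lemma asym_scale f c n a : asym f c n -> asym (fun x => f (a * x)) (c * a ^+ n) n.
Proof.
move=> Hf e e0; have A0 : 0 < `|a| ^+ n + 1 by rewrite ltr_wpDl // exprn_ge0.
have [d d0 H] := Hf (e / (`|a| ^+ n + 1)) (divr_gt0 e0 A0).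
exists (d / (`|a| + 1)) => [|x xd]; first by rewrite divr_gt0 // ltr_wpDl.
have : `|a * x| < d.
  move: xd; rewrite ltr_pdivlMr ?ltr_wpDl // normrM => xd.
  by apply: le_lt_trans xd; rewrite mulrC ler_wpM2l // lerDl.
move=> /H; rewrite exprMn mulrA => /le_trans; apply.
rewrite normrM exprMn mulrA ler_wpM2r ?exprn_ge0 //.
rewrite mulrAC ler_pdivrMr // mulrDr mulr1 lerDl ltW //.
Qed.

(** A nonpositive function cannot vanish to odd order: apply [asym_le0] on both sides. *)
Lemma asym_eq0 f c n : odd n -> asym f c n ->
  (exists2 d, 0 < d & forall x, `|x| < d -> f x <= 0) -> c = 0.
Proof.
move=> on Hf [d d0 fle]; apply/eqP; rewrite eq_le (asym_le0 Hf); last by exists d.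
rewrite -oppr_le0; apply: (@asym_le0 (fun x => f (-1 * x)) _ n).
  have -> : - c = c * (-1) ^+ n by rewrite -signr_odd on expr1 mulrN1.
  exact: asym_scale.
by exists d => // x xd; apply: fle; rewrite mulN1r normrN.
Qed.

Lemma asym_mul f g c n : asym f c n -> {for 0, continuous g} ->
  asym (fun x => g x * f x) (g 0 * c) n.
Proof.
move=> Hf cg e e0; pose K := `|g 0| + 1; pose C := `|c| + 1.
have K0 : 0 < K by rewrite ltr_wpDl. have C0 : 0 < C by rewrite ltr_wpDl.
have e1 : 0 < Num.min 1 (e / 2 / C) by rewrite lt_min ltr01 !divr_gt0.
have eK : 0 < e / 2 / K by rewrite !divr_gt0.
have [d1 d10 H1] := Hf _ eK.
have /cvgrPdist_le/(_ _ e1) [d2 /= d20 H2] := cg.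
exists (Num.min d1 d2) => [|x]; first by rewrite lt_min d10.
rewrite lt_min => /andP[x1 x2].
have {}H1 := H1 x x1.
have : `|g 0 - g x| <= Num.min 1 (e / 2 / C).
  by apply: H2; rewrite /ball /= sub0r normrN.
rewrite le_min => /andP[g1 g2].
have -> : g x * f x - g 0 * c * x ^+ n =
  g x * (f x - c * x ^+ n) - (g 0 - g x) * (c * x ^+ n) by ring.
apply: le_trans (ler_normB _ _) _; rewrite !normrM normrX.
have gK : `|g x| <= K.
  have -> : g x = g 0 - (g 0 - g x) by ring.
  by apply: le_trans (ler_normB _ _) _; rewrite lerD2l.
have X0 : 0 <= `|x| ^+ n by rewrite exprn_ge0.
have t1 : `|g x| * `|f x - c * x ^+ n| <= K * (e / 2 / K * `|x| ^+ n).
  by apply: ler_pM.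
have t2 : `|g 0 - g x| * (`|c| * `|x| ^+ n) <= e / 2 / C * (C * `|x| ^+ n).
  by apply: ler_pM; rewrite ?mulr_ge0 // ler_wpM2r // lerDl.
have E1 : K * (e / 2 / K * `|x| ^+ n) = e / 2 * `|x| ^+ n by field; rewrite gt_eqF.
have E2 : e / 2 / C * (C * `|x| ^+ n) = e / 2 * `|x| ^+ n by field; rewrite gt_eqF.
move: t1 t2; rewrite E1 E2; lra.
Qed.

Lemma asym_expm1 f c n : asym f c n.+1 -> asym (fun x => expR (f x) - 1) c n.+1.
Proof.
move=> Hf e e0; pose C := `|c| + 1; have C0 : 0 < C by rewrite ltr_wpDl.
have [d1 d10 H1] := Hf 1 ltr01.
have e20 : 0 < e / 2 by rewrite divr_gt0.
have [d2 d20 H2] := Hf _ e20.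
pose m := Num.min (1 / 2) (e / 4 / C); have m0 : 0 < m by rewrite lt_min !divr_gt0.
pose d3 := Num.min 1 (m / C); have d30 : 0 < d3 by rewrite lt_min ltr01 divr_gt0.
exists (Num.min d1 (Num.min d2 d3)) => [|x]; first by rewrite !lt_min d10 d20 ltr01 divr_gt0.
rewrite !lt_min => /and4P[x1 x2 x3 x4].
have {}H1 := H1 x x1; have {}H2 := H2 x x2.
set X := `|x| ^+ n.+1 in H1 H2 *; have X0 : 0 <= X by rewrite exprn_ge0.
have Xx : X <= `|x| by rewrite /X exprS ler_piMr // exprn_ile1 // ltW.
have yC : `|f x| <= C * X.
  have -> : f x = (f x - c * x ^+ n.+1) + c * x ^+ n.+1 by ring.
  apply: le_trans (ler_normD _ _) _; rewrite normrM normrX -/X /C mulrDl addrC lerD2l.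
  by [].
have ym : `|f x| <= m.
  apply: (le_trans yC); rewrite -ler_pdivlMl // mulrC.
  by apply: (le_trans Xx); exact: ltW.
have := ym; rewrite le_min => /andP[y1 y2].
have up := expR_le_quadratic y1; have lo := expR_ge1Dx (f x).
have sq : 2 * f x ^+ 2 <= e / 2 * X.
  rewrite -real_normK ?num_real // expr2.
  have : `|f x| * `|f x| <= e / 4 / C * (C * X) by apply: ler_pM.
  have -> : e / 4 / C * (C * X) = e / 4 * X by field; rewrite gt_eqF.
  lra.
move: H2; rewrite !ler_norml => /andP[h1 h2]; apply/andP; split; lra.
Qed.

End asym.

(** * The free energy along the line of magnetizations *)

Section line.
Context {R : realType}.
Variables (p q : nat) (beta h : R).
Hypothesis hq : (2 <= q)%N.

Local Notation q1 := (q%:R - 1 : R).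

Definition vtop (s : R) : R := (1 + q1 * s) / q%:R.
Definition vbot (s : R) : R := (1 - s) / q%:R.

Lemma q1_ge1 : 1 <= q1.
Proof. by rewrite lerBrDr -(natrD _ 1 1) ler_nat. Qed.

Lemma q_gt0 : 0 < q%:R :> R.
Proof. by rewrite ltr0n; apply: leq_trans hq. Qed.

Lemma sum_ord_first (F : 'I_q -> R) (A B : R) :
  (forall r, F r = if r == 0 :> nat then A else B) -> \sum_r F r = A + q1 * B.
Proof.
move=> HF; have q0 : (0 < q)%N by apply: leq_trans hq.
rewrite (bigD1 (Ordinal q0)) //= HF /=; congr (_ + _).
rewrite (eq_bigr (fun=> B)) => [|r]; last by rewrite HF -val_eqE /= => /negbTE ->.
rewrite sumr_const -(mulr_natl B); congr (_ * _).
have -> : #|[pred r : 'I_q | r != Ordinal q0]| = q.-1.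
  by have := cardC1 (Ordinal q0); rewrite card_ord => <-; apply: eq_card => r; rewrite !inE.
by rewrite -subn1 natrB.
Qed.

Lemma xvecE (s : R) (r : 'I_q) : xvec q s 0 r = if r == 0 :> nat then vtop s else vbot s :> R.
Proof. by rewrite mxE. Qed.

Lemma vtop_vbot s : vtop s + q1 * vbot s = 1.
Proof. by rewrite /vtop /vbot; field; rewrite gt_eqF // q_gt0. Qed.

Definition interior (s : R) := - q1^-1 < s < 1.

Lemma interior_pos s : interior s -> 0 < vtop s /\ 0 < vbot s.
Proof.
move=> /andP[s1 s2]; have Q := q1_ge1; have q0 := q_gt0.
split; apply: divr_gt0 => //; last by rewrite subr_gt0.
have : q1 * (- q1^-1) < q1 * s by rewrite ltr_pM2l //; lra.
by rewrite mulrN divff ?gt_eqF //; lra.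
Qed.

Lemma xvec_prob s : interior s -> prob_vec (xvec q s : 'rV[R]_q).
Proof.
move=> /interior_pos[v1 v2]; split => [r|].
  by rewrite xvecE; case: ifP => _; exact: ltW.
by rewrite (sum_ord_first (xvecE s)) vtop_vbot.
Qed.

Lemma flineE s : fline p q beta h s =
  beta * (vtop s ^+ p + q1 * vbot s ^+ p) + h * vtop s
  - (vtop s * ln (vtop s) + q1 * (vbot s * ln (vbot s))).
Proof.
rewrite /fline /Hfun; congr (_ * _ + _ * _ - _).
- by apply: sum_ord_first => r; rewrite xvecE; case: ifP.
- rewrite first_coordE -[RHS]addr0 -[X in _ = _ + X](mulr0 q1).
  by apply: sum_ord_first => r; rewrite xvecE; case: ifP => _; rewrite ?mul1r ?mul0r.
- by apply: sum_ord_first => r; rewrite xvecE; case: ifP.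
Qed.

(** The derivatives of [t |-> beta * t ^+ p - t * ln t], written with the truncated
    predecessors that the power rule produces; the falling factorial vanishes as soon as
    a truncation occurs. *)
Definition g1 (t : R) := beta * (p%:R * t ^+ p.-1) - ln t - 1.
Definition g2 (t : R) := beta * (p%:R * (p.-1%:R * t ^+ p.-2)) - t^-1.
Definition g3 (t : R) := beta * (p%:R * (p.-1%:R * (p.-2%:R * t ^+ p.-2.-1))) + (t ^+ 2)^-1.
Definition g4 (t : R) :=
  beta * (p%:R * (p.-1%:R * (p.-2%:R * (p.-2.-1%:R * t ^+ p.-2.-2)))) - 2 / t ^+ 3.

Lemma dv_g1 (t : R) : 0 < t -> is_derive t (1 : R) g1 (g2 t).
Proof.
move=> t0; apply: dv_eq (dvB (dvB (dvZ _ (dvZ _ (dvX _ _))) (dv_ln t0)) (dv_cst _ _)) _.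
by rewrite /g2; ring.
Qed.

Lemma dv_g2 (t : R) : 0 < t -> is_derive t (1 : R) g2 (g3 t).
Proof.
move=> t0; have tn0 : t != 0 by rewrite gt_eqF.
apply: dv_eq (dvB (dvZ _ (dvZ _ (dvZ _ (dvX _ _)))) (dv_inv tn0)) _.
by rewrite /g3; ring.
Qed.

Lemma dv_g3 (t : R) : 0 < t -> is_derive t (1 : R) g3 (g4 t).
Proof.
move=> t0; have tn0 : t != 0 by rewrite gt_eqF.
have t20 : t ^+ 2 != 0 by rewrite expf_eq0 (negbTE tn0).
have H := @dv_comp R (fun y => y^-1) (fun y => y ^+ 2) t _ _ (dv_inv t20) (dvX 2 t).
apply: dv_eq (dvD (dvZ _ (dvZ _ (dvZ _ (dvZ _ (dvX _ _))))) H) _.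
by rewrite /g4 /=; field.
Qed.

Lemma dv_vtop (s : R) : is_derive s (1 : R) vtop (q1 / q%:R).
Proof.
apply: dv_eq (dvM (dvD (dv_cst _ 1) (dvZ q1 (dv_id s))) (dv_cst s q%:R^-1)) _.
ring.
Qed.

Lemma dv_vbot (s : R) : is_derive s (1 : R) vbot (- q%:R^-1).
Proof.
apply: dv_eq (dvM (dvB (dv_cst _ 1) (dv_id s)) (dv_cst s q%:R^-1)) _.
ring.
Qed.

Definition F1 s := q1 / q%:R * (g1 (vtop s) + h) - q1 / q%:R * g1 (vbot s).
Definition F2 s := (q1 / q%:R) ^+ 2 * g2 (vtop s) + q1 / q%:R ^+ 2 * g2 (vbot s).
Definition F3 s := (q1 / q%:R) ^+ 3 * g3 (vtop s) - q1 / q%:R ^+ 3 * g3 (vbot s).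
Definition F4 s := (q1 / q%:R) ^+ 4 * g4 (vtop s) + q1 / q%:R ^+ 4 * g4 (vbot s).

Lemma dv_F0 (s : R) : interior s -> is_derive s (1 : R) (fline p q beta h) (F1 s).
Proof.
move=> /interior_pos[v1 v2]; have q0 : q%:R != 0 :> R by rewrite gt_eqF // q_gt0.
have -> : fline p q beta h = fun s => beta * (vtop s ^+ p + q1 * vbot s ^+ p) + h * vtop s
  - (vtop s * ln (vtop s) + q1 * (vbot s * ln (vbot s))).
  by apply/funext => t; exact: flineE.
have t1 := dv_vtop s; have t2 := dv_vbot s.
have P1 := dv_comp (dvX p (vtop s)) t1; have P2 := dv_comp (dvX p (vbot s)) t2.
have L1 := dvM t1 (dv_comp (dv_ln v1) t1); have L2 := dvM t2 (dv_comp (dv_ln v2) t2).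
apply: dv_eq (dvB (dvD (dvZ beta (dvD P1 (dvZ q1 P2))) (dvZ h t1)) (dvD L1 (dvZ q1 L2))) _.
rewrite /F1 /g1; field.
by rewrite q0 !gt_eqF.
Qed.

Lemma dv_F1 (s : R) : interior s -> is_derive s (1 : R) F1 (F2 s).
Proof.
move=> /interior_pos[v1 v2].
have T1 := dv_comp (dv_g1 v1) (dv_vtop s); have T2 := dv_comp (dv_g1 v2) (dv_vbot s).
apply: dv_eq (dvB (dvZ (q1 / q%:R) (dvD T1 (dv_cst _ h))) (dvZ (q1 / q%:R) T2)) _.
by rewrite /F2; field; rewrite gt_eqF // q_gt0.
Qed.

Lemma dv_F2 (s : R) : interior s -> is_derive s (1 : R) F2 (F3 s).
Proof.
move=> /interior_pos[v1 v2].
have T1 := dv_comp (dv_g2 v1) (dv_vtop s); have T2 := dv_comp (dv_g2 v2) (dv_vbot s).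
apply: dv_eq (dvD (dvZ ((q1 / q%:R) ^+ 2) T1) (dvZ (q1 / q%:R ^+ 2) T2)) _.
by rewrite /F3; field; rewrite gt_eqF // q_gt0.
Qed.

Lemma dv_F3 (s : R) : interior s -> is_derive s (1 : R) F3 (F4 s).
Proof.
move=> /interior_pos[v1 v2].
have T1 := dv_comp (dv_g3 v1) (dv_vtop s); have T2 := dv_comp (dv_g3 v2) (dv_vbot s).
apply: dv_eq (dvB (dvZ ((q1 / q%:R) ^+ 3) T1) (dvZ (q1 / q%:R ^+ 3) T2)) _.
by rewrite /F4; field; rewrite gt_eqF // q_gt0.
Qed.

Lemma interior_ball s : interior s -> exists2 d, 0 < d & forall x, `|x| < d -> interior (s + x).
Proof.
move=> /andP[s1 s2]; exists (Num.min (s + q1^-1) (1 - s)).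
  by rewrite lt_min; apply/andP; split; lra.
by move=> x; rewrite lt_min !ltr_norml => /andP[/andP[? ?] /andP[? ?]]; apply/andP; split; lra.
Qed.

Lemma derive1_interior (f g dg : R -> R) (s : R) :
  (forall s, interior s -> f s = g s) ->
  (forall s : R, interior s -> is_derive s (1 : R) g (dg s)) ->
  interior s -> derive1 f s = dg s.
Proof.
move=> fg Hg si; have [d d0 Hd] := interior_ball si.
have near_fg : \near s, g s = f s.
  exists d => //= y; rewrite /ball /= distrC => yd.
  by rewrite fg // -[y](subrK s) addrC; exact: Hd.
have dgs := Hg s si.
by rewrite derive1E -(near_eq_derive _ near_fg) ?oner_neq0 // derive_val.
Qed.

Lemma derive1n4_fline s : interior s -> derive1n 4 (fline p q beta h) s = F4 s.
Proof.
move=> si; rewrite /derive1n /=.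
apply: (derive1_interior _ dv_F3) => // {si}s si.
apply: (derive1_interior _ dv_F2) => // {si}s si.
apply: (derive1_interior _ dv_F1) => // {si}s si.
by apply: (derive1_interior _ dv_F0).
Qed.

End line.

(** * Special points *)

(** With [A] and [B] the values of [kappa * u ^+ p.-1] at the two coordinates [a > b] of the
    maximizer and [k = p - 2], the hypotheses [flat2] and [flat3] are the vanishing of the
    second and third derivatives of the free energy along the line, cleared of common
    positive factors. *)
Section flatness_algebra.
Context {R : realType}.
Variables (kap a b q1 : R) (k : nat).
Hypotheses (kap0 : 0 < kap) (b0 : 0 < b) (ba : b < a) (hq1 : 1 <= q1).

Local Notation A := (kap * a ^+ k.+1).
Local Notation B := (kap * b ^+ k.+1).
Local Notation rho := (q1 * b / a).

Hypothesis flat2 : rho * (A - 1) = 1 - B.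
Hypothesis flat3 : rho ^+ 2 * (k%:R * A + 1) = k%:R * B + 1.

Let a0 : 0 < a. Proof. exact: lt_trans ba. Qed.
Let rho0 : 0 < rho. Proof. by rewrite divr_gt0 // mulr_gt0 // (lt_le_trans ltr01). Qed.

Lemma flat_kB : k%:R * B = k%:R * rho + rho - 1.
Proof.
have r1 : 0 < 1 + rho by rewrite addr_gt0.
apply: (mulIf (lt0r_neq0 r1)); have E := congr1 (fun u => k%:R * rho * u) flat2.
by move: E flat3; lra.
Qed.

Lemma flat_kA : k%:R * (rho * A) = k%:R + 1 - rho.
Proof.
by have := congr1 (fun u => k%:R * u) flat2; have := flat_kB; lra.
Qed.

Lemma AB_lt : B < A.
Proof. by rewrite ltr_pM2l // ltrXn2r // ltW. Qed.

(** The second, third and fourth derivatives cannot vanish together off the centre: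
    elimination leaves [k * rho = rho ^+ 2 + 1] and then [B = rho ^+ 3 * A]. *)
Lemma flat4_absurd :
  rho ^+ 3 * (k%:R * (k%:R - 1) * A - 2) = 2 - k%:R * (k%:R - 1) * B -> False.
Proof.
move=> flat4; have kA := flat_kA; have kB := flat_kB.
have ra : rho * a = q1 * b by rewrite divfK // gt_eqF.
have AB := AB_lt.
move: ra kA kB rho0 flat4 AB; set r := rho; set K : R := k%:R; set A0 := A; set B0 := B.
move=> ra kA kB r0 flat4 AB.
have K0 : 0 <= K by exact: ler0n.
have E1 : (K + 1) * (1 + r) * (K * r - r ^+ 2 - 1) = 0.
  have h1 : (K - 1) * r ^+ 2 * (K * (r * A0)) = (K - 1) * r ^+ 2 * (K + 1 - r) by rewrite kA.
  have h2 : (K - 1) * (K * B0) = (K - 1) * (K * r + r - 1) by rewrite kB.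
  lra.
have Kr : K * r = r ^+ 2 + 1.
  move/eqP: E1; rewrite !mulf_eq0 => /orP[/orP[/eqP|/eqP]|/eqP]; lra.
have Kpos : 0 < K by rewrite -(pmulr_lgt0 _ r0) Kr addr_gt0 // exprn_gt0.
have BA : B0 = r ^+ 3 * A0.
  apply: (mulfI (lt0r_neq0 Kpos)).
  have h1 : r ^+ 2 * (K * (r * A0)) = r ^+ 2 * (K + 1 - r) by rewrite kA.
  have h2 : r * (K * r) = r * (r ^+ 2 + 1) by rewrite Kr.
  lra.
have K2 : 2 <= K.
  rewrite -(ler_pM2r r0) Kr; have := sqr_ge0 (r - 1); lra.
have [j kj] : exists j, k = j.+2.
  by move: K2; rewrite /K ler_nat; case: (k) => [|[|j]] // _; exists j.
case: j kj => [|j] kj.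
  have r1 : r = 1.
    apply/eqP; rewrite -subr_eq0 -sqrf_eq0; apply/eqP.
    have : K = 2 by rewrite /K kj.
    move=> KE; rewrite KE in Kr; lra.
  by move: BA; rewrite r1 expr1n mul1r => BA; rewrite BA ltxx in AB.
have E : b ^+ j.+1 = q1 ^+ 3 * a ^+ j.+1.
  have c0 : kap * (a ^+ 3 * b ^+ 3) != 0 by rewrite !mulf_neq0 ?expf_neq0 ?gt_eqF.
  apply: (mulfI c0).
  have -> : kap * (a ^+ 3 * b ^+ 3) * b ^+ j.+1 = a ^+ 3 * B0.
    by rewrite /B0 kj -[j.+4]/(3 + j.+1)%N exprD; ring.
  rewrite BA.
  have -> : a ^+ 3 * (r ^+ 3 * A0) = (r * a) ^+ 3 * A0 by ring.
  by rewrite ra /A0 kj -[j.+4]/(3 + j.+1)%N exprD; ring.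
have : b ^+ j.+1 < a ^+ j.+1 by rewrite ltrXn2r // ltW.
have : a ^+ j.+1 <= q1 ^+ 3 * a ^+ j.+1.
  by rewrite ler_peMl ?exprn_ege1 // exprn_ge0 // ltW.
by rewrite -E leNgt => /negP.
Qed.

(** For [q = 2] and [p] at most 3, the relations leave no room for [rho < 1]. *)
Lemma flat_lowdegree_absurd : q1 = 1 -> (k < 2)%N -> False.
Proof.
move=> q1E k2; have r1 : rho < 1 by rewrite q1E mul1r ltr_pdivrMr // mul1r.
have kA := flat_kA; have kB := flat_kB.
have BA : B = rho ^+ k.+1 * A.
  have bE : rho * a = b by rewrite q1E mul1r divfK // gt_eqF.
  by rewrite -[in LHS]bE exprMn; ring.
move: BA r1 kA kB flat3 rho0.
set r := rho; set A0 := A; set B0 := B => BA r1 kA kB f3 r0.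
have r21 : r ^+ 2 < 1 by rewrite exprn_ilt1 // ltW.
case: (k) k2 BA kA kB f3 => [|[|//]] _ BA kA kB f3; first by lra.
have : B0 = r * (r * A0) by rewrite BA; ring.
rewrite !mul1r in kA kB; rewrite kA; lra.
Qed.

End flatness_algebra.

Section special_point.
Context {R : realType}.
Variables (p q : nat) (beta h s : R).
Hypotheses (hp : (2 <= p)%N) (hq : (2 <= q)%N) (hbeta : 0 < beta).
Hypothesis hspecial : special p q beta h s.

Local Notation q1 := (q%:R - 1 : R).
Local Notation a := (vtop q s).
Local Notation b := (vbot q s).
Local Notation D1 := (F1 p q beta h).
Local Notation D2 := (F2 p q beta).
Local Notation D3 := (F3 p q beta).
Local Notation D4 := (F4 p q beta).

(** [kappa * u ^+ p.-1] is the ratio of the curvature of the energy to that of the entropy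
    at [u]. *)
Definition kappa : R := beta * (p%:R * p.-1%:R).

Let Q := @q1_ge1 R q hq.
Let q0 := @q_gt0 R q hq.
Let q1pos : 0 < q1. Proof. exact: lt_le_trans Q. Qed.

Lemma special_interior : interior q s.
Proof.
have [/andP[s0 s1] _ _] := hspecial; apply/andP; split=> //.
by apply: lt_le_trans s0; rewrite oppr_lt0 invr_gt0; apply: lt_le_trans Q.
Qed.

Let pos := interior_pos hq special_interior.
Let a0 : 0 < a := pos.1.
Let b0 : 0 < b := pos.2.

Lemma vtop_sub_vbot : a - b = s.
Proof. by rewrite /vtop /vbot; field; rewrite gt_eqF. Qed.

Lemma vbot_lt : 0 < s -> b < a.
Proof. by rewrite -(subr_gt0 b) vtop_sub_vbot. Qed.

Lemma vbot_eq : s = 0 -> a = b.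
Proof. by move=> s0; apply/eqP; rewrite -subr_eq0 vtop_sub_vbot s0. Qed.

Lemma kappa_gt0 : 0 < kappa.
Proof. by rewrite !mulr_gt0 // ltr0n; [apply: ltnW | case: (p) hp => [|[]]]. Qed.

Lemma fline_max : exists2 d, 0 < d & forall x, `|x| < d ->
  fline p q beta h (s + x) - fline p q beta h s <= 0.
Proof.
have [d d0 Hd] := interior_ball special_interior.
exists d => // x xd; rewrite subr_le0.
have [_ [[_ maxm] _] _] := hspecial.
by apply: maxm; apply: xvec_prob => //; exact: Hd.
Qed.

Lemma asym_shift (f df : R -> R) c n : f s = 0 ->
  (forall s : R, interior q s -> is_derive s (1 : R) f (df s)) ->
  asym (fun x => df (s + x)) c n -> asym (fun x => f (s + x)) (c / n.+1%:R) n.+1.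
Proof.
move=> f0 Hf; apply: asym_primitive; first by rewrite addr0.
have [d d0 Hd] := interior_ball special_interior.
exists d => // x xd.
apply: dv_eq (@dv_comp R f (fun x => s + x) x _ _ (Hf _ (Hd x xd)) (dvD (dv_cst x s) (dv_id x))) _.
by rewrite add0r mulr1.
Qed.

Lemma asym_shift0 (f df : R -> R) :
  (forall s : R, interior q s -> is_derive s (1 : R) f (df s)) ->
  asym (fun x => f (s + x)) (f s) 0.
Proof.
move=> Hf; have := @asym_continuous R (fun x => f (s + x)); rewrite addr0; apply.
have ds := @dv_comp R f (fun x => s + x) 0 (df s) _ _ (dvD (dv_cst 0 s) (dv_id 0)).
by apply: (dv_continuous (ds _)); rewrite addr0; apply: Hf; exact: special_interior.
Qed.

Lemma asym_fline c n : asym (fun x => D1 (s + x)) c n ->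
  asym (fun x => fline p q beta h (s + x) - fline p q beta h s) (c / n.+1%:R) n.+1.
Proof.
move=> H; apply: (@asym_shift (fun y => fline p q beta h y - fline p q beta h s) D1) H.
  by rewrite subrr.
move=> y yi; apply: dv_eq (dvB (dv_F0 p beta h hq yi) (dv_cst _ _)) _.
by rewrite subr0.
Qed.

Lemma F1_eq0 : D1 s = 0.
Proof.
have := asym_eq0 _ (asym_fline (asym_shift0 (dv_F1 p beta h hq))) fline_max.
by rewrite divr1; apply.
Qed.

Lemma F2_le0 : D2 s <= 0.
Proof.
have A1 := asym_shift F1_eq0 (dv_F1 p beta h hq) (asym_shift0 (dv_F2 p beta hq)).
have := asym_le0 (asym_fline A1) fline_max.
by rewrite divr1 pmulr_lle0 // invr_gt0.
Qed.

Lemma powS (t : R) : 0 < t -> t ^+ p.-2 = t ^+ p.-1 / t.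
Proof.
move=> t0; have -> : p.-1 = p.-2.+1 by case: (p) hp => [|[]].
by rewrite exprSr mulfK // gt_eqF.
Qed.

Lemma g2E (t : R) : 0 < t -> g2 p beta t = (kappa * t ^+ p.-1 - 1) / t.
Proof. by move=> t0; rewrite /g2 powS // /kappa; field; rewrite gt_eqF. Qed.

Lemma g3E (t : R) : 0 < t ->
  g3 p beta t = (p.-2%:R * (kappa * t ^+ p.-1) + 1) / t ^+ 2.
Proof.
move=> t0; rewrite /g3 /kappa; case: (p) hp => [|[|[|k]]] //= _.
  by field; rewrite gt_eqF.
by rewrite !exprS; field; rewrite gt_eqF.
Qed.

Lemma g4E (t : R) : 0 < t ->
  g4 p beta t = (p.-2%:R * (p.-2%:R - 1) * (kappa * t ^+ p.-1) - 2) / t ^+ 3.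
Proof.
move=> t0; rewrite /g4 /kappa; case: (p) hp => [|[|[|[|k]]]] //= _; try by field; rewrite gt_eqF.
by rewrite -(natr1 k.+1) !exprS; field; rewrite gt_eqF.
Qed.

Lemma F2E : D2 s = q1 / q%:R ^+ 2 *
  (q1 * ((kappa * a ^+ p.-1 - 1) / a) + (kappa * b ^+ p.-1 - 1) / b).
Proof. by rewrite /F2 !g2E //; field; rewrite !gt_eqF. Qed.

Lemma vbot_le : b <= a.
Proof. by rewrite -subr_ge0 vtop_sub_vbot; have [/andP[]] := hspecial. Qed.

Lemma kappa_mono : kappa * b ^+ p.-1 <= kappa * a ^+ p.-1.
Proof. by rewrite ler_pM2l ?kappa_gt0 // lerXn2r ?nnegrE ?vbot_le // ltW. Qed.

Lemma F2_lt0_bot : D2 s < 0 -> kappa * b ^+ p.-1 < 1.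
Proof.
rewrite F2E pmulr_rlt0; last by rewrite divr_gt0 ?exprn_gt0.
apply: contraTT; rewrite -!leNgt => B1.
have A1 := le_trans B1 kappa_mono.
by apply: addr_ge0; [apply: mulr_ge0; [exact: ltW|]|]; apply: divr_ge0;
  rewrite ?subr_ge0 // ltW.
Qed.

(** If [D2 s] were negative, the coefficient of [Qform] on the equal coordinates would be
    negative too, and the Cauchy-Schwarz inequality for [t 0 i0 = - \sum_(r != i0) t 0 r]
    would make [Qform] negative definite on the sum-zero hyperplane. *)
Lemma F2_eq0 : D2 s = 0.
Proof.
apply/eqP; rewrite eq_le F2_le0 /= leNgt; apply/negP => F2neg.
have B1 := F2_lt0_bot F2neg.
have [_ _ [t [tn0 tsum]]] := hspecial.
pose al := g2 p beta a; pose ga := g2 p beta b.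
have ga0 : ga < 0 by rewrite /ga g2E // pmulr_llt0 ?invr_gt0 // subr_lt0.
have comb : q1 * al + ga < 0.
  move: F2neg; rewrite /F2 -/al -/ga.
  have -> : (q1 / q%:R) ^+ 2 * al + q1 / q%:R ^+ 2 * ga = q1 / q%:R ^+ 2 * (q1 * al + ga) by field; rewrite gt_eqF.
  by rewrite pmulr_rlt0 // divr_gt0 ?exprn_gt0.
pose i0 : 'I_q := Ordinal (ltnW hq).
have QE : Qform p (xvec q s) beta t = al * t 0 i0 ^+ 2 + ga * \sum_(r | r != i0) t 0 r ^+ 2.
  have cE : beta * p%:R * (p%:R - 1) = beta * (p%:R * p.-1%:R) :> R.
    by rewrite -subn1 natrB ?mulrA // ltnW.
  rewrite /Qform (bigD1 i0) //= xvecE /= mulr_sumr; congr (_ + _).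
    by rewrite cE /al /g2 subn2 !mulrA.
  apply: eq_bigr => r ri; rewrite xvecE ifN; last by rewrite -val_eqE in ri.
  by rewrite cE /ga /g2 subn2 !mulrA.
rewrite QE; set t0 := t 0 i0; set S := \sum_(r | r != i0) _ => Q0.
have sumr : \sum_(r | r != i0) t 0 r = - t0.
  have := tsum; rewrite (bigD1 i0) //= -/t0 => /eqP.
  by rewrite addrC addr_eq0 => /eqP.
have S0 : 0 <= S by apply: sumr_ge0 => r _; exact: sqr_ge0.
have cauchy : t0 ^+ 2 <= q1 * S.
  have : 0 <= \sum_(r | r != i0) (q1 * t 0 r + t0) ^+ 2 by apply: sumr_ge0 => r _; exact: sqr_ge0.
  have cardE : \sum_(r | r != i0) (1 : R) = q1.
    have := @sum_ord_first R q hq (fun r => if r == 0 :> nat then 0 else 1) 0 1 (fun=> erefl).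
    rewrite (bigD1 i0) //= !add0r mulr1 => <-; apply: eq_bigr => r ri.
    by move: ri; rewrite -val_eqE /= => /negbTE ->.
  have -> : \sum_(r | r != i0) (q1 * t 0 r + t0) ^+ 2 =
      q1 ^+ 2 * S + 2 * q1 * t0 * (\sum_(r | r != i0) t 0 r) + t0 ^+ 2 * \sum_(r | r != i0) 1.
    rewrite !mulr_sumr -!big_split /=; apply: eq_bigr => r _; ring.
  rewrite sumr cardE.
  have -> : q1 ^+ 2 * S + 2 * q1 * t0 * - t0 + t0 ^+ 2 * q1 = q1 * (q1 * S - t0 ^+ 2) by ring.
  by rewrite pmulr_rge0 ?subr_ge0.
have t00 : t0 ^+ 2 = 0.
  apply/eqP; rewrite eq_le sqr_ge0 andbT leNgt; apply/negP => tpos.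
  have : q1 * (al * t0 ^+ 2 + ga * S) = 0 by rewrite Q0 mulr0.
  have : ga * (q1 * S) <= ga * t0 ^+ 2 by rewrite ler_nM2l.
  have : (q1 * al + ga) * t0 ^+ 2 < 0 by rewrite pmulr_llt0.
  lra.
have S00 : S = 0.
  by move: Q0; rewrite t00 mulr0 add0r => /eqP; rewrite mulf_eq0 lt_eqF //= => /eqP.
move/eqP: tn0; apply; apply/rowP => r; rewrite !mxE.
have [->|ri] := eqVneq r i0; first by apply/eqP; rewrite -sqrf_eq0; apply/eqP.
apply/eqP; rewrite -sqrf_eq0; apply/eqP.
by apply: (psumr_eq0P _ S00) => // i _; exact: sqr_ge0.
Qed.

(** With the first two derivatives zero, a local maximum excludes a cubic term. *)
Lemma F3_eq0 : D3 s = 0.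
Proof.
have A2 := asym_shift F2_eq0 (dv_F2 p beta hq) (asym_shift0 (dv_F3 p beta hq)).
have A1 := asym_shift F1_eq0 (dv_F1 p beta h hq) A2.
have := asym_eq0 _ (asym_fline A1) fline_max.
move=> /(_ isT) /eqP; rewrite divr1 !mulf_eq0 !invr_eq0 !pnatr_eq0 !orbF.
by move/eqP.
Qed.

Lemma F4_derivable x : interior q x -> exists d, is_derive x (1 : R) D4 d.
Proof.
have Hg (t : R) : 0 < t -> exists d, is_derive t (1 : R) (g4 p beta) d.
  move=> t0; have t30 : t ^+ 3 != 0 by rewrite expf_eq0 gt_eqF.
  have H := @dv_comp R (fun y => y^-1) (fun y => y ^+ 3) t _ _ (dv_inv t30) (dvX 3 t).
  by eexists; exact: (dvB (dvZ _ (dvZ _ (dvZ _ (dvZ _ (dvZ _ (dvX _ _)))))) (dvZ 2 H)).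
move=> /(interior_pos hq)[v1 v2]; have [d1 H1] := Hg _ v1; have [d2 H2] := Hg _ v2.
have T1 := dv_comp H1 (dv_vtop q x); have T2 := dv_comp H2 (dv_vbot q x).
by eexists; exact: (dvD (dvZ ((q1 / q%:R) ^+ 4) T1) (dvZ (q1 / q%:R ^+ 4) T2)).
Qed.

Lemma F1_asym : asym (fun x => D1 (s + x)) (D4 s / 6) 3.
Proof.
have A4 : asym (fun x => D4 (s + x)) (D4 s) 0.
  have := @asym_continuous R (fun x => D4 (s + x)); rewrite addr0; apply.
  have [d d4] := F4_derivable special_interior.
  apply: (@dv_continuous R _ 0 (d * (0 + 1))).
  by apply: dv_comp (dvD (dv_cst 0 s) (dv_id 0)); rewrite addr0.
have A3 := asym_shift F3_eq0 (dv_F3 p beta hq) A4.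
have A2 := asym_shift F2_eq0 (dv_F2 p beta hq) A3.
have := asym_shift F1_eq0 (dv_F1 p beta h hq) A2.
by have -> : D4 s / 1%:R / 2%:R / 3%:R = D4 s / 6 by field.
Qed.

End special_point.

Section special_consequences.
Context {R : realType}.
Variables (p q : nat) (beta h s : R).
Hypotheses (hp : (2 <= p)%N) (hq : (2 <= q)%N) (hbeta : 0 < beta).
Hypothesis hspecial : special p q beta h s.

Local Notation q1 := (q%:R - 1 : R).
Local Notation a := (vtop q s).
Local Notation b := (vbot q s).
Local Notation kap := (kappa p beta).

Let Q := @q1_ge1 R q hq.
Let q0 := @q_gt0 R q hq.
Let q1pos : 0 < q1. Proof. exact: lt_le_trans Q. Qed.
Let pos := interior_pos hq (special_interior hq hspecial).
Let a0 : 0 < a := pos.1.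
Let b0 : 0 < b := pos.2.

Lemma special_s_ge0 : 0 <= s.
Proof. by have [/andP[]] := hspecial. Qed.

Lemma special_F2 : q1 * ((kap * a ^+ p.-1 - 1) / a) + (kap * b ^+ p.-1 - 1) / b = 0.
Proof.
have := F2_eq0 hp hq hbeta hspecial; rewrite (F2E hp hq hspecial) => /eqP.
by rewrite mulf_eq0 gt_eqF ?divr_gt0 ?exprn_gt0 //= => /eqP.
Qed.

Lemma special_F3 : q1 ^+ 2 * ((p.-2%:R * (kap * a ^+ p.-1) + 1) / a ^+ 2) =
  (p.-2%:R * (kap * b ^+ p.-1) + 1) / b ^+ 2.
Proof.
have := F3_eq0 hp hq hbeta hspecial; rewrite /F3 !g3E // => E.
have c0 : q1 / q%:R ^+ 3 != 0 by rewrite mulf_neq0 ?invr_eq0 ?expf_neq0 ?gt_eqF.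
apply: (mulfI c0); apply/eqP; rewrite -subr_eq0 -E; apply/eqP.
by field; rewrite !gt_eqF.
Qed.

(** The two terms of [special_F2] have opposite signs, and the larger coordinate has the
    larger ratio. *)
Lemma special_vbot_convex : 0 < s -> kap * b ^+ p.-1 < 1.
Proof.
move=> s0; have ba := vbot_lt hq s0; have k0 := kappa_gt0 hp hbeta.
have lt : kap * b ^+ p.-1 < kap * a ^+ p.-1.
  rewrite ltr_pM2l // ltrXn2r ?nnegrE ?(ltW b0) ?(ltW a0) //.
  by case: (p) hp => [|[]].
rewrite ltNge; apply/negP => B1; have := special_F2; apply/eqP; rewrite gt_eqF //.
apply: ltr_wpDr; first by rewrite divr_ge0 ?subr_ge0 // ltW.
by rewrite mulr_gt0 // divr_gt0 // subr_gt0 (le_lt_trans B1).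
Qed.

(** At the centre the third derivative is a positive multiple of [q1 ^+ 2 - 1]. *)
Lemma special_centre : s = 0 -> q = 2%N.
Proof.
move=> s0; have ab := vbot_eq hq s0; have := special_F3; rewrite -ab => E.
have c0 : 0 < (p.-2%:R * (kap * a ^+ p.-1) + 1) / a ^+ 2.
  apply: divr_gt0; last exact: exprn_gt0.
  by rewrite ltr_wpDl // !mulr_ge0 // ?exprn_ge0 // ltW // kappa_gt0.
have : q1 ^+ 2 = 1 by apply: (mulIf (lt0r_neq0 c0)); rewrite mul1r.
move=> /eqP; rewrite sqrf_eq1 => /orP[] /eqP E1; last by have := q1pos; rewrite E1 oppr_gt0 ltr10.
apply/eqP; rewrite -(eqr_nat R) -(subr_eq0 q%:R); apply/eqP.
have -> : q%:R - 2%:R = q1 - 1 :> R by ring.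
by rewrite E1 subrr.

Qed.

Lemma special_centre_half : s = 0 -> q1 = 1 /\ a = 1/2 /\ b = 1/2.
Proof.
move=> s0; have q2 := special_centre s0.
by rewrite /vtop /vbot s0 q2; split; [|split]; field.
Qed.

Lemma special_centre_kappa : s = 0 -> kap * (1/2) ^+ p.-1 = 1.
Proof.
move=> s0; have [E1 [aE bE]] := special_centre_half s0.
have := special_F2; rewrite aE bE E1; lra.
Qed.

Lemma special_centre_F4 : s = 0 ->
  F4 p q beta s = p.-2%:R * (p.-2%:R - 1) - 2.
Proof.
move=> s0; have [E1 [aE bE]] := special_centre_half s0; have q2 := special_centre s0.
have K := special_centre_kappa s0.
by rewrite /F4 !g4E ?aE ?bE ?divr_gt0 // K E1 q2; field.
Qed.

Lemma special_typeI_centre : s = 0 -> F4 p q beta s < 0 -> (p < 4)%N.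
Proof.
move=> s0; rewrite special_centre_F4 //; case: (p) => [|[|[|[|k]]]] //=.
rewrite -[k.+2%:R]natr1 -natr1; have : 0 <= (k%:R : R) := ler0n _ _.
by move=> k0 H; exfalso; nra.
Qed.

Lemma special_typeII_centre : s = 0 -> F4 p q beta s = 0 -> p = 4%N.
Proof.
move=> s0; rewrite special_centre_F4 //.
case: (p) hp => [|[|[|[|[|k]]]]] //= _; try by move=> H; exfalso; lra.
have : 0 <= (k%:R : R) := ler0n _ _.
by rewrite -!natr1 => k0 H; exfalso; nra.
Qed.

Lemma flat_conditions : let rho := q1 * b / a in
  rho * (kap * a ^+ p.-2.+1 - 1) = 1 - kap * b ^+ p.-2.+1 /\
  rho ^+ 2 * (p.-2%:R * (kap * a ^+ p.-2.+1) + 1) = p.-2%:R * (kap * b ^+ p.-2.+1) + 1.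
Proof.
have -> : p.-2.+1 = p.-1 by case: (p) hp => [|[]].
have := special_F2; have := special_F3; move: (kap * _) (kap * _) => B A /= E3 E2; split.
  have := congr1 (fun u => b * u) E2; rewrite mulr0 mulrDr [b * (_ / b)]mulrC divfK ?gt_eqF //.
  have -> : b * (q1 * ((A - 1) / a)) = q1 * b / a * (A - 1) by ring.
  lra.
have := congr1 (fun u => b ^+ 2 * u) E3; rewrite /= [b ^+ 2 * (_ / b ^+ 2)]mulrC divfK.
  by move=> <-; field; rewrite gt_eqF.
by rewrite expf_neq0 // gt_eqF.
Qed.

Lemma typeII_centre : F4 p q beta s = 0 -> s = 0.
Proof.
move=> E4; apply/eqP; rewrite eq_le special_s_ge0 andbT leNgt; apply/negP => s0.
have [f2 f3] := flat_conditions.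
apply: (flat4_absurd (kappa_gt0 hp hbeta) b0 (vbot_lt hq s0) Q f2 f3).
have -> : p.-2.+1 = p.-1 by case: (p) hp => [|[]].
move: E4; rewrite /F4 !g4E //; move: (kap * _) (kap * _) => B A E4.
have c0 : q1 / (q%:R ^+ 4 * b ^+ 3) != 0.
  by rewrite gt_eqF // divr_gt0 // mulr_gt0 // exprn_gt0.
apply: (mulfI c0); apply/eqP; rewrite -subr_eq0 -E4; apply/eqP.
by field; rewrite !gt_eqF.
Qed.

Lemma lowdegree_centre : (p, q) \in [:: (2, 2); (3, 2)]%N -> s = 0.
Proof.
move=> pq; apply/eqP; rewrite eq_le special_s_ge0 andbT leNgt; apply/negP => s0.
have [f2 f3] := flat_conditions.
move: pq; rewrite !inE !xpair_eqE => pq.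
apply: (flat_lowdegree_absurd b0 (vbot_lt hq s0) Q f2 f3).
  by case/orP: pq => /andP[_ /eqP ->]; rewrite -natr1; ring.
by case/orP: pq => /andP[/eqP -> _].
Qed.

End special_consequences.

(** * The drift of the exchange dynamics *)

Section drift.
Context {R : realType}.
Variables (p q : nat) (beta h s : R).

Local Notation q1 := (q%:R - 1 : R).
Local Notation a := (vtop q s).
Local Notation b := (vbot q s).

(** The rate at which spins leave a colour of proportion [t], in the dynamics that is
    reversible for the Potts law. *)
Definition theta (t : R) : R := t * expR (- (beta * (p%:R * t ^+ p.-1))).

Definition drift (xi : R) : R := expR (- h) * theta (a - q1 * xi) - theta (b + xi).

Definition log_drift (xi : R) : R :=
  ln (a - q1 * xi) - ln (b + xi)
  + beta * (p%:R * (b + xi) ^+ p.-1) - beta * (p%:R * (a - q1 * xi) ^+ p.-1) - h.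

Hypotheses (hp : (2 <= p)%N) (hq : (2 <= q)%N) (hbeta : 0 < beta).
Hypothesis hspecial : special p q beta h s.

Let q1pos : 0 < q1. Proof. exact: lt_le_trans (@q1_ge1 R q hq). Qed.
Let q0 := @q_gt0 R q hq.
Let pos := interior_pos hq (special_interior hq hspecial).
Let a0 : 0 < a := pos.1.
Let b0 : 0 < b := pos.2.

Lemma theta_gt0 t : 0 < t -> 0 < theta t.
Proof. by move=> t0; rewrite mulr_gt0 // expR_gt0. Qed.

Lemma dv_theta (t : R) : is_derive t (1 : R) theta
  ((1 - kappa p beta * t ^+ p.-1) * expR (- (beta * (p%:R * t ^+ p.-1)))).
Proof.
apply: dv_eq (dvM (dv_id t) (dv_exp (dvN (dvZ beta (dvZ p%:R (dvX _ _)))))) _.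
rewrite /kappa; have -> : p.-1 = p.-2.+1 by case: (p) hp => [|[]].
by rewrite exprS /=; ring.
Qed.

Lemma driftE xi : 0 < a - q1 * xi -> 0 < b + xi ->
  drift xi = theta (b + xi) * (expR (log_drift xi) - 1).
Proof.
move=> u0 v0; rewrite /drift /theta /log_drift !expRD !expRN !lnK ?posrE //.
by field; rewrite !gt_eqF ?expR_gt0.
Qed.

(** The logarithmic drift is the derivative of the free energy along the line, so its
    order of vanishing is that of [F1]. *)
Lemma log_driftE xi : log_drift xi = - (q%:R / q1) * F1 p q beta h (s + (- q%:R) * xi).
Proof.
rewrite /F1 /g1.
have -> : vtop q (s + - q%:R * xi) = a - q1 * xi by rewrite /vtop; field; rewrite gt_eqF.
have -> : vbot q (s + - q%:R * xi) = b + xi by rewrite /vbot; field; rewrite gt_eqF.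
by rewrite /log_drift; field; rewrite !gt_eqF.
Qed.

Lemma near_interior : exists2 d, 0 < d &
  forall xi, `|xi| < d -> 0 < a - q1 * xi /\ 0 < b + xi.
Proof.
exists (Num.min (a / q1) b) => [|xi]; first by rewrite lt_min b0 divr_gt0.
rewrite lt_min ltr_pdivlMr // => /andP[x1 x2]; split.
  by rewrite subr_gt0 mulrC; apply: le_lt_trans x1; rewrite ler_pM2r // ler_norm.
by rewrite -ltrBlDl sub0r ltrNl; apply: le_lt_trans x2; rewrite -normrN ler_norm.
Qed.

Lemma asym_near (f g : R -> R) c n :
  (exists2 d, 0 < d & forall x, `|x| < d -> f x = g x) -> asym f c n -> asym g c n.
Proof.
move=> [d1 d10 H1] Hf e e0; have [d2 d20 H2] := Hf e e0.
exists (Num.min d1 d2) => [|x]; first by rewrite lt_min d10.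
by rewrite lt_min => /andP[x1 x2]; rewrite -H1 //; exact: H2.
Qed.

Lemma asym_drift c n : asym log_drift c n.+1 -> asym drift (theta b * c) n.+1.
Proof.
move=> H.
have [d d0 Hd] := near_interior.
apply: (@asym_near (fun xi => theta (b + xi) * (expR (log_drift xi) - 1))).
  by exists d => // x xd; have [u v] := Hd x xd; rewrite driftE.
rewrite -[b in theta b]addr0; apply: asym_mul (asym_expm1 H) _.
exact: dv_continuous (dv_comp (dv_theta (b + 0)) (dvD (dv_cst 0 b) (dv_id 0))).
Qed.

Lemma drift_typeI : asym drift (theta b * (q%:R ^+ 4 * F4 p q beta s / (6 * q1))) 3.
Proof.
apply: asym_drift.
have A := asym_scale (- q%:R) (F1_asym hp hq hbeta hspecial).
have := asym_mul A (@ct_cst R R (- (q%:R / q1)) 0).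
have -> : - (q%:R / q1) * (F4 p q beta s / 6 * (- q%:R) ^+ 3) =
   q%:R ^+ 4 * F4 p q beta s / (6 * q1) by field; rewrite gt_eqF.
by apply: asym_near; exists 1 => // x _; rewrite log_driftE.
Qed.

(** Type II forces [p = 4], [q = 2], [s = 0], [beta = 2 / 3] and [h = 0], where
    the derivative of [log_drift] is [- 64 * xi ^+ 4 / (1 - 4 * xi ^+ 2)]. *)
Lemma drift_typeII : F4 p q beta s = 0 -> asym drift (theta b * (- (64 / 5))) 5.
Proof.
move=> F40; apply: asym_drift.
have s0 := typeII_centre hp hq hbeta hspecial F40.
have p4 := special_typeII_centre hp hq hbeta hspecial s0 F40.
have [q1E [aE bE]] := special_centre_half hp hq hbeta hspecial s0.
have := special_centre_kappa hp hq hbeta hspecial s0; rewrite /kappa p4 /= => kE.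
have bet : beta = 2 / 3 by move: kE; lra.
have L0 : log_drift 0 = 0.
  by rewrite log_driftE mulr0 addr0 (F1_eq0 hq hspecial) mulr0.
pose G (x : R) : R := - 64 / (1 - 4 * x ^+ 2).
have -> : - (64 / 5) = G 0 * 1 / 5%:R by rewrite /G expr0n /=; field.
have near_half (x : R) : `|x| < 1/2 -> [/\ 0 < 1/2 - x, 0 < 1/2 + x & 0 < 1 - 4 * x ^+ 2].
  by rewrite ltr_norml => /andP[x1 x2]; split; [lra|lra|nra].
apply: (@asym_primitive R _ (fun x => G x * x ^+ 4)) => //; last first.
  apply: asym_mul => [e e0|].
    by exists 1 => // x _; rewrite mul1r subrr normr0 mulr_ge0 ?exprn_ge0 // ltW.
  have n0 : (1 - 4 * (0 : R) ^+ 2) != 0 by rewrite expr0n /= mulr0 subr0 oner_eq0.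
  have V := @dv_comp R (fun y => y^-1) (fun x => 1 - 4 * x ^+ 2) 0 _ _ (dv_inv n0)
    (dvB (dv_cst 0 1) (dvZ 4 (dvX 2 0))).
  exact: dv_continuous (dvZ (- 64) V).
exists (1/2) => [|x xh]; first by rewrite divr_gt0.
have [u0 v0 w0] := near_half x xh.
have U : is_derive x (1 : R) (fun y => a - q1 * y) (- 1).
  by apply: dv_eq (dvB (dv_cst x a) (dvZ q1 (dv_id x))) _; rewrite q1E; ring.
have V : is_derive x (1 : R) (fun y => b + y) 1.
  by apply: dv_eq (dvD (dv_cst x b) (dv_id x)) _; rewrite add0r.
have uE : a - q1 * x = 1 / 2%:R - x by rewrite aE q1E; ring.
have vE : b + x = 1 / 2%:R + x by rewrite bE.
have lnU := dv_comp (f := @ln R) (g := fun y => a - q1 * y) (x := x) (dv_ln (x := a - q1 * x) _) U.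
have lnV := dv_comp (f := @ln R) (g := fun y => b + y) (x := x) (dv_ln (x := b + x) _) V.
have pU := dv_comp (f := fun y => y ^+ p.-1) (g := fun y => a - q1 * y) (dvX p.-1 _) U.
have pV := dv_comp (f := fun y => y ^+ p.-1) (g := fun y => b + y) (dvX p.-1 _) V.
apply: dv_eq (dvB (dvB (dvD (dvB (lnU _) (lnV _)) (dvZ beta (dvZ p%:R pV)))
  (dvZ beta (dvZ p%:R pU))) (dv_cst x h)) _; rewrite ?uE ?vE //.
rewrite bet p4 /= /G; field.
by rewrite !gt_eqF //; lra.
Qed.

End drift.

(** * Vanishing errors *)

Section small.
Context {R : realType}.
Variables (T : nat -> finType) (P : forall N, T N -> R).
Hypothesis hP : forall N, is_dist (@P N).
Implicit Types f g : forall N, T N -> R.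

(** Convergence to 0 in mean. *)
Definition small f := fexp (@P N) (fun X => `|f N X|) @[N --> \oo] --> (0 : R).

Lemma small_of_bound f (u : nat -> R) : u N @[N --> \oo] --> (0 : R) ->
  (\forall N \near \oo, fexp (@P N) (fun X => `|f N X|) <= u N) -> small f.
Proof.
move=> u0 fu; apply: squeeze_cvgr (@cvg_cst R^o _ _ _ _) u0; near=> N.
apply/andP; split; last by near: N.
by apply: fexp_ge0 => // X; exact: normr_ge0.
Unshelve. all: by end_near. Qed.

Lemma small_le f g : small g ->
  (\forall N \near \oo, forall X, `|f N X| <= `|g N X|) -> small f.
Proof.
move=> g0 fg; apply: small_of_bound g0 _; near=> N; apply: le_fexp => // X.
by have : forall X, `|f N X| <= `|g N X| by near: N; exact: fg.
Unshelve. all: by end_near. Qed.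

Lemma smallD f g : small f -> small g -> small (fun N X => f N X + g N X).
Proof.
move=> f0 g0; have fg0 : (fexp (@P N) (fun X => `|f N X|) + fexp (@P N) (fun X => `|g N X|))
    @[N --> \oo] --> (0 : R) by rewrite -[X in _ --> X]addr0; exact: cvgD.
apply: small_of_bound fg0 _; near=> N; rewrite /= -fexpD.
by apply: le_fexp => // X; exact: ler_normD.
Unshelve. all: by end_near. Qed.

Lemma small_bounded f g C : small f ->
  (\forall N \near \oo, forall X, `|g N X| <= C) -> small (fun N X => g N X * f N X).
Proof.
move=> f0 gC; have Cf0 : (C * fexp (@P N) (fun X => `|f N X|)) @[N --> \oo] --> (0 : R).
  by rewrite -[X in _ --> X](mulr0 C); apply: cvgMr.
apply: small_of_bound Cf0 _; near=> N; rewrite /= -fexpZ; apply: le_fexp => // X.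
rewrite normrM ler_wpM2r //.
by have : forall X, `|g N X| <= C by near: N; exact: gC.
Unshelve. all: by end_near. Qed.

Lemma smallZ f C : small f -> small (fun N X => C * f N X).
Proof. by move=> f0; apply: (@small_bounded f (fun _ _ => C) `|C|) => //; near=> N. Unshelve. all: by end_near. Qed.

Lemma smallN f : small f -> small (fun N X => - f N X).
Proof. by move=> f0; apply: small_le f0 _; near=> N => X; rewrite normrN. Unshelve. all: by end_near. Qed.

Lemma smallB f g : small f -> small g -> small (fun N X => f N X - g N X).
Proof. by move=> f0 g0; apply: smallD => //; exact: smallN. Qed.

Lemma small_seq (u : nat -> R) : u N @[N --> \oo] --> (0 : R) -> small (fun N _ => u N).
Proof.
move=> u0; have nu0 : `|u N| @[N --> \oo] --> (0 : R).
  by rewrite -[X in _ --> X](@normr0 R R); apply: cvg_norm.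
by apply: small_of_bound nu0 _; near=> N; rewrite fexp_cst.
Unshelve. all: by end_near. Qed.

Lemma small0 : small (fun _ _ => 0).
Proof. by apply: small_seq; exact: cvg_cst. Qed.

Lemma small_sum (I : finType) (A : pred I) (f : I -> forall N, T N -> R) :
  (forall i, A i -> small (f i)) -> small (fun N X => \sum_(i | A i) f i N X).
Proof.
move=> Hf; have H0 := small0.
suff H s : small (fun N X => \sum_(i <- s | A i) f i N X) by exact: H.
elim: s => [|i s IH].
  by apply: small_le H0 _; near=> N => X; rewrite big_nil.
have [Ai|nAi] := boolP (A i).
  by apply: small_le (smallD (Hf i Ai) IH) _; near=> N => X; rewrite big_cons Ai.
by apply: small_le IH _; near=> N => X; rewrite big_cons (negbTE nAi).
Unshelve. all: by end_near. Qed.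

Lemma small_eps f : (forall e, 0 < e -> exists2 g : forall N, T N -> R, small g &
    \forall N \near \oo, forall X, `|f N X| <= e + `|g N X|) -> small f.
Proof.
move=> H; apply/cvgrPdist_le => e e0; have e20 : 0 < e / 2 by rewrite divr_gt0.
have [g g0 fg] := H _ e20; move/cvgrPdist_le: g0 => /(_ _ e20) g0.
near=> N; rewrite sub0r normrN ger0_norm; last by apply: fexp_ge0.
have h1 : forall X, `|f N X| <= e / 2 + `|g N X| by near: N; exact: fg.
have h2 : `|0 - fexp (@P N) (fun X => `|g N X|)| <= e / 2 by near: N; exact: g0.
apply: le_trans (le_fexp (hP N) h1) _; rewrite (fexpD _ (fun=> e / 2)) fexp_cst //.
move: h2; rewrite sub0r normrN ler_norml => /andP[_ h2].
by rewrite [leRHS]splitr lerD2l.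
Unshelve. all: by end_near. Qed.

Lemma small_cvg f : small f -> fexp (@P N) (f N) @[N --> \oo] --> (0 : R).
Proof.
move=> f0; apply/cvgrPdist_le => e e0; move/cvgrPdist_le: f0 => /(_ _ e0) f0.
near=> N; rewrite sub0r normrN; apply: le_trans (fexp_norm (hP N) _) _.
have : `|0 - fexp (@P N) (fun X => `|f N X|)| <= e by near: N; exact: f0.
by rewrite sub0r normrN; apply: le_trans; exact: ler_norm.
Unshelve. all: by end_near. Qed.

End small.

(** * Elementary bounds *)

Section elementary.
Context {R : realType}.
Implicit Types (z e x : R).

Lemma expr_increment n z e : `|z| <= 1 -> `|z + e| <= 2 ->
  `|(z + e) ^+ n - z ^+ n| <= 2 ^+ n * `|e|.
Proof.
move=> z1 ze; suff : `|(z + e) ^+ n - z ^+ n| <= (2 ^+ n - 1) * `|e|.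
  by move=> H; apply: le_trans H _; rewrite ler_wpM2r // lerBlDr lerDl.
elim: n => [|n IH]; first by rewrite !expr0 !subrr normr0 mul0r.
have -> : (z + e) ^+ n.+1 - z ^+ n.+1 = (z + e) * ((z + e) ^+ n - z ^+ n) + e * z ^+ n.
  by rewrite !exprS; ring.
apply: le_trans (ler_normD _ _) _; rewrite !normrM normrX.
have h1 : `|z + e| * `|(z + e) ^+ n - z ^+ n| <= 2 * ((2 ^+ n - 1) * `|e|) by apply: ler_pM.
have h2 : `|e| * `|z| ^+ n <= `|e| by rewrite ler_piMr // exprn_ile1.
apply: le_trans (lerD h1 h2) _; rewrite [2 ^+ n.+1]exprS; lra.
Qed.

Lemma expr_increment2 n z e : `|z| <= 1 -> `|z + e| <= 2 ->
  `|(z + e) ^+ n - z ^+ n - e * (n%:R * z ^+ n.-1)| <= 2 ^+ n * e ^+ 2.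
Proof.
move=> z1 ze; suff : `|(z + e) ^+ n - z ^+ n - e * (n%:R * z ^+ n.-1)| <= (2 ^+ n - 1) * e ^+ 2.
  by move=> H; apply: le_trans H _; rewrite ler_wpM2r ?sqr_ge0 // lerBlDr lerDl.
elim: n => [|n IH]; first by rewrite !expr0 !subrr !mul0r mulr0 subrr normr0.
have -> : (z + e) ^+ n.+1 - z ^+ n.+1 - e * (n.+1%:R * z ^+ n) =
   z * ((z + e) ^+ n - z ^+ n - e * (n%:R * z ^+ n.-1)) + e * ((z + e) ^+ n - z ^+ n).
  by rewrite -natr1; case: n {IH} => [|n]; rewrite ?expr0 ?expr1 /= ?exprS; ring.
apply: le_trans (ler_normD _ _) _; rewrite !normrM.
have h1 : `|z| * `|(z + e) ^+ n - z ^+ n - e * (n%:R * z ^+ n.-1)| <= (2 ^+ n - 1) * e ^+ 2.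
  by rewrite -[leRHS]mul1r; apply: ler_pM.
have h2 : `|e| * `|(z + e) ^+ n - z ^+ n| <= 2 ^+ n * e ^+ 2.
  rewrite -[e ^+ 2]ger0_norm ?sqr_ge0 // normrX mulrC expr2 mulrA ler_wpM2r //.
  exact: expr_increment.
apply: le_trans (lerD h1 h2) _; rewrite [2 ^+ n.+1]exprS; lra.
Qed.

Lemma expr_lipschitz n x y : 0 <= x <= 1 -> 0 <= y <= 1 ->
  `|x ^+ n - y ^+ n| <= n%:R * `|x - y|.
Proof.
move=> /andP[x0 x1] /andP[y0 y1]; elim: n => [|n IH].
  by rewrite !expr0 subrr normr0 mul0r.
have -> : x ^+ n.+1 - y ^+ n.+1 = x * (x ^+ n - y ^+ n) + (x - y) * y ^+ n.
  by rewrite !exprS; ring.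
apply: le_trans (ler_normD _ _) _; rewrite !normrM -natr1 mulrDl mul1r.
apply: lerD; first by rewrite -[leRHS]mul1r; apply: ler_pM => //; rewrite ger0_norm.
by rewrite ler_piMr // normrX exprn_ile1 // ger0_norm.
Qed.

Lemma expR_sub1_bound x : `|x| <= 1 / 2 -> `|expR x - 1| <= 2 * `|x|.
Proof.
move=> x1; have U := expR_le_quadratic x1; have L := expR_ge1Dx x.
have x2 : x ^+ 2 <= `|x| / 2.
  rewrite -[x ^+ 2]ger0_norm ?sqr_ge0 // normrX expr2 ler_wpM2l //.
  by rewrite -[_^-1]mul1r.
have := ler_norm x; have := ler_norm (- x); rewrite normrN => n1 n2.
have n0 := normr_ge0 x.
by rewrite ler_norml; apply/andP; split; lra.
Qed.

Lemma expR_sub1_bound2 x : `|x| <= 1 / 2 -> `|expR x - 1 - x| <= 2 * x ^+ 2.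
Proof.
move=> x1; have U := expR_le_quadratic x1; have L := expR_ge1Dx x.
have x2 := sqr_ge0 x.
by rewrite ler_norml; apply/andP; split; lra.
Qed.

(** [expR (N * g)] is the [q.+1]-th power of a function of linear growth. *)
Lemma exponential_beats_power (q : nat) (g : R) : 0 < g -> exists2 C, 0 < C &
  forall N : nat, (0 < N)%N -> (N.+1 ^ q)%:R * expR (- (N%:R * g)) <= C / N%:R.
Proof.
move=> g0; pose c := Num.min 1 (g / q.+1%:R).
have c0 : 0 < c by rewrite lt_min ltr01 divr_gt0.
exists (c ^+ q.+1)^-1 => [|N N0]; first by rewrite invr_gt0 exprn_gt0.
have Nr : 0 < N%:R :> R by rewrite ltr0n.
have h1 : (c * N.+1%:R) ^+ q.+1 <= expR (N%:R * g).
  have -> : expR (N%:R * g) = expR (N%:R * (g / q.+1%:R)) ^+ q.+1.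
    by rewrite -expRM_natl; congr expR; field.
  rewrite lerXn2r ?nnegrE ?expR_ge0 ?mulr_ge0 // ?(ltW c0) //.
  apply: le_trans (expR_ge1Dx _); rewrite -natr1 mulrDr mulr1 addrC.
  have : c <= 1 by rewrite ge_min lexx.
  have : c * N%:R <= N%:R * (g / q.+1%:R) by rewrite mulrC ler_wpM2l // ge_min lexx orbT.
  by move=> ? ?; apply: lerD.
rewrite expRN ler_pdivlMr // mulrAC ler_pdivrMr ?expR_gt0 // -ler_pdivrMl ?invr_gt0 ?exprn_gt0 //.
rewrite invrK; apply: le_trans h1; rewrite exprMn ler_wpM2l ?exprn_ge0 ?(ltW c0) //.
by rewrite -natrM -natrX ler_nat expnSr leq_mul2l leqnSn orbT.
Qed.

End elementary.

Section uniform.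
Context {R : realType}.

Lemma compact_support_uniform (f : R -> R) M : continuous f -> vanishes_beyond M f ->
  forall e, 0 < e -> exists2 d, 0 < d & forall x y, `|x - y| < d -> `|f x - f y| <= e.
Proof.
move=> cf fM e e0; pose K : R := `|M| + 1.
have /compact_near_coveringP ncK := @segment_compact R (- K) K.
have H : \forall d \near nbhs (0 : R), `[- K, K]%classic `<=` [set x | `|f (x + d) - f x| <= e].
  apply: ncK => x _.
  have e20 : 0 < e / 2 by rewrite divr_gt0.
  have : (fun u : R * R => f (u.1 + u.2) - f u.1) u @[u --> (x, 0 : R)] --> f (x + 0) - f x.
    apply: cvgB; first exact: cvg_comp (cvgD cvg_fst cvg_snd) (cf _).
    by apply: (@cvg_comp _ _ _ (@fst R R) f _ (nbhs x)); [exact: cvg_fst | exact: cf].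
  rewrite addr0 subrr => /cvgrPdist_le/(_ _ e0).
  by apply: filterS => -[u v] /=; rewrite sub0r normrN.
have [d /= d0 Hd] := H.
exists (Num.min d 1) => [|x y]; first by rewrite lt_min d0 ltr01.
rewrite lt_min => /andP[xyd xy1].
have [yK|yK] := leP `|y| K.
  have := Hd (x - y); rewrite /ball_ /= sub0r normrN => /(_ xyd y).
  by rewrite /= (addrC y) subrK; apply; rewrite in_itv /= -ler_norml.
rewrite !fM ?subrr ?normr0 ?(ltW e0) //.
  by apply: le_trans (ltW yK); rewrite (le_trans (ler_norm M)) // lerDl.
have : `|y| <= `|x| + `|x - y| by rewrite -{1}(subrK x y) addrC (le_trans (ler_normD _ _)) // (distrC y).
have := ler_norm M; move: yK; rewrite /K; lra.
Qed.

End uniform.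

(** * The exchange identity in terms of [theta] *)

Section theta_bounds.
Context {R : realType}.
Variables (p : nat) (beta : R).
Hypotheses (hp : (2 <= p)%N) (hbeta : 0 < beta).
Local Notation th := (theta p beta).
Local Notation kap := (kappa p beta).

Definition dtheta (t : R) : R :=
  (1 - kap * t ^+ p.-1) * expR (- (beta * (p%:R * t ^+ p.-1))).

Lemma unit_expr (t : R) n : 0 <= t <= 1 -> 0 <= t ^+ n <= 1.
Proof. by move=> /andP[t0 t1]; rewrite exprn_ge0 // exprn_ile1. Qed.

Lemma expRN_unit (t : R) : 0 <= t <= 1 -> 0 < expR (- (beta * (p%:R * t ^+ p.-1))) <= 1.
Proof.
move=> /(unit_expr p.-1)/andP[t0 _]; rewrite expR_gt0 /= -[leRHS]expR0 ler_expR.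
by rewrite oppr_le0 !mulr_ge0 // ltW.
Qed.

Lemma theta_unit (t : R) : 0 <= t <= 1 -> 0 <= th t <= 1.
Proof.
move=> tu; have /andP[e0 e1] := expRN_unit tu; have /andP[t0 t1] := tu.
by rewrite /theta mulr_ge0 ?(ltW e0) //= -[leRHS]mul1r ler_pM // ltW.
Qed.

Lemma between_unit (u v w : R) : 0 <= u <= 1 -> 0 <= v <= 1 ->
  Num.min u v <= w <= Num.max u v -> 0 <= w <= 1 /\ `|w - u| <= `|v - u|.
Proof.
move=> /andP[u0 u1] /andP[v0 v1]; have [uv|vu] := leP u v => /andP[w1 w2]; split.
- by apply/andP; split; lra.
- by rewrite !ger0_norm ?subr_ge0 // lerD2r.
- by apply/andP; split; lra.
- by rewrite !ler0_norm ?subr_le0 ?(ltW vu) // lerN2 lerD2r.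
Qed.

Lemma theta_lipschitz (u v : R) : 0 <= u <= 1 -> 0 <= v <= 1 ->
  `|th u - th v| <= (1 + kap) * `|u - v|.
Proof.
move=> u1 v1.
have [w wuv ->] := @dv_MVT R th dtheta v u (fun x _ => dv_theta beta hp x).
have [wu _] := between_unit v1 u1 wuv.
rewrite normrM ler_wpM2r // /dtheta; have /andP[e0 e1] := expRN_unit wu.
have k0 := kappa_gt0 hp hbeta; have /andP[x0 x1] := unit_expr p.-1 wu.
rewrite normrM (gtr0_norm e0) -[leRHS]mulr1; apply: ler_pM => //; rewrite ?(ltW e0) //.
have : kap * w ^+ p.-1 <= kap by rewrite ler_piMr // ltW.
have : 0 <= kap * w ^+ p.-1 by rewrite mulr_ge0 // ltW.
by move=> ? ?; rewrite ler_norml; apply/andP; split; lra.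
Qed.

Lemma dv_dtheta (t : R) : is_derive t (1 : R) dtheta
  ((- (kap * (p.-1%:R * t ^+ p.-2)) - (1 - kap * t ^+ p.-1) * (kap * t ^+ p.-2)) *
     expR (- (beta * (p%:R * t ^+ p.-1)))).
Proof.
apply: dv_eq (dvM (dvB (dv_cst t 1) (dvZ kap (dvX p.-1 t)))
  (dv_exp (dvN (dvZ beta (dvZ p%:R (dvX p.-1 t)))))) _.
by rewrite /kappa; ring.
Qed.

Lemma theta_taylor : exists2 L, 0 < L & forall u v : R, 0 <= u <= 1 -> 0 <= v <= 1 ->
  `|th u - th v - dtheta v * (u - v)| <= L * (u - v) ^+ 2.
Proof.
have k0 := kappa_gt0 hp hbeta.
pose L := kap * p.-1%:R + (1 + kap) * kap.
exists L => [|u v u1 v1].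
  apply: ltr_wpDl; first by rewrite mulr_ge0 // ltW.
  by rewrite mulr_gt0 // addr_gt0.
have [w wvu ->] := @dv_MVT R th dtheta v u (fun x _ => dv_theta beta hp x).
have [wu wle] := between_unit v1 u1 wvu.
rewrite -mulrBl normrM.
have [y ywv E] := @dv_MVT R dtheta _ v w (fun x _ => dv_dtheta x).
have [yu _] := between_unit v1 wu ywv.
rewrite E normrM -[X in _ <= _ * X]ger0_norm ?sqr_ge0 // normrX expr2 [leRHS]mulrA.
rewrite ler_wpM2r //; apply: ler_pM => //.
have /andP[e0 e1] := expRN_unit yu.
have /andP[x0 x1] := unit_expr p.-1 yu; have /andP[z0 z1] := unit_expr p.-2 yu.
rewrite normrM (gtr0_norm e0) -[leRHS]mulr1; apply: ler_pM => //; rewrite ?(ltW e0) //.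
apply: le_trans (ler_normB _ _) _; rewrite normrN; apply: lerD.
  by rewrite normrM (gtr0_norm k0) ler_pM2l // ger0_norm ?mulr_ge0 // ler_piMr.
rewrite normrM; apply: ler_pM => //.
  have : kap * y ^+ p.-1 <= kap by rewrite ler_piMr // ltW.
  have : 0 <= kap * y ^+ p.-1 by rewrite mulr_ge0 // ltW.
  by move=> ? ?; rewrite ler_norml; apply/andP; split; lra.
by rewrite normrM (gtr0_norm k0) ger0_norm // ler_piMr // ltW.
Qed.

Lemma theta_local_monotone (b : R) : kap * b ^+ p.-1 < 1 ->
  exists c d : R, [/\ 0 < c, 0 < d & forall u v : R, `|u - b| <= d -> `|v - b| <= d ->
    c * (u - v) ^+ 2 <= (th u - th v) * (u - v)].
Proof.
move=> kb; have Db : 0 < dtheta b by rewrite mulr_gt0 ?expR_gt0 // subr_gt0.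
have D2 : 0 < dtheta b / 2 by rewrite divr_gt0.
have /cvgrPdist_lt/(_ _ D2) [d /= d0 Hd] := dv_continuous (dv_dtheta b).
exists (dtheta b / 2), (d / 2); split; rewrite ?divr_gt0 // => u v ub vb.
have [w wvu ->] := @dv_MVT R th dtheta v u (fun x _ => dv_theta beta hp x).
rewrite -[leRHS]mulrA -expr2 ler_wpM2r ?sqr_ge0 //.
have wb : `|b - w| < d.
  have d2 : d / 2 < d by rewrite ltr_pdivrMr // ltr_pMr // ltr1n.
  apply: le_lt_trans d2; move: ub vb wvu; rewrite !ler_norml => /andP[? ?] /andP[? ?].
  by have [_|_] := leP v u => /andP[? ?]; apply/andP; split; lra.
have := Hd w wb; rewrite ltr_norml => /andP[_]; lra.
Qed.

End theta_bounds.

Section exchange_theta.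
Context {R : realType}.
Variables (p q : nat) (beta h : R).
Hypothesis hbeta : 0 < beta.
Implicit Types (B : R) (N : nat) (k l : 'I_q) (z : 'rV[R]_q).

(** The energy released by recolouring one site, beyond its mean field value at the
    reference inverse temperature. *)
Definition excess B N k l z : R :=
  N%:R * (energy p h B (jump N k l z) - energy p h B z)
  - h * ((l == 0 :> nat)%:R - (k == 0 :> nat)%:R)
  - beta * (p%:R * (z 0 l + N%:R^-1) ^+ p.-1) + beta * (p%:R * z 0 k ^+ p.-1).

(** The exchange identity for [psi z = expR (- (beta * (p%:R * z 0 l ^+ p.-1))) * phi z]: the
    exponential makes the two sides functions of one colour each, up to [excess]. *)
Lemma exchange_theta B N k l (phi : 'rV[R]_q -> R) : (0 < N)%N -> k != l ->
  fexp (@potts R p q B h N) (fun X => expR (h * ((l == 0 :> nat)%:R - (k == 0 :> nat)%:R))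
     * theta p beta (freq X 0 k) * expR (excess B N k l (freq X)) * phi (jump N k l (freq X)))
  = fexp (@potts R p q B h N) (fun X => theta p beta (freq X 0 l) * phi (freq X)).
Proof.
move=> N0 kl.
pose psi z := expR (- (beta * (p%:R * z 0 l ^+ p.-1))) * phi z.
have := exchange_identity p h B k l psi N0; rewrite /potts_expectation /fexp => E.
rewrite [RHS](_ : _ = \sum_(X : config q N) potts p B h X * (freq X 0 l * psi (freq X))).
  rewrite -E; apply: eq_bigr => X _; congr (_ * _).
  rewrite /psi /theta /excess; set z := freq X.
  have -> : (jump N k l z) 0 l = z 0 l + N%:R^-1.
    by rewrite mxE eqxx (negbTE (_ : l != k)) 1?eq_sym // subr0 mul1r.
  rewrite !mulrA; congr (_ * _).
  rewrite (mulrC (expR (h * _)) (z 0 k)) -!(mulrA (z 0 k)) -!expRD.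
  by congr (_ * expR _); ring.
by apply: eq_bigr => X _; rewrite /theta /psi !mulrA.
Qed.

Definition excess_const : R := 2 * (beta + 1) * 2 ^+ p + beta * (p%:R * 2 ^+ p.-1).

Lemma energy_jump B N k l z : k != l ->
  energy p h B (jump N k l z) - energy p h B z =
  B * ((z 0 l + N%:R^-1) ^+ p - z 0 l ^+ p) + B * ((z 0 k - N%:R^-1) ^+ p - z 0 k ^+ p)
  + h / N%:R * ((l == 0 :> nat)%:R - (k == 0 :> nat)%:R).
Proof.
move=> kl; rewrite !energyE -sumrB (bigD1 l) //= (bigD1 k) //= big1 => [|r /andP[rl rk]].
  rewrite !mxE !eqxx (negbTE kl) eq_sym (negbTE kl) subr0 sub0r mulN1r mul1r; ring.
by rewrite !mxE (negbTE rl) (negbTE rk) subr0 mul0r addr0 subrr.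
Qed.

(** The mean field terms cancel at [B = beta], leaving second order Taylor remainders. *)
Lemma excess_bound B N k l z : (0 < N)%N -> k != l -> `|B| <= beta + 1 ->
  0 <= z 0 l <= 1 -> 0 <= z 0 k <= 1 ->
  `|excess B N k l z - (B - beta) * (p%:R * (z 0 l ^+ p.-1 - z 0 k ^+ p.-1))|
  <= excess_const / N%:R.
Proof.
move=> N0 kl Bb zl zk; set e : R := N%:R^-1.
have Nr : 0 < N%:R :> R by rewrite ltr0n.
have e0 : 0 <= e by rewrite invr_ge0 ltW.
have e1 : e <= 1 by rewrite invf_le1 // ler1n.
have Ne : N%:R * e = 1 by rewrite divff // gt_eqF.
have nl : `|z 0 l| <= 1 by rewrite ger0_norm; case/andP: zl.
have nk : `|z 0 k| <= 1 by rewrite ger0_norm; case/andP: zk.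
have le2 : `|z 0 l + e| <= 2.
  by rewrite (le_trans (ler_normD _ _)) // -[leRHS]/(1 + 1) lerD // ger0_norm.
have ke2 : `|z 0 k + - e| <= 2.
  by rewrite (le_trans (ler_normD _ _)) // -[leRHS]/(1 + 1) lerD // normrN ger0_norm.
set R1 := (z 0 l + e) ^+ p - z 0 l ^+ p - e * (p%:R * z 0 l ^+ p.-1).
set R2 := (z 0 k + - e) ^+ p - z 0 k ^+ p - - e * (p%:R * z 0 k ^+ p.-1).
set R3 := (z 0 l + e) ^+ p.-1 - z 0 l ^+ p.-1.
have H1 : `|R1| <= 2 ^+ p * e ^+ 2 by exact: expr_increment2.
have H2 : `|R2| <= 2 ^+ p * e ^+ 2 by rewrite -(sqrrN e); exact: expr_increment2.
have H3 : `|R3| <= 2 ^+ p.-1 * e by rewrite -[X in _ * X]ger0_norm //; exact: expr_increment.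
have -> : excess B N k l z - (B - beta) * (p%:R * (z 0 l ^+ p.-1 - z 0 k ^+ p.-1)) =
    B * (N%:R * R1 + N%:R * R2) - beta * (p%:R * R3).
  rewrite /excess energy_jump // -/e /R1 /R2 /R3; set D : R := _%:R - _%:R.
  have -> : h / N%:R * D = e * (h * D) by rewrite /e; ring.
  have := congr1 (fun u => u * (h * D + B * (p%:R * (z 0 l ^+ p.-1 - z 0 k ^+ p.-1)))) Ne.
  rewrite mul1r => X; apply/eqP; rewrite -subr_eq0; apply/eqP; rewrite -[RHS](subrr (N%:R * e *
    (h * D + B * (p%:R * (z 0 l ^+ p.-1 - z 0 k ^+ p.-1))))) [in X in _ = _ - X]X; ring.
apply: le_trans (ler_normB _ _) _; rewrite /excess_const mulrDl; apply: lerD.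
  rewrite normrM; have -> : 2 * (beta + 1) * 2 ^+ p / N%:R = (beta + 1) * (2 * (2 ^+ p * e)).
    by rewrite /e; ring.
  apply: ler_pM => //; apply: le_trans (ler_normD _ _) _.
  rewrite !normrM (gtr0_norm Nr) mulrDl mul1r.
  have HH r : `|r| <= 2 ^+ p * e ^+ 2 -> N%:R * `|r| <= 2 ^+ p * e.
    move=> Hr; have -> : 2 ^+ p * e = N%:R * (2 ^+ p * e ^+ 2).
      by rewrite expr2 mulrCA (mulrA N%:R) Ne mul1r.
    by rewrite ler_pM2l.
  by apply: lerD; apply: HH.
by rewrite !normrM (gtr0_norm hbeta) normr_nat -mulrA ler_pM2l // -mulrA ler_wpM2l.
Qed.

End exchange_theta.

(** * The critical window *)

Section scale.
Context {R : realType}.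
Variables (d : nat) (t : R).
Hypothesis d4 : (4 <= d)%N.

(** The parameter [beta + tau N] moves with the scale of the fluctuations: the force
    [N * tau] acting on a displacement of size [1 / scale] is of order 1 when
    [N = scale ^+ d]. *)
Definition scale (N : nat) : R := N%:R `^ d%:R^-1.
Definition tau (N : nat) : R := t / scale N ^+ d.-1.

Let dpos : (0 < d)%N. Proof. by apply: leq_trans d4. Qed.

Lemma scale_exp N : scale N ^+ d = N%:R.
Proof.
rewrite /scale -powR_mulrn ?powR_ge0 // -powRrM mulVf ?powRr1 //.
by rewrite pnatr_eq0 -lt0n.
Qed.

Lemma scale_gt0 N : (0 < N)%N -> 0 < scale N.
Proof. by move=> N0; rewrite powR_gt0 // ltr0n. Qed.

Lemma scale_ge1 N : (0 < N)%N -> 1 <= scale N.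
Proof.
move=> N0; have S0 := ltW (scale_gt0 N0).
rewrite -(@ler_pXn2r _ d) ?nnegrE //.
by rewrite expr1n scale_exp ler1n.
Qed.

Lemma near_ge (N0 : nat) : \forall N \near \oo, (N0 <= N)%N.
Proof. exact: nbhs_infty_ge. Qed.

Lemma inv_scale_cvg0 : (scale N)^-1 @[N --> \oo] --> (0 : R).
Proof.
apply/cvgrPdist_le => e e0; pose n := Num.truncn (e^-1 ^+ d).
near=> N; have N0 : (0 < N)%N by near: N; exact: near_ge.
rewrite sub0r normrN ger0_norm ?invr_ge0 ?powR_ge0 //.
rewrite -[leRHS]invrK lef_pV2 ?posrE ?invr_gt0 ?scale_gt0 //.
rewrite -(@ler_pXn2r _ d) ?nnegrE ?powR_ge0 ?invr_ge0 ?(ltW e0) // scale_exp.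
have : (n.+1 <= N)%N by near: N; exact: near_ge.
rewrite -(ler_nat R); apply: le_trans.
by rewrite ltW // truncnS_gt.
Unshelve. all: by end_near. Qed.

Lemma inv_scaleX_cvg0 n : (0 < n)%N -> (scale N)^-1 ^+ n @[N --> \oo] --> (0 : R).
Proof.
case: n => // n _; elim: n => [|n IH]; first exact: inv_scale_cvg0.
by rewrite -[X in _ --> X](mulr0 0); apply: cvgM IH; exact: inv_scale_cvg0.
Qed.

Lemma tau_cvg0 : tau N @[N --> \oo] --> (0 : R).
Proof.
have d1 : (0 < d.-1)%N by case: (d) d4 => [|[]].
have H : (t * (scale N)^-1 ^+ d.-1) @[N --> \oo] --> (0 : R).
  by rewrite -[X in _ --> X](mulr0 t); apply: cvgMr; exact: inv_scaleX_cvg0.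
by apply: cvg_trans H; apply: near_eq_cvg; near=> N; rewrite /tau exprVn.
Unshelve. all: by end_near. Qed.

Lemma inv_nat_cvg0 (C : R) : (C / N%:R) @[N --> \oo] --> (0 : R).
Proof.
have H : (C * (scale N)^-1 ^+ d) @[N --> \oo] --> (0 : R).
  by rewrite -[X in _ --> X](mulr0 C); apply: cvgMr; exact: inv_scaleX_cvg0.
by apply: cvg_trans H; apply: near_eq_cvg; near=> N; rewrite exprVn scale_exp.
Unshelve. all: by end_near. Qed.

Lemma near_small (u : nat -> R) e : 0 < e -> u N @[N --> \oo] --> (0 : R) ->
  \forall N \near \oo, `|u N| <= e.
Proof.
move=> e0 /cvgrPdist_le/(_ _ e0); apply: filterS => N.
by rewrite sub0r normrN.
Qed.

Lemma scale_mul_inv N : (0 < N)%N -> scale N ^+ d.-1 / N%:R = (scale N)^-1.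
Proof.
move=> N0; rewrite -(scale_exp N) -[in X in _ / X](prednK dpos) exprS.
by field; rewrite ?expf_neq0 gt_eqF // scale_gt0.
Qed.

Lemma scale_tau N : (0 < N)%N -> scale N ^+ d.-1 * tau N = t.
Proof. by move=> N0; rewrite /tau mulrC divfK // expf_neq0 // gt_eqF // scale_gt0. Qed.

End scale.

Lemma unit_dist (R : realType) (x y : R) : 0 <= x <= 1 -> 0 <= y <= 1 -> `|x - y| <= 1.
Proof. by move=> /andP[? ?] /andP[? ?]; rewrite ler_norml; apply/andP; split; lra. Qed.

(** The case [x = excess], [W] the difference of two proportions, [k] a value of [theta]:
    the quadratic term is half of what monotonicity of [theta] provides, so it can be
    absorbed. *)
Lemma equalization_step (R : realType) (c T D k W x e : R) :
  0 <= k <= 1 -> `|W| <= 1 -> `|x| <= 1 / 2 -> `|x| <= T * `|W| + D -> 0 <= D ->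
  T <= c / 4 -> 0 <= T -> 0 <= e ->
  k * ((expR x - 1) * W + expR x * (2 * e)) <= c / 2 * W ^+ 2 + 2 * D + 4 * e.
Proof.
move=> /andP[k0 k1] W1 x2 xW D0 Tc T0 e0.
have s1 : `|expR x - 1| <= 2 * `|x| by exact: expR_sub1_bound.
have s2 : (expR x - 1) * W <= c / 2 * W ^+ 2 + 2 * D.
  apply: le_trans (ler_norm _) _; rewrite normrM.
  apply: (@le_trans _ _ (2 * (T * `|W| + D) * `|W|)).
    by rewrite ler_wpM2r // (le_trans s1) // ler_wpM2l.
  have h2 : T * `|W| ^+ 2 <= c / 4 * `|W| ^+ 2 by rewrite ler_wpM2r // exprn_ge0.
  have h3 : D * `|W| <= D by rewrite ler_piMr.
  by rewrite -[W ^+ 2]ger0_norm ?sqr_ge0 // normrX; lra.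
have s3 : expR x <= 2 by move: s1; rewrite ler_norml => /andP[_]; lra.
have u1 : expR x * (2 * e) <= 2 * (2 * e) by rewrite ler_wpM2r // mulr_ge0.
have pw : 0 <= c / 2 * W ^+ 2 + 2 * D + 4 * e.
  by have c0 : 0 <= c / 2; [lra | have := mulr_ge0 c0 (sqr_ge0 W); lra].
have [v0|v0] := leP 0 ((expR x - 1) * W + expR x * (2 * e)).
  by apply: (@le_trans _ _ ((expR x - 1) * W + expR x * (2 * e))); [rewrite ler_piMl | lra].
by apply: le_trans pw; rewrite mulr_ge0_le0 // ltW.
Qed.

Lemma jump_to (R : realType) q N (k l : 'I_q) (z : 'rV[R]_q) : k != l ->
  jump N k l z 0 l = z 0 l + N%:R^-1.
Proof. by move=> kl; rewrite mxE eqxx (negbTE (_ : l != k)) 1?eq_sym // subr0 mul1r. Qed.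

Lemma jump_from (R : realType) q N (k l : 'I_q) (z : 'rV[R]_q) : k != l ->
  jump N k l z 0 k = z 0 k - N%:R^-1.
Proof. by move=> kl; rewrite mxE eqxx (negbTE kl) sub0r mulN1r. Qed.

Section window.
Context {R : realType}.
Variables (p q : nat) (beta h s : R) (d : nat) (t : R).
Hypotheses (hp : (2 <= p)%N) (hq : (2 <= q)%N) (hbeta : 0 < beta).
Hypothesis hspecial : special p q beta h s.
Hypothesis d4 : (4 <= d)%N.

Local Notation q1 := (q%:R - 1 : R).
Local Notation a := (vtop q s).
Local Notation b := (vbot q s).
Local Notation th := (theta p beta).
Local Notation m := (xvec q s).

Hypothesis hconvex : (2 < q)%N -> kappa p beta * b ^+ p.-1 < 1.

Definition window (N : nat) : R := beta + tau d t N.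
Definition window_law (N : nat) : config q N -> R := @potts R p q (window N) h N.
Local Notation P := window_law.
Local Notation E N Z := (fexp (@P N) Z).

Lemma window_dist N : is_dist (@P N).
Proof. exact: (potts_dist p h (ltnW hq)). Qed.
Local Notation hP := window_dist.

Let sint := special_interior hq hspecial.
Let pos := interior_pos hq sint.
Let a0 : 0 < a := pos.1.
Let b0 : 0 < b := pos.2.

Lemma near_window e : 0 < e -> \forall N \near \oo, (0 < N)%N /\ `|tau d t N| <= e.
Proof.
move=> e0; near=> N; split; near: N; first exact: near_ge.
by apply: near_small => //; exact: tau_cvg0.
Unshelve. all: by end_near. Qed.

Lemma window_bound : \forall N \near \oo, (0 < N)%N /\ (0 <= window N /\ `|window N| <= beta + 1).
Proof.
have e0 : 0 < Num.min 1 beta by rewrite lt_min ltr01.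
have := near_window e0; apply: filterS => N [N0]; rewrite le_min => /andP[].
rewrite !ler_norml /window => /andP[? ?] /andP[? ?]; split => //; split; first by lra.
by apply/andP; split; lra.
Qed.

Lemma pnormp_unit (z : 'rV[R]_q) : prob_vec z -> 0 <= pnormp p z <= 1.
Proof.
move=> [z0 z1]; apply/andP; split; first by apply: sumr_ge0 => r _; rewrite exprn_ge0.
rewrite -z1; apply: ler_sum => r _; have zr : z 0 r <= 1.
  by rewrite -z1 (bigD1 r) //= lerDl sumr_ge0.
by rewrite -{2}[z 0 r]expr1 ler_wiXn2l // ltnW.
Qed.

Definition bad (e : R) N (X : config q N) : R := (e <= dist2 (freq X) m)%R%:R.

Lemma bad_unit e N (X : config q N) : 0 <= bad e X <= 1.
Proof. by rewrite /bad; case: (e <= _); rewrite ?ler01 ?lexx ?ler0n ?lern1. Qed.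

Lemma bad_rare e : 0 < e -> exists2 C, 0 < C & \forall N \near \oo, E N (bad e (N := N)) <= C / N%:R.
Proof.
move=> e0; have [_ um _] := hspecial; have [g g0 gap] := maximizer_gap e0 um.
have g20 : 0 < g / 2 by rewrite divr_gt0.
have [C C0 HC] := exponential_beats_power q g20; exists C => //.
near=> N.
have [N0 tg] : (0 < N)%N /\ `|tau d t N| <= g / 2 by near: N; exact: near_window.
have [_ [B0 _]] : (0 < N)%N /\ (0 <= window N /\ `|window N| <= beta + 1).
  by near: N; exact: window_bound.
apply: le_trans (HC N N0).
have := @concentration R p q h (ltnW hp) (window N) m (fun z => e <= dist2 z m) (g / 2) N B0 N0 (xvec_prob hq sint).
rewrite /potts_expectation => cc; apply: cc => //.
  by move=> r; rewrite xvecE; case: ifP.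
move=> z pz ez; have := gap z pz ez.
have HE y : Hfun p (window N) h y = Hfun p beta h y + tau d t N * pnormp p y.
  by rewrite /Hfun /window; ring.
rewrite !HE; have /andP[s0 s1] := pnormp_unit pz.
have /andP[r0 r1] := pnormp_unit (xvec_prob hq sint).
move: tg; rewrite ler_norml; set T := tau d t N => /andP[t1 t2] gz.
have : T * (pnormp p z - pnormp p m) <= g / 2.
  have n1 : `|pnormp p z - pnormp p m| <= 1 by apply: unit_dist; apply/andP.
  apply: le_trans (ler_norm _) _; rewrite normrM -[leRHS]mulr1 ler_pM //.
  by rewrite ler_norml t1.
lra.
Unshelve. all: by end_near. Qed.

(** A deviation exceeds [e] only on the event [bad], of vanishing probability. *)
Lemma deviation_small r : small (fun N => @P N) (fun N X => freq X 0 r - m 0 r).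
Proof.
apply: small_eps; first exact: hP.
move=> e e0; have e20 : 0 < e ^+ 2 by rewrite exprn_gt0.
exists (fun N X => @bad (e ^+ 2) N X).
  have [C C0 HC] := bad_rare e20.
  apply: (small_of_bound _ (inv_nat_cvg0 d4 C)); first exact: hP.
  apply: filterS HC => N; apply: le_trans; apply: le_fexp => [|X]; first exact: hP.
  by have /andP[b1 _] := bad_unit (e ^+ 2) X; rewrite ger0_norm.
near=> N => X; have N0 : (0 < N)%N by near: N; exact: near_ge.
have /andP[b1 _] := bad_unit (e ^+ 2) X; rewrite (ger0_norm b1) /bad.
have d2 : (freq X 0 r - m 0 r) ^+ 2 <= dist2 (freq X) m.
  by rewrite /dist2 (bigD1 r) //= lerDl sumr_ge0 // => i _; exact: sqr_ge0.
have [ez|ez] := leP (e ^+ 2) (dist2 _ _).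
  apply: (@le_trans _ _ 1); last by rewrite lerDr ltW.
  have := freq_ge0 (R := R) X r; have := freq_le1 (R := R) X r.
  have := xvec_prob hq sint; move=> [m0 m1].
  have : m 0 r <= 1 by rewrite -m1 (bigD1 r) //= lerDl sumr_ge0.
  by have := m0 r; move=> ? ? ? ?; rewrite ler_norml; apply/andP; split; lra.
rewrite addr0 -(@ler_pXn2r _ 2) ?nnegrE ?(ltW e0) // -normrX ger0_norm ?sqr_ge0 //.
exact: le_trans d2 (ltW ez).
Unshelve. all: by end_near. Qed.

Lemma freq_unit N (X : config q N) r : 0 <= (freq X 0 r : R) <= 1.
Proof. by rewrite freq_ge0 freq_le1. Qed.

Definition excess_c : R := excess_const p beta.

Lemma excess_c_ge0 : 0 <= excess_c.
Proof.
rewrite /excess_c /excess_const addr_ge0 ?mulr_ge0 ?exprn_ge0 ?ler0n ?addr_ge0 // ltW //.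
Qed.

Lemma excess_window : \forall N \near \oo, (0 < N)%N /\ forall k l (X : config q N), k != l ->
  `|excess p beta h (window N) N k l (freq X)
     - tau d t N * (p%:R * (freq X 0 l ^+ p.-1 - freq X 0 k ^+ p.-1))| <= excess_c / N%:R.
Proof.
apply: filterS window_bound => N [N0 [_ B1]]; split => // k l X kl.
have -> : tau d t N = window N - beta by rewrite /window addrC addKr.
by apply: excess_bound => //; exact: freq_unit.
Qed.

(** An exchange between two colours other than the distinguished one tends to equalize
    them, because [theta] is increasing at their common value. When [q = 2] there is no
    such pair. *)
Lemma equalization (k l : 'I_q) : k != 0 :> nat -> l != 0 :> nat ->
  exists2 C, 0 < C & \forall N \near \oo,
    E N (fun X => (freq X 0 l - freq X 0 k) ^+ 2) <= C / N%:R.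
Proof.
move=> k0 l0; have [<-|kl] := eqVneq k l.
  exists 1 => //; near=> N; rewrite [leLHS](_ : _ = 0) ?divr_ge0 //.
  by rewrite /fexp big1 // => X _; rewrite subrr expr0n mulr0.
have q3 : (2 < q)%N.
  move: kl k0 l0 (ltn_ord k) (ltn_ord l); rewrite -val_eqE /= -!lt0n => kl k0 l0 kq lq.
  have [kl'|lk|kE] := ltngtP k l; last by rewrite kE eqxx in kl.
    by apply: leq_ltn_trans lq; apply: leq_ltn_trans kl'.
  by apply: leq_ltn_trans kq; apply: leq_ltn_trans lk.
have [c [e [c0 e0 mono]]] := theta_local_monotone hp (hconvex q3).
have e20 : 0 < e ^+ 2 by rewrite exprn_gt0.
have [Cb Cb0 badN] := bad_rare e20.
pose L := c + (1 + kappa p beta).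
have k1 := kappa_gt0 hp hbeta.
have L0 : 0 < L by rewrite !addr_gt0.
pose C := (2 * excess_c + 4 + L * Cb) * (2 / c).
have ec0 := excess_c_ge0.
have C0 : 0 < C by rewrite !mulr_gt0 ?invr_gt0 // ltr_wpDl ?addr_gt0 ?mulr_gt0 // addr_ge0 ?mulr_ge0.
exists C => //.
have pp0 : 0 < p%:R * p%:R :> R by rewrite mulr_gt0 // ltr0n ltnW.
(* the force of the parameter shift must lose against half of the monotonicity constant,
   and the excess must stay where [expR] is controlled by its tangent *)
pose t1 := Num.min (c / 4 / (p%:R * p%:R)) (1 / 2 / 2 / (p%:R * p%:R)).
have t10 : 0 < t1 by rewrite lt_min !divr_gt0.
near=> N.
have [N0 tN] : (0 < N)%N /\ `|tau d t N| <= t1 by near: N; exact: near_window.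
have Nr : 0 < N%:R :> R by rewrite ltr0n.
have [_ exN] : (0 < N)%N /\ forall k l (X : config q N), k != l ->
  `|excess p beta h (window N) N k l (freq X)
     - tau d t N * (p%:R * (freq X 0 l ^+ p.-1 - freq X 0 k ^+ p.-1))| <= excess_c / N%:R.
  by near: N; exact: excess_window.
have cN4 : `|excess_c / N%:R| <= 1 / 2 / 2.
  by near: N; apply: near_small; [rewrite divr_gt0 | exact: inv_nat_cvg0 d4 _].
have bN : E N (bad (e ^+ 2) (N := N)) <= Cb / N%:R by near: N; exact: badN.
pose W (X : config q N) : R := freq X 0 l - freq X 0 k.
have W1 X : `|W X| <= 1 by apply: unit_dist; exact: freq_unit.
pose ee (X : config q N) := excess p beta h (window N) N k l (freq X).
have eeW X : `|ee X| <= `|tau d t N| * (p%:R * p%:R) * `|W X| + excess_c / N%:R.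
  have := exN k l X kl; rewrite -/(ee X) => H.
  rewrite -[ee X](subrK (tau d t N * (p%:R * (freq X 0 l ^+ p.-1 - freq X 0 k ^+ p.-1)))).
  apply: le_trans (ler_normD _ _) _; rewrite addrC; apply: lerD H.
  rewrite !normrM normr_nat -!mulrA ler_wpM2l // ler_wpM2l // ?ler0n //.
  rewrite ler_wpM2l //; apply: le_trans (expr_lipschitz _ (freq_unit _ _) (freq_unit _ _)) _.
  by rewrite ler_wpM2r // ler_nat leq_pred.
have TT : `|tau d t N| * (p%:R * p%:R) <= c / 4.
  by rewrite -ler_pdivlMr //; apply: le_trans tN _; rewrite ge_min lexx.
have ee12 X : `|ee X| <= 1 / 2.
  apply: le_trans (eeW X) _.
  have h1 : `|tau d t N| * (p%:R * p%:R) <= 1 / 2 / 2.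
    by rewrite -ler_pdivlMr //; apply: le_trans tN _; rewrite ge_min lexx orbT.
  have h2 : `|tau d t N| * (p%:R * p%:R) * `|W X| <= 1 / 2 / 2 * 1 by apply: ler_pM => //; rewrite mulr_ge0.
  rewrite (splitr (1 / 2)) lerD //; first by apply: le_trans h2 _; rewrite mulr1.
  by move: cN4; rewrite ger0_norm ?divr_ge0 // .
have ex := @exchange_theta R p q beta h (window N) N k l (fun z => z 0 l - z 0 k) N0 kl.
rewrite (negbTE k0) (negbTE l0) subrr mulr0 expR0 in ex.
pose F (X : config q N) := th (freq X 0 l) * W X - 1 * th (freq X 0 k) * expR (ee X) *
  (jump N k l (freq X) 0 l - jump N k l (freq X) 0 k).
have EF : E N F = 0 by rewrite [LHS]fexpB ex subrr.
have main X : c / 2 * W X ^+ 2 <= F X + ((2 * excess_c + 4) / N%:R + L * bad (e ^+ 2) X).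
  rewrite /F.
  have -> : jump N k l (freq X) 0 l - jump N k l (freq X) 0 k = W X + 2 / N%:R.
    by rewrite jump_to // jump_from // /W; ring.
  rewrite mul1r.
  have tk := theta_unit p hbeta (freq_unit X k); have tl := theta_unit p hbeta (freq_unit X l).
  have mn : c * W X ^+ 2 <= (th (freq X 0 l) - th (freq X 0 k)) * W X + L * bad (e ^+ 2) X.
    rewrite /bad; have [ez|ez] := leP (e ^+ 2) (dist2 _ _).
      rewrite mulr1; have lip := theta_lipschitz hp hbeta (freq_unit X l) (freq_unit X k).
      have h1 : `|(th (freq X 0 l) - th (freq X 0 k)) * W X| <= (1 + kappa p beta) * 1.
        rewrite normrM; apply: ler_pM => //; apply: le_trans lip _.
        by rewrite ler_piMr ?W1 // addr_ge0 // ltW.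
      have h2 : c * W X ^+ 2 <= c.
        by rewrite ler_piMr ?(ltW c0) // -[W X ^+ 2]ger0_norm ?sqr_ge0 // normrX exprn_ile1.
      by move: h1; rewrite ler_norml mulr1 /L => /andP[? ?]; lra.
    rewrite mulr0 addr0; apply: mono.
      rewrite -(@ler_pXn2r _ 2) ?nnegrE ?(ltW e0) // -normrX ger0_norm ?sqr_ge0 //.
      apply: le_trans (ltW ez); rewrite /dist2 (bigD1 l) //= xvecE (negbTE l0) lerDl.
      by apply: sumr_ge0 => i _; exact: sqr_ge0.
    rewrite -(@ler_pXn2r _ 2) ?nnegrE ?(ltW e0) // -normrX ger0_norm ?sqr_ge0 //.
    apply: le_trans (ltW ez); rewrite /dist2 (bigD1 k) //= xvecE (negbTE k0) lerDl.
    by apply: sumr_ge0 => i _; exact: sqr_ge0.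
  have s4 := equalization_step tk (W1 X) (ee12 X) (eeW X) (divr_ge0 ec0 (ler0n _ N))
    (TT : _ <= c / 4) (mulr_ge0 (normr_ge0 _) (ltW pp0)) (ltW (_ : 0 < N%:R^-1)).
  rewrite invr_gt0 in s4; move: mn (s4 Nr); rewrite mulrDl.
  move: (th _) (th _) (expR _) (W X) (bad _ _) => x y z w v; lra.
have := le_fexp (hP N) main.
have EB : E N (fun X => (2 * excess_c + 4) / N%:R + L * bad (e ^+ 2) X) =
    (2 * excess_c + 4) / N%:R + L * E N (bad (e ^+ 2) (N := N)).
  by rewrite (fexpD (@P N) (fun=> _)) (fexp_cst (hP N)) (fexpZ (@P N)).
rewrite (fexpD (@P N) F) EF add0r EB (fexpZ (@P N)) => fin.
have fin2 : c / 2 * E N (fun X => W X ^+ 2) <= (2 * excess_c + 4 + L * Cb) / N%:R.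
  by rewrite mulrDl (le_trans fin) // lerD2l -mulrA ler_pM2l.
by rewrite /C mulrAC -ler_pdivrMr ?divr_gt0 // invf_div mulrC.
Unshelve. all: by end_near. Qed.

End window.

Section balance.
Context {R : realType}.
Variables (p q : nat) (beta h s : R) (d : nat) (t : R).
Hypotheses (hp : (2 <= p)%N) (hq : (2 <= q)%N) (hbeta : 0 < beta) (hh : 0 <= h).
Hypothesis hspecial : special p q beta h s.
Hypothesis d4 : (4 <= d)%N.

Local Notation q1 := (q%:R - 1 : R).
Local Notation a := (vtop q s).
Local Notation b := (vbot q s).
Local Notation th := (theta p beta).
Local Notation P N := (@window_law R p q beta h d t N).
Local Notation E N Z := (fexp (P N) Z).
Local Notation B N := (window beta d t N).

Hypothesis hconvex : (2 < q)%N -> kappa p beta * b ^+ p.-1 < 1.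

Let hP N : is_dist (P N). Proof. exact: window_dist. Qed.
Let q11 := @q1_ge1 R q hq.
Let q1pos : 0 < q1. Proof. exact: lt_le_trans q11. Qed.
Let sint := special_interior hq hspecial.

Definition colour0 : 'I_q := Ordinal (ltnW hq).
Local Notation i0 := colour0.

(** The displacement of the order parameter, measured on the other colours. *)
Definition xi (z : 'rV[R]_q) : R := (a - z 0 i0) / q1.

Definition spread (z : 'rV[R]_q) : R := \sum_(r | r != i0) (z 0 r - (b + xi z)) ^+ 2.

Lemma neq_colour0 (r : 'I_q) : (r != i0) = (r != 0 :> nat).
Proof. by rewrite -val_eqE. Qed.

Lemma top_xi z : a - q1 * xi z = z 0 i0.
Proof. by rewrite /xi; field; rewrite gt_eqF. Qed.

Lemma sum_others (c : R) : \sum_(r | r != i0) c = q1 * c.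
Proof.
have := @sum_ord_first R q hq (fun r => if r == 0 :> nat then 0 else c) 0 c (fun=> erefl).
rewrite (bigD1 i0) //= !add0r => <-; apply: eq_bigr => r.
by rewrite neq_colour0 => /negbTE ->.
Qed.

Lemma sum_deviation z : prob_vec z -> \sum_(r | r != i0) (z 0 r - (b + xi z)) = 0.
Proof.
move=> [_ z1]; rewrite sumrB sum_others.
have := vtop_vbot hq s; rewrite /xi; move: z1; rewrite (bigD1 i0) //= => z1 ab.
have -> : \sum_(r | r != i0) z 0 r = 1 - z 0 i0.
  by apply/eqP; rewrite eq_sym subr_eq addrC; apply/eqP.
have -> : q1 * (b + (a - z 0 i0) / q1) = a + q1 * b - z 0 i0 by field; rewrite gt_eqF.
by rewrite ab subrr.
Qed.

Lemma coord_unit (z : 'rV[R]_q) r : prob_vec z -> 0 <= z 0 r <= 1.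
Proof. by move=> [z0 z1]; rewrite z0 -z1 (bigD1 r) //= lerDl sumr_ge0. Qed.

Lemma mean_unit z : prob_vec z -> 0 <= b + xi z <= 1.
Proof.
move=> pz; have /andP[z0 z1] := coord_unit i0 pz.
have -> : b + xi z = (1 - z 0 i0) / q1.
  have -> : 1 - z 0 i0 = a + q1 * b - z 0 i0 by rewrite vtop_vbot.
  by rewrite /xi; field; rewrite gt_eqF.
have d0 : 0 <= 1 - z 0 i0 by rewrite subr_ge0.
apply/andP; split; first exact: divr_ge0 d0 (ltW q1pos).
by rewrite ler_pdivrMr // mul1r (le_trans _ q11) // lerBlDr lerDl.
Qed.

Lemma xi_le1 z : prob_vec z -> `|xi z| <= 1.
Proof.
move=> pz; rewrite /xi normrM normfV (gtr0_norm q1pos) ler_pdivrMr // mul1r.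
apply: le_trans q11; apply: unit_dist; last exact: coord_unit.
by have := coord_unit i0 (xvec_prob hq sint); rewrite xvecE.
Qed.

Lemma spread_ge0 z : 0 <= spread z.
Proof. by apply: sumr_ge0 => r _; exact: sqr_ge0. Qed.

(** Cauchy-Schwarz, [z 0 k - v] being the average of [z 0 k - z 0 l] over [l]. *)
Lemma spread_le z : prob_vec z ->
  spread z <= \sum_(k | k != i0) \sum_(l | l != i0) (z 0 l - z 0 k) ^+ 2.
Proof.
move=> pz; apply: ler_sum => k _; set v := b + xi z; set y := z 0 k - v.
have sv : \sum_(l | l != i0) (z 0 l - v) = 0 by exact: sum_deviation.
have := sumr_ge0 (index_enum _) (fun l _ => sqr_ge0 (z 0 l - v)) : 0 <= \sum_(l | l != i0) (z 0 l - v) ^+ 2.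
have -> : \sum_(l | l != i0) (z 0 l - z 0 k) ^+ 2 =
   \sum_(l | l != i0) (z 0 l - v) ^+ 2 - 2 * y * (\sum_(l | l != i0) (z 0 l - v)) + q1 * y ^+ 2.
  rewrite -sum_others mulr_sumr -sumrB -big_split /=; apply: eq_bigr => l _.
  by rewrite /y; ring.
rewrite sv mulr0 subr0 => S0; apply: ler_wpDl => //.
by rewrite ler_peMl ?sqr_ge0.
Qed.

(** Of mean [O(1 / N)], hence negligible even after multiplication by [scale ^+ d.-1]. *)
Definition rare (f : forall N, config q N -> R) :=
  exists2 C, 0 < C & \forall N \near \oo, E N (f N) <= C / N%:R.

Lemma rare_sum (I : finType) (A : pred I) (f : I -> forall N, config q N -> R) :
  (forall i, A i -> rare (f i)) -> rare (fun N X => \sum_(i | A i) f i N X).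
Proof.
move=> Hf; suff H r : rare (fun N X => \sum_(i <- r | A i) f i N X) by exact: H.
elim: r => [|i r [C C0 HC]].
  exists 1 => //; near=> N; rewrite [leLHS](_ : _ = 0) ?divr_ge0 //.
  by rewrite /fexp big1 // => X _; rewrite big_nil mulr0.
have [Ai|nAi] := boolP (A i); last first.
  exists C => //; apply: filterS HC => N; apply: le_trans; apply: le_fexp => // X.
  by rewrite big_cons (negbTE nAi).
have [D D0 HD] := Hf i Ai; exists (D + C); first exact: addr_gt0.
near=> N; have h1 : E N (f i N) <= D / N%:R by near: N; exact: HD.
have h2 : E N (fun X => \sum_(j <- r | A j) f j N X) <= C / N%:R by near: N; exact: HC.
apply: le_trans (_ : E N (f i N) + E N (fun X => \sum_(j <- r | A j) f j N X) <= _).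
  by rewrite -fexpD; apply: le_fexp => // X; rewrite big_cons Ai.
by rewrite mulrDl lerD.
Unshelve. all: by end_near. Qed.

Lemma rare_le f g : rare g -> (\forall N \near \oo, forall X, f N X <= g N X) -> rare f.
Proof.
move=> [C C0 HC] fg; exists C => //; near=> N.
have h1 : forall X, f N X <= g N X by near: N; exact: fg.
by apply: le_trans (le_fexp (hP N) h1) _; near: N; exact: HC.
Unshelve. all: by end_near. Qed.

Lemma spread_rare : rare (fun N X => spread (freq X)).
Proof.
apply: (@rare_le _ (fun N X => \sum_(k | k != i0) \sum_(l | l != i0)
   (freq X 0 l - freq X 0 k) ^+ 2)).
  apply: rare_sum => k; rewrite neq_colour0 => k0; apply: rare_sum => l.
  by rewrite neq_colour0 => l0; exact: (equalization t hp hq hbeta hspecial d4 hconvex).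
near=> N => X; apply: spread_le; apply: freq_prob_vec; near: N; exact: near_ge.
Unshelve. all: by end_near. Qed.

Local Notation ee N r X := (excess p beta h (B N) N i0 r (freq X)).

(** Exchanges between the distinguished colour and the others, tested against a function
    of the order parameter. *)
Lemma balance N (G : R -> R) : (0 < N)%N ->
  E N (fun X => expR (- h) * th (freq X 0 i0) *
     (\sum_(r | r != i0) expR (ee N r X)) * G (xi (freq X) + (q1 * N%:R)^-1)) =
  E N (fun X => (\sum_(r | r != i0) th (freq X 0 r)) * G (xi (freq X))).
Proof.
move=> N0.
transitivity (\sum_(r | r != i0) E N (fun X => th (freq X 0 r) * G (xi (freq X)))); last first.
  by rewrite -fexp_sum; congr fexp; apply/funext => X; rewrite mulr_suml.
transitivity (\sum_(r | r != i0) E N (fun X => expR (- h) * th (freq X 0 i0) *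
    expR (ee N r X) * G (xi (freq X) + (q1 * N%:R)^-1))).
  by rewrite -fexp_sum; congr fexp; apply/funext => X; rewrite mulr_sumr mulr_suml.
apply: eq_bigr => r r0; have r0' : i0 != r by rewrite eq_sym.
have := @exchange_theta R p q beta h (B N) N i0 r (fun z => G (xi z)) N0 r0'.
rewrite eqxx; move: (r0); rewrite neq_colour0 => /negbTE ->.
rewrite sub0r mulrN1 => <-; congr fexp; apply/funext => X; congr (_ * G _).
rewrite /xi jump_from //; field; rewrite !gt_eqF //.
by rewrite ltr0n.
Qed.

(** The first order terms of Taylor's formula at the average cancel in the sum. *)
Lemma theta_others : exists2 L, 0 < L & forall z : 'rV[R]_q, prob_vec z ->
  `|\sum_(r | r != i0) th (z 0 r) - q1 * th (b + xi z)| <= L * spread z.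
Proof.
have [L L0 HL] := theta_taylor hp hbeta; exists L => // z pz; set v := b + xi z.
have -> : \sum_(r | r != i0) th (z 0 r) - q1 * th v =
   \sum_(r | r != i0) (th (z 0 r) - th v - dtheta p beta v * (z 0 r - v)).
  have sd : \sum_(r | r != i0) (z 0 r - v) = 0 by exact: sum_deviation.
  by rewrite [RHS]sumrB [X in _ = X - _]sumrB -[X in _ = _ - X]mulr_sumr sd mulr0 subr0 sum_others.
apply: le_trans (ler_norm_sum _ _ _) _; rewrite /spread mulr_sumr.
by apply: ler_sum => r _; apply: HL; [exact: coord_unit | exact: mean_unit].
Qed.

Lemma expRNh : 0 < expR (- h) <= 1.
Proof. by rewrite expR_gt0 -[leRHS]expR0 ler_expR oppr_le0. Qed.

Lemma drift_xi z : drift p q beta h s (xi z) = expR (- h) * th (z 0 i0) - th (b + xi z).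
Proof. by rewrite /drift top_xi. Qed.

Lemma excess_others : \forall N \near \oo, (0 < N)%N /\ forall r (X : config q N), r != i0 ->
  `|ee N r X| <= `|tau d t N| * p%:R + excess_c p beta / N%:R /\ `|ee N r X| <= 1 / 2.
Proof.
have p0 : 0 < p%:R :> R by rewrite ltr0n ltnW.
have e1 : 0 < 1 / 2 / 2 / p%:R :> R by rewrite !divr_gt0.
near=> N.
have [N0 exN] : (0 < N)%N /\ forall k l (X : config q N), k != l ->
  `|excess p beta h (B N) N k l (freq X)
     - tau d t N * (p%:R * (freq X 0 l ^+ p.-1 - freq X 0 k ^+ p.-1))| <= excess_c p beta / N%:R.
  by near: N; exact: excess_window.
have [_ tN] : (0 < N)%N /\ `|tau d t N| <= 1 / 2 / 2 / p%:R by near: N; exact: near_window.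
have cN : `|excess_c p beta / N%:R| <= 1 / 2 / 2.
  by near: N; apply: near_small; [rewrite !divr_gt0 | exact: inv_nat_cvg0 d4 _].
split => // r X r0.
have H1 : `|ee N r X| <= `|tau d t N| * p%:R + excess_c p beta / N%:R.
  have := exN i0 r X; rewrite eq_sym => /(_ r0) H.
  rewrite -[ee N r X](subrK (tau d t N * (p%:R * (freq X 0 r ^+ p.-1 - freq X 0 i0 ^+ p.-1)))).
  apply: le_trans (ler_normD _ _) _; rewrite addrC; apply: lerD H.
  rewrite !normrM normr_nat ler_wpM2l // ler_piMr //.
  by apply: unit_dist; apply: unit_expr; exact: freq_unit.
split => //; apply: le_trans H1 _; rewrite (splitr (1 / 2)) lerD //.
  by rewrite -ler_pdivlMr.
by apply: le_trans (ler_norm _) cN.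
Unshelve. all: by end_near. Qed.

End balance.

Section order_parameter.
Context {R : realType}.
Variables (p q : nat) (beta h s : R) (d : nat) (lam t : R).
Hypotheses (hp : (2 <= p)%N) (hq : (2 <= q)%N) (hbeta : 0 < beta) (hh : 0 <= h).
Hypothesis hspecial : special p q beta h s.
Hypotheses (od : ~~ odd d) (d4 : (4 <= d)%N) (lam0 : 0 < lam).

Local Notation q1 := (q%:R - 1 : R).
Local Notation a := (vtop q s).
Local Notation b := (vbot q s).
Local Notation th := (theta p beta).
Local Notation K := (@scale R d).
Local Notation m := (xvec q s).
Local Notation P N := (@window_law R p q beta h d t N).
Local Notation E N Z := (fexp (P N) Z).
Local Notation B N := (window beta d t N).
Local Notation i0 := (colour0 hq).
Local Notation xi := (xi s hq).
Local Notation spread := (spread s hq).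
Local Notation ee N r X := (excess p beta h (B N) N i0 r (freq X)).
Local Notation rare := (rare p beta h d t).
Local Notation drift := (drift p q beta h s).

Hypothesis hdrift : asym drift (- (th b * lam)) d.-1.
Hypothesis hconvex : (2 < q)%N -> kappa p beta * b ^+ p.-1 < 1.

Let hP N : is_dist (P N). Proof. exact: window_dist. Qed.
Let q11 := @q1_ge1 R q hq.
Let q1pos : 0 < q1. Proof. exact: lt_le_trans q11. Qed.
Let sint := special_interior hq hspecial.
Let pos := interior_pos hq sint.
Let b0 : 0 < b := pos.2.
Let dpos : (0 < d)%N. Proof. by apply: leq_trans d4. Qed.

Lemma exprd_ge0 (x : R) : 0 <= x ^+ d.
Proof. by rewrite exprn_even_ge0. Qed.

(** Near 0 this is the expansion of the drift, with half of its coefficient; elsewhere the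
    event [bad] occurs. *)
Lemma restoring : exists c C e : R, [/\ 0 < c, 0 < C, 0 < e &
  forall N (X : config q N), (0 < N)%N ->
    c * xi (freq X) ^+ d <= - (q1 * drift (xi (freq X)) * xi (freq X)) + C * bad s e X].
Proof.
pose l := th b * lam; have l0 : 0 < l by rewrite mulr_gt0 // theta_gt0.
have l20 : 0 < l / 2 by rewrite divr_gt0.
have [e e0 He] := hdrift l20.
pose c := q1 * (l / 2); have c0 : 0 < c by rewrite mulr_gt0.
exists c, (c + q1), (e ^+ 2).
split; [exact: c0 | exact: addr_gt0 c0 q1pos | exact: exprn_gt0 | move=> N X N0].
have pz : prob_vec (freq X : 'rV[R]_q) by exact: freq_prob_vec.
set x := xi (freq X); have x1 : `|x| <= 1 by exact: (xi_le1 hq hspecial pz).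
have xd1 : x ^+ d <= 1.
  by rewrite -[x ^+ d]ger0_norm ?exprd_ge0 // normrX exprn_ile1.
have xdE : x ^+ d = x * x ^+ d.-1 by rewrite -exprS prednK.
have [xe|xe] := ltP `|x| e.
  have := He x xe; have b1 : 0 <= bad s (e ^+ 2) X by have /andP[] := bad_unit s (e ^+ 2) X.
  have cb : 0 <= (c + q1) * bad s (e ^+ 2) X by rewrite mulr_ge0 // addr_ge0 // ltW.
  move=> H; apply: le_trans (_ : - (q1 * drift x * x) <= _); last by rewrite lerDl.
  have : `|(drift x - - l * x ^+ d.-1) * x| <= l / 2 * x ^+ d.
    have -> : x ^+ d = `|x| ^+ d.-1 * `|x|.
      by rewrite -[LHS]ger0_norm ?exprd_ge0 // normrX -exprSr prednK.
    by rewrite normrM mulrA ler_wpM2r.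
  rewrite ler_norml => /andP[_].
  have -> : (drift x - - l * x ^+ d.-1) * x = drift x * x + l * x ^+ d by rewrite xdE; ring.
  rewrite -(ler_pM2l q1pos) /c; lra.
have -> : bad s (e ^+ 2) X = 1.
  rewrite /bad; suff -> : e ^+ 2 <= dist2 (freq X) m by [].
  apply: (@le_trans _ _ ((freq X 0 i0 - m 0 i0) ^+ 2)); last first.
    by rewrite /dist2 (bigD1 i0) //= lerDl sumr_ge0 // => i _; exact: sqr_ge0.
  have -> : freq X 0 i0 - m 0 i0 = - (q1 * x).
    by rewrite xvecE /= -(top_xi s hq (freq X)) -/x; ring.
  rewrite sqrrN exprMn; apply: (@le_trans _ _ (`|x| ^+ 2)).
    by rewrite lerXn2r ?nnegrE // ltW.
  by rewrite -normrX ger0_norm ?sqr_ge0 // ler_peMl ?sqr_ge0 // exprn_ege1.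
rewrite mulr1; have dr : `|drift x| <= 1.
  rewrite drift_xi; apply: unit_dist; last exact: (theta_unit p hbeta (mean_unit s hq pz)).
  have /andP[u0 u1] := theta_unit p hbeta (coord_unit i0 pz).
  have /andP[v0 v1] := expRNh hh.
  by rewrite mulr_ge0 ?(ltW v0) //= -[leRHS]mul1r ler_pM // ltW.
have : c * x ^+ d <= c by rewrite ler_piMr // ltW.
have : `|q1 * drift x * x| <= q1.
  have h1 : `|drift x * x| <= 1 by rewrite normrM mulr_ile1.
  by rewrite -mulrA normrM (gtr0_norm q1pos) -[leRHS]mulr1 ler_pM2l.
rewrite ler_norml => /andP[_]; lra.
Qed.

Lemma abs_le_pow (L x : R) : 1 <= L -> `|x| <= L + x ^+ d / L.
Proof.
move=> L1; have L0 : 0 < L by exact: lt_le_trans L1.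
have xL : 0 <= x ^+ d / L by rewrite divr_ge0 ?exprd_ge0 // ltW.
have [xl|xl] := leP `|x| L; first by apply: le_trans xl _; rewrite lerDl.
apply: (@le_trans _ _ (x ^+ d / L)); last by rewrite lerDr ltW.
rewrite ler_pdivlMr // -[x ^+ d]ger0_norm ?exprd_ge0 // normrX.
have x1 : 1 <= `|x| by rewrite (le_trans L1) // ltW.
apply: (@le_trans _ _ (`|x| ^+ 2)); first by rewrite expr2 ler_wpM2l // ltW.
by rewrite ler_weXn2l // (leq_trans _ d4).
Qed.

Lemma exchange_increment N (X : config q N) (D g k : R) : 0 <= D ->
  (forall r, r != i0 -> `|ee N r X| <= D /\ `|ee N r X| <= 1 / 2) ->
  `|(\sum_(r | r != i0) expR (ee N r X)) * (g + k) - q1 * g| <= q1 * (2 * D * `|g| + 2 * `|k|).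
Proof.
move=> D0 H.
have -> : (\sum_(r | r != i0) expR (ee N r X)) * (g + k) - q1 * g =
    \sum_(r | r != i0) ((expR (ee N r X) - 1) * g + expR (ee N r X) * k).
  by rewrite -(sum_others hq) mulr_suml -sumrB; apply: eq_bigr => r _; ring.
apply: le_trans (ler_norm_sum _ _ _) _; rewrite -(sum_others hq); apply: ler_sum => r r0.
have [H1 H2] := H r r0; have s1 := expR_sub1_bound H2.
apply: le_trans (ler_normD _ _) _; rewrite !normrM; apply: lerD; rewrite ler_wpM2r //.
  by apply: le_trans s1 _; rewrite ler_wpM2l.
rewrite ger0_norm ?expR_ge0 //; move: s1; rewrite ler_norml => /andP[_]; lra.
Qed.

(** The balance identity for the test function [xi] itself: the restoring drift bounds
    [N * E (xi ^+ d)] by a constant, up to the force [t * E |scale * xi|], which is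
    absorbed by [abs_le_pow] with [L] large. *)
Lemma moment_bound : exists C, \forall N \near \oo,
  E N (fun X => (K N * xi (freq X)) ^+ d) <= C.
Proof.
have [c [C1 [e [c0 C10 e0 Hr]]]] := restoring.
have [Cb Cb0 Hb] := bad_rare t hp hq hbeta hspecial d4 e0.
have [Cs Cs0 Hs] := spread_rare t hp hq hbeta hspecial d4 hconvex.
have [L L0 HL] := theta_others s hp hq hbeta.
pose ec := excess_c p beta; have ec0 : 0 <= ec := excess_c_ge0 p hbeta.
have p0 : 0 < p%:R :> R by rewrite ltr0n ltnW.
pose C2 := 2 * (q1 * ec + 1) + L * Cs + C1 * Cb.
pose A := 2 * q1 * p%:R * `|t|; have A0 : 0 <= A by rewrite !mulr_ge0 // ltW.
(* so large that [A / M <= c / 2] *)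
pose M := 1 + 2 * A / c.
have M1 : 1 <= M by rewrite /M lerDl divr_ge0 ?mulr_ge0 // ltW.
exists ((A * M + C2) * (2 / c)).
near=> N.
have [N0 eeN] : (0 < N)%N /\ forall r (X : config q N), r != i0 ->
  `|ee N r X| <= `|tau d t N| * p%:R + ec / N%:R /\ `|ee N r X| <= 1 / 2.
  by near: N; exact: excess_others.
have Nr : 0 < N%:R :> R by rewrite ltr0n.
have hb : E N (bad s e (N := N)) <= Cb / N%:R by near: N; exact: Hb.
have hs : E N (fun X => spread (freq X)) <= Cs / N%:R by near: N; exact: Hs.
pose D := `|tau d t N| * p%:R + ec / N%:R.
have D0 : 0 <= D by rewrite addr_ge0 ?mulr_ge0 ?divr_ge0 ?(ltW p0).
pose x (X : config q N) := xi (freq X).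
pose FA (X : config q N) := expR (- h) * th (freq X 0 i0) *
     (\sum_(r | r != i0) expR (ee N r X)) * (x X + (q1 * N%:R)^-1).
pose FB (X : config q N) := (\sum_(r | r != i0) th (freq X 0 r)) * x X.
have EAB : E N FA = E N FB by exact: (balance p beta h s d t hq (fun y => y) N0).
have main X : c * x X ^+ d <= (FB X - FA X) +
   (2 * q1 * p%:R * `|tau d t N| * `|x X| + 2 * (q1 * ec + 1) / N%:R) +
   (L * spread (freq X) + C1 * bad s e X).
  have pz : prob_vec (freq X : 'rV[R]_q) by exact: freq_prob_vec.
  have x1 : `|x X| <= 1 by exact: (xi_le1 hq hspecial pz).
  pose k0 := expR (- h) * th (freq X 0 i0).
  have k01 : 0 <= k0 <= 1.
    have /andP[u0 u1] := theta_unit p hbeta (coord_unit i0 pz).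
    have /andP[v0 v1] := expRNh hh.
    by rewrite /k0 mulr_ge0 ?(ltW v0) //= -[leRHS]mul1r ler_pM // ltW.
  pose inc := (\sum_(r | r != i0) expR (ee N r X)) * (x X + (q1 * N%:R)^-1) - q1 * x X.
  have hinc : k0 * inc <= 2 * q1 * p%:R * `|tau d t N| * `|x X| + 2 * (q1 * ec + 1) / N%:R.
    have H := exchange_increment (x X) (q1 * N%:R)^-1 D0 (fun r => eeN r X).
    apply: le_trans (ler_norm _) _; rewrite normrM.
    apply: le_trans (_ : `|inc| <= _); first by rewrite ler_piMl // ger0_norm; case/andP: k01.
    apply: le_trans H _.
    have -> : `|(q1 * N%:R)^-1| = q1^-1 / N%:R by rewrite invfM ger0_norm // divr_ge0 // invr_ge0 ltW.
    have -> : q1 * (2 * D * `|x X| + 2 * (q1^-1 / N%:R)) =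
       2 * q1 * p%:R * `|tau d t N| * `|x X| + (2 * q1 * (ec / N%:R) * `|x X| + 2 / N%:R).
      by rewrite /D; field; rewrite !gt_eqF.
    rewrite lerD2l; have -> : 2 * (q1 * ec + 1) / N%:R = 2 * q1 * (ec / N%:R) + 2 / N%:R by ring.
    by rewrite lerD2r ler_piMr // !mulr_ge0 ?invr_ge0 // ltW.
  have hth : (q1 * th (b + x X) - \sum_(r | r != i0) th (freq X 0 r)) * x X <= L * spread (freq X).
    apply: le_trans (ler_norm _) _; rewrite normrM distrC; apply: le_trans (HL _ pz).
    by rewrite ler_piMr.
  have := Hr N X N0; rewrite -/(x X) drift_xi -/(x X) -/k0.
  have -> : - (q1 * (k0 - th (b + x X)) * x X) = FB X - FA X + k0 * inc +
      (q1 * th (b + x X) - \sum_(r | r != i0) th (freq X 0 r)) * x X.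
    by rewrite /FB /FA /inc -/k0; ring.
  by move=> H; apply: le_trans H _; rewrite [leRHS]addrA lerD2r lerD // lerD2l.
have := le_fexp (hP N) main.
have -> : E N (fun X => FB X - FA X +
     (2 * q1 * p%:R * `|tau d t N| * `|x X| + 2 * (q1 * ec + 1) / N%:R) +
     (L * spread (freq X) + C1 * bad s e X)) =
  (E N FB - E N FA) + (2 * q1 * p%:R * `|tau d t N| * E N (fun X => `|x X|) +
    2 * (q1 * ec + 1) / N%:R) + (L * E N (fun X => spread (freq X)) + C1 * E N (bad s e (N := N))).
  rewrite -!(fexpZ (P N)) -(fexpB (P N)) -{2}(fexp_cst (hP N) (2 * (q1 * ec + 1) / N%:R)).
  by rewrite -!(fexpD (P N)).
rewrite EAB subrr add0r (fexpZ (P N)) => H.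
have H1 : c * E N (fun X => x X ^+ d) <= 2 * q1 * p%:R * `|tau d t N| * E N (fun X => `|x X|) + C2 / N%:R.
  apply: le_trans H _; rewrite -addrA lerD2l.
  have -> : C2 / N%:R = 2 * (q1 * ec + 1) / N%:R + (L * (Cs / N%:R) + C1 * (Cb / N%:R)).
    by rewrite /C2; ring.
  by rewrite lerD2l lerD // ler_pM2l.
have KN := @scale_gt0 R d N N0; have Kd := @scale_exp R d d4 N.
pose y X := K N * x X.
have Eyd : E N (fun X => y X ^+ d) = N%:R * E N (fun X => x X ^+ d).
  by rewrite -fexpZ; congr fexp; apply/funext => X; rewrite /y exprMn Kd.
have Ey1 : N%:R * (`|tau d t N| * E N (fun X => `|x X|)) = `|t| * E N (fun X => `|y X|).
  have tK : N%:R * `|tau d t N| = `|t| * K N.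
    have KS : K N ^+ d = K N * K N ^+ d.-1 by rewrite -exprS prednK.
    rewrite /tau normrM normfV normrX (gtr0_norm KN) -Kd KS.
    by field; rewrite expf_neq0 // gt_eqF.
  rewrite mulrA tK -mulrA -fexpZ; congr (_ * fexp _ _); apply/funext => X.
  by rewrite /y (normrM (K N)) (gtr0_norm KN).
have H2 : c * E N (fun X => y X ^+ d) <= A * E N (fun X => `|y X|) + C2.
  rewrite Eyd mulrCA.
  have : N%:R * (c * E N (fun X => x X ^+ d)) <= N%:R *
    (2 * q1 * p%:R * `|tau d t N| * E N (fun X => `|x X|) + C2 / N%:R) by rewrite ler_pM2l.
  move=> H2; apply: le_trans H2 _; rewrite /A -[_ * `|t| * _]mulrA -Ey1 le_eqVlt.
  by apply/orP; left; apply/eqP; field; rewrite gt_eqF.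
have M0 : 0 < M by exact: lt_le_trans M1.
have H3 : E N (fun X => `|y X|) <= M + E N (fun X => y X ^+ d) / M.
  have -> : M + E N (fun X => y X ^+ d) / M = E N (fun X => M + M^-1 * y X ^+ d).
    by rewrite (fexpD (P N) (fun=> M)) (fexp_cst (hP N)) fexpZ mulrC.
  by apply: le_fexp => // X; rewrite mulrC; exact: abs_le_pow.
have H4 : A * (E N (fun X => y X ^+ d) / M) <= c / 2 * E N (fun X => y X ^+ d).
  have Y0 : 0 <= E N (fun X => y X ^+ d) by apply: fexp_ge0 => // X; exact: exprd_ge0.
  rewrite mulrCA [leRHS]mulrC ler_wpM2l // ler_pdivrMr // /M.
  have -> : c / 2 * (1 + 2 * A / c) = c / 2 + A by field; rewrite gt_eqF.
  by rewrite lerDr divr_ge0 // ltW.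
have H5 : A * E N (fun X => `|y X|) <= A * M + A * (E N (fun X => y X ^+ d) / M).
  by rewrite -mulrDr ler_wpM2l.
have H6 : c / 2 * E N (fun X => y X ^+ d) <= A * M + C2.
  have : c * E N (fun X => y X ^+ d) = c / 2 * E N (fun X => y X ^+ d) + c / 2 * E N (fun X => y X ^+ d) by field.
  move: H2 H4 H5; lra.
by rewrite -ler_pdivrMr ?divr_gt0 // invf_div mulrC.
Unshelve. all: by end_near. Qed.

End order_parameter.

Section compact_support.
Context {R : realType}.

Lemma compact_support_bounded (f : R -> R) M : continuous f -> vanishes_beyond M f ->
  exists2 C, 0 < C & forall y, `|f y| <= C.
Proof.
move=> cf fM; have M0 : - `|M| <= `|M| by have := normr_ge0 M; lra.
have cn : {within `[- `|M|, `|M|], continuous (fun y => `|f y|)}.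
  by apply: continuous_subspaceT; apply: (ct_comp cf); exact: ct_norm.
have [c _ Hc] := EVT_max M0 cn.
exists (`|f c| + 1) => [|y]; first by rewrite ltr_wpDl.
have [yM|yM] := leP `|y| `|M|.
  by apply: le_trans (Hc y _) _; rewrite ?lerDl // in_itv /= -ler_norml.
by rewrite fM ?normr0 ?addr_ge0 // (le_trans (ler_norm M)) // ltW.
Qed.

Lemma derivative_vanishes (G dG : R -> R) M :
  (forall y, is_derive y (1 : R) G (dG y)) -> vanishes_beyond M G ->
  vanishes_beyond (M + 1) dG.
Proof.
move=> dGP GM y My.
have H0 : is_derive y (1 : R) G 0.
  apply: near_eq_is_derive (dv_cst y 0); near=> x; rewrite GM //.
  have xy : `|y - x| < 1 by near: x; exact: (nbhsx_ballx y 1 ltr01).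
  have := ler_distD x y 0; rewrite !subr0; lra.
by have := @derive_val _ _ _ _ _ _ _ (dGP y); rewrite (@derive_val _ _ _ _ _ _ _ H0).
Unshelve. all: by end_near. Qed.

End compact_support.

Section stein.
Context {R : realType}.
Variables (p q : nat) (beta h s : R) (d : nat) (lam t : R).
Hypotheses (hp : (2 <= p)%N) (hq : (2 <= q)%N) (hbeta : 0 < beta) (hh : 0 <= h).
Hypothesis hspecial : special p q beta h s.
Hypothesis d4 : (4 <= d)%N.

Local Notation q1 := (q%:R - 1 : R).
Local Notation a := (vtop q s).
Local Notation b := (vbot q s).
Local Notation th := (theta p beta).
Local Notation K := (@scale R d).
Local Notation m := (xvec q s).
Local Notation P N := (@window_law R p q beta h d t N).
Local Notation E N Z := (fexp (P N) Z).
Local Notation B N := (window beta d t N).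
Local Notation i0 := (colour0 hq).
Local Notation xi := (xi s hq).
Local Notation spread := (spread s hq).
Local Notation ee N r X := (excess p beta h (B N) N i0 r (freq X)).
Local Notation drift := (drift p q beta h s).
Local Notation sml := (@small R (fun N => config q N) (fun N => P N)).

Hypothesis hdrift : asym drift (- (th b * lam)) d.-1.
Hypothesis hconvex : (2 < q)%N -> kappa p beta * b ^+ p.-1 < 1.

Let hP N : is_dist (P N). Proof. exact: window_dist. Qed.
Let q11 := @q1_ge1 R q hq.
Let q1pos : 0 < q1. Proof. exact: lt_le_trans q11. Qed.
Let sint := special_interior hq hspecial.
Let pos := interior_pos hq sint.
Let b0 : 0 < b := pos.2.
Let dpos : (0 < d)%N. Proof. by apply: leq_trans d4. Qed.

Definition order N (X : config q N) : R := K N * xi (freq X).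

(** The slope of [pnormp p] in [xi], which is also the force exerted by a shift of [beta]. *)
Definition field_coef : R := q1 * (p%:R * (b ^+ p.-1 - a ^+ p.-1)).

Definition deviation N (X : config q N) : R := \sum_r `|freq X 0 r - m 0 r|.

Lemma deviation_cvg0 : sml deviation.
Proof.
apply: (small_sum hP (f := fun r N X => `|freq X 0 r - m 0 r|)) => // r _.
apply: small_le (deviation_small t hp hq hbeta hspecial d4 r) _ => //.
by near=> N => X; rewrite normr_id.
Unshelve. all: by end_near. Qed.

Lemma deviation_ge N (X : config q N) r : `|freq X 0 r - m 0 r| <= deviation X.
Proof. by rewrite /deviation (bigD1 r) //= lerDl sumr_ge0. Qed.

Definition field0 (z : 'rV[R]_q) : R := expR (- h) * th (z 0 i0).

Lemma field0_unit z : prob_vec z -> 0 <= field0 z <= 1.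
Proof.
move=> pz; have /andP[u0 u1] := theta_unit p hbeta (coord_unit i0 pz).
have /andP[v0 v1] := expRNh hh.
by rewrite /field0 mulr_ge0 ?(ltW v0) //= -[leRHS]mul1r ler_pM // ltW.
Qed.

(** The drift vanishes at the maximizer. *)
Lemma field0_eq : expR (- h) * th a = th b.
Proof.
have [e e0 He] := hdrift ltr01; have := He 0; rewrite normr0 => /(_ e0).
have -> : d.-1 = d.-2.+1 by case: (d) d4 => [|[]].
rewrite !exprS !mul0r mulr0 subr0 mulr0 normr_le0 /drift mulr0 subr0 addr0 subr_eq0.
by move/eqP.
Qed.

Lemma field0_dev : forall N (X : config q N), (0 < N)%N ->
  `|th b - field0 (freq X)| <= (1 + kappa p beta) * deviation X.
Proof.
move=> N X N0; have pz : prob_vec (freq X : 'rV[R]_q) by exact: freq_prob_vec.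
have k1 : 0 <= 1 + kappa p beta by rewrite addr_ge0 // ltW // kappa_gt0.
have au : 0 <= a <= 1 by have := coord_unit i0 (xvec_prob hq sint); rewrite xvecE.
rewrite /field0 -field0_eq -mulrBr normrM; have /andP[v0 v1] := expRNh hh.
apply: le_trans (_ : `|th a - th (freq X 0 i0)| <= _).
  by rewrite ler_piMl // ger0_norm // ltW.
apply: le_trans (theta_lipschitz hp hbeta au (coord_unit i0 pz)) _.
rewrite ler_wpM2l // distrC; have := deviation_ge X i0; rewrite xvecE /=; exact.
Qed.

Section test_function.
Variables (G dG : R -> R) (M CG CdG : R).
Hypotheses (dGP : forall y : R, is_derive y (1 : R) G (dG y)) (cdG : continuous dG).
Hypotheses (GM : vanishes_beyond M G) (dGM : vanishes_beyond M dG) (M0 : 0 < M).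
Hypotheses (CG0 : 0 < CG) (GC : forall y, `|G y| <= CG).
Hypotheses (CdG0 : 0 < CdG) (dGC : forall y, `|dG y| <= CdG).

Local Notation step N := (K N / (q1 * N%:R)).

(** The balance identity for [G], multiplied by [scale ^+ d.-1], splits into the terms of
    Stein's identity and the four errors below: the drift against its leading monomial, the
    other colours against their average, the force of the parameter shift, and the finite
    difference of [G] against its derivative. *)
Definition drift_error N (X : config q N) : R :=
  q1 * (K N ^+ d.-1 * drift (xi (freq X)) + th b * lam * order X ^+ d.-1) * G (order X).

Definition spread_error N (X : config q N) : R :=
  K N ^+ d.-1 * (q1 * th (b + xi (freq X)) - \sum_(r | r != i0) th (freq X 0 r)) * G (order X).

Definition field_error N (X : config q N) : R :=
  th b * (t * field_coef) * G (order X) - field0 (freq X) * K N ^+ d.-1 *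
    (\sum_(r | r != i0) (expR (ee N r X) - 1)) * G (order X + step N).

Definition diffusion_error N (X : config q N) : R :=
  th b * dG (order X) -
  field0 (freq X) * K N ^+ d.-1 * q1 * (G (order X + step N) - G (order X)).

Lemma drift_small : sml drift_error.
Proof.
apply: small_eps => // e e0; exists (fun _ _ => 0); first exact: small0.
have e1 : 0 < e / (q1 * M ^+ d.-1 * CG) by rewrite divr_gt0 // !mulr_gt0 // exprn_gt0.
have [del del0 Hd] := hdrift e1.
near=> N => X; rewrite normr0 addr0.
have N0 : (0 < N)%N by near: N; exact: near_ge.
have KN := @scale_gt0 R d N N0.
have [xM|xM] := leP M `|order X|; first by rewrite /drift_error GM // mulr0 normr0 ltW.
have xd : `|xi (freq X)| < del.
  have : `|(K N)^-1| <= del / 2 / M.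
    by near: N; apply: near_small; [rewrite !divr_gt0 | exact: inv_scale_cvg0].
  rewrite ger0_norm ?invr_ge0 ?(ltW KN) // ler_pdivlMr // => KM.
  have -> : xi (freq X) = (K N)^-1 * order X by rewrite /order mulrA mulVf ?mul1r // gt_eqF.
  rewrite normrM ger0_norm ?invr_ge0 ?(ltW KN) //.
  apply: le_lt_trans (_ : del / 2 < del); last by rewrite ltr_pdivrMr // ltr_pMr // ltr1n.
  by apply: le_trans KM; rewrite ler_wpM2l ?invr_ge0 ?(ltW KN) // ltW.
have H := Hd _ xd.
rewrite /drift_error !normrM (gtr0_norm q1pos).
have -> : K N ^+ d.-1 * drift (xi (freq X)) + th b * lam * order X ^+ d.-1 =
   K N ^+ d.-1 * (drift (xi (freq X)) - - (th b * lam) * xi (freq X) ^+ d.-1).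
  by rewrite /order exprMn; ring.
rewrite normrM normrX (gtr0_norm KN).
have H2 : K N ^+ d.-1 * `|drift (xi (freq X)) - - (th b * lam) * xi (freq X) ^+ d.-1| <=
    e / (q1 * M ^+ d.-1 * CG) * M ^+ d.-1.
  apply: (@le_trans _ _ (K N ^+ d.-1 * (e / (q1 * M ^+ d.-1 * CG) * `|xi (freq X)| ^+ d.-1))).
    by rewrite ler_wpM2l // exprn_ge0 // ltW.
  rewrite mulrCA ler_wpM2l ?(ltW e1) // -exprMn -{1}(gtr0_norm KN) -normrM.
  by rewrite lerXn2r ?nnegrE ?(ltW M0) // ltW.
have -> : e = q1 * (e / (q1 * M ^+ d.-1 * CG) * M ^+ d.-1) * CG.
  by field; rewrite !gt_eqF // exprn_gt0.
apply: ler_pM => //; first by rewrite !mulr_ge0 ?exprn_ge0 ?(ltW KN) ?(ltW q1pos).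
by rewrite ler_pM2l.
Unshelve. all: by end_near. Qed.

Lemma spread_small : sml spread_error.
Proof.
have [L L0 HL] := theta_others s hp hq hbeta.
have [Cs Cs0 Hs] := spread_rare t hp hq hbeta hspecial d4 hconvex.
apply: (small_of_bound hP (u := fun N => L * CG * Cs * (K N)^-1)) => //.
  by rewrite -[X in _ --> X](mulr0 (L * CG * Cs)); apply: cvgMr; exact: inv_scale_cvg0.
near=> N; have N0 : (0 < N)%N by near: N; exact: near_ge.
have KN := @scale_gt0 R d N N0.
have hs : E N (fun X => spread (freq X)) <= Cs / N%:R by near: N; exact: Hs.
apply: (@le_trans _ _ (E N (fun X => (L * CG * K N ^+ d.-1) * spread (freq X)))).
  apply: le_fexp => // X; have pz : prob_vec (freq X : 'rV[R]_q) by exact: freq_prob_vec.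
  rewrite /spread_error !normrM normrX (gtr0_norm KN) distrC.
  have -> : L * CG * K N ^+ d.-1 * spread (freq X) = K N ^+ d.-1 * (L * spread (freq X)) * CG by ring.
  apply: ler_pM => //; first by rewrite mulr_ge0 // exprn_ge0 // ltW.
  by rewrite ler_wpM2l ?HL // exprn_ge0 // ltW.
rewrite fexpZ -(@scale_mul_inv R d d4 N N0).
have -> : L * CG * Cs * (K N ^+ d.-1 / N%:R) = L * CG * K N ^+ d.-1 * (Cs / N%:R) by ring.
by rewrite ler_wpM2l // !mulr_ge0 ?exprn_ge0 // ltW.
Unshelve. all: by end_near. Qed.

Lemma step_small N : (0 < N)%N -> 0 <= step N <= (K N)^-1.
Proof.
move=> N0; have KN := @scale_gt0 R d N N0; have K1 := @scale_ge1 R d d4 N N0.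
have Nr : 0 < N%:R :> R by rewrite ltr0n.
rewrite divr_ge0 ?mulr_ge0 ?(ltW KN) ?(ltW q1pos) //= ler_pdivrMr ?mulr_gt0 //.
rewrite ler_pdivlMl // -(@scale_exp R d d4 N) -expr2.
apply: (@le_trans _ _ (K N ^+ d)); last by rewrite ler_peMl // exprn_ge0 // ltW.
by rewrite ler_weXn2l // (leq_trans _ d4).
Qed.

Lemma test_step N y : (0 < N)%N -> exists2 z, `|z - y| <= (K N)^-1 &
  G (y + step N) - G y = dG z * step N.
Proof.
move=> N0; have /andP[s0 s1] := step_small N0.
have [z zy E1] := @dv_MVT R G dG y (y + step N) (fun x _ => dGP x).
exists z; last by rewrite E1 addrAC subrr add0r.
have ys : y <= y + step N by rewrite lerDl.
move: zy; rewrite (min_idPl ys) (max_idPr ys) => /andP[z1 z2].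
by rewrite ger0_norm ?subr_ge0 // (le_trans _ s1) // lerBlDl.
Qed.

Lemma diffusion_small : sml diffusion_error.
Proof.
apply: small_eps => // e e0; exists (fun N X => (1 + kappa p beta) * CdG * deviation X).
  by apply: smallZ => //; exact: deviation_cvg0.
have tb0 := theta_gt0 p beta b0.
have [del del0 Hd] := compact_support_uniform cdG dGM (divr_gt0 e0 tb0).
near=> N => X; have N0 : (0 < N)%N by near: N; exact: near_ge.
have KN := @scale_gt0 R d N N0.
have Kd : (K N)^-1 < del.
  apply: le_lt_trans (_ : del / 2 < del); last by rewrite ltr_pdivrMr // ltr_pMr // ltr1n.
  rewrite -[leLHS]ger0_norm ?invr_ge0 ?(ltW KN) //.
  by near: N; apply: near_small; [rewrite !divr_gt0 | exact: inv_scale_cvg0].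
have [z zy Gz] := test_step (order X) N0.
have k1 : 0 < 1 + kappa p beta by rewrite addr_gt0 // kappa_gt0.
have -> : diffusion_error X = th b * (dG (order X) - dG z) + (th b - field0 (freq X)) * dG z.
  rewrite /diffusion_error Gz.
  have -> : field0 (freq X) * K N ^+ d.-1 * q1 * (dG z * step N) = field0 (freq X) * dG z *
     (K N * (K N ^+ d.-1 / N%:R)).
    by field; rewrite !gt_eqF // ltr0n.
  by rewrite (@scale_mul_inv R d d4 N N0) divff ?gt_eqF //; ring.
have d0 : 0 <= deviation X by exact: sumr_ge0.
rewrite [X in _ <= _ + X]ger0_norm; last by rewrite !mulr_ge0 // ltW.
apply: le_trans (ler_normD _ _) _; apply: lerD.
  rewrite (normrM (th b)) (gtr0_norm tb0) mulrC -ler_pdivlMr //; apply: Hd.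
  by rewrite distrC; exact: le_lt_trans Kd.
by rewrite (normrM (_ - _)) mulrAC; apply: ler_pM => //; exact: field0_dev.
Unshelve. all: by end_near. Qed.

Lemma increment_expansion : exists2 C, 0 < C & \forall N \near \oo, (0 < N)%N /\
  forall r (X : config q N), r != i0 ->
  `|K N ^+ d.-1 * (expR (ee N r X) - 1)
    - t * (p%:R * (freq X 0 r ^+ p.-1 - freq X 0 i0 ^+ p.-1))| <= C * (K N)^-1.
Proof.
pose ec := excess_c p beta; have ec0 : 0 <= ec := excess_c_ge0 p hbeta.
pose C3 := `|t| * p%:R + ec; have C30 : 0 <= C3 by rewrite addr_ge0 ?mulr_ge0.
exists (2 * C3 ^+ 2 + ec + 1); first by rewrite ltr_wpDl // addr_ge0 // mulr_ge0 ?sqr_ge0.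
near=> N.
have [N0 exN] : (0 < N)%N /\ forall k l (X : config q N), k != l ->
  `|excess p beta h (B N) N k l (freq X)
     - tau d t N * (p%:R * (freq X 0 l ^+ p.-1 - freq X 0 k ^+ p.-1))| <= ec / N%:R.
  by near: N; exact: excess_window.
have [_ eeN] : (0 < N)%N /\ forall r (X : config q N), r != i0 ->
  `|ee N r X| <= `|tau d t N| * p%:R + ec / N%:R /\ `|ee N r X| <= 1 / 2.
  by near: N; exact: excess_others.
split => // r X r0.
have KN := @scale_gt0 R d N N0; have K1 := @scale_ge1 R d d4 N N0.
have Kd0 : 0 < K N ^+ d.-1 by rewrite exprn_gt0.
have Nr : 0 < N%:R :> R by rewrite ltr0n.
have [ee1 ee2] := eeN r X r0; have := exN i0 r X; rewrite eq_sym => /(_ r0) ex.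
set w := p%:R * _ in ex *.
have e2 := expR_sub1_bound2 ee2.
have -> : K N ^+ d.-1 * (expR (ee N r X) - 1) - t * w =
    K N ^+ d.-1 * ((expR (ee N r X) - 1 - ee N r X) + (ee N r X - tau d t N * w)).
  have -> : t * w = K N ^+ d.-1 * tau d t N * w by rewrite (@scale_tau R d t N N0).
  by ring.
rewrite normrM (gtr0_norm Kd0).
have eeC : `|ee N r X| <= C3 / K N ^+ d.-1.
  apply: le_trans ee1 _.
  have -> : `|tau d t N| = `|t| / K N ^+ d.-1 by rewrite /tau normrM normfV (gtr0_norm Kd0).
  have -> : C3 / K N ^+ d.-1 = `|t| / K N ^+ d.-1 * p%:R + ec / K N ^+ d.-1 by rewrite /C3; ring.
  rewrite lerD2l ler_wpM2l // lef_pV2 ?posrE // -(@scale_exp R d d4 N).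
  by rewrite ler_weXn2l // leq_pred.
have h1 : K N ^+ d.-1 * (2 * ee N r X ^+ 2) <= 2 * C3 ^+ 2 * (K N)^-1.
  apply: (@le_trans _ _ (K N ^+ d.-1 * (2 * (C3 / K N ^+ d.-1) ^+ 2))).
    rewrite ler_pM2l // ler_pM2l // -[ee N r X ^+ 2]ger0_norm ?sqr_ge0 // normrX.
    by rewrite lerXn2r ?nnegrE ?divr_ge0 // ltW.
  have -> : K N ^+ d.-1 * (2 * (C3 / K N ^+ d.-1) ^+ 2) = 2 * C3 ^+ 2 * (K N ^+ d.-1)^-1.
    by field; rewrite gt_eqF.
  rewrite ler_wpM2l ?mulr_ge0 ?sqr_ge0 // lef_pV2 ?posrE //.
  by rewrite -{1}[K N]expr1 ler_weXn2l //; case: (d) d4 => [|[]].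
have h2 : K N ^+ d.-1 * (ec / N%:R) = ec * (K N)^-1.
  by rewrite -(@scale_mul_inv R d d4 N N0); ring.
apply: le_trans (_ : K N ^+ d.-1 * (2 * ee N r X ^+ 2 + ec / N%:R) <= _).
  by rewrite ler_pM2l //; apply: le_trans (ler_normD _ _) _; exact: lerD.
have -> : (2 * C3 ^+ 2 + ec + 1) * (K N)^-1 = 2 * C3 ^+ 2 * (K N)^-1 + (ec * (K N)^-1 + (K N)^-1).
  by ring.
by rewrite mulrDr h2 lerD // lerDl invr_ge0 ltW.
Unshelve. all: by end_near. Qed.

Lemma field_step (k c0 c f g g' eta u v D e : R) : 0 <= f <= 1 ->
  `|k - f| <= u * D -> `|c0| <= p%:R -> `|c| <= p%:R -> `|c0 - c| <= v * D ->
  `|g| <= CG -> `|g'| <= CG -> `|g - g'| <= CdG * e -> `|eta| <= v * e ->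
  `|k * (t * c0) * g - f * (t * c + eta) * g'| <=
    `|t| * (u * p%:R * CG + v * CG) * D + (`|t| * p%:R * CdG + v * CG) * e.
Proof.
move=> /andP[f0 f1] hk hc0 hc hcc hg hg' hgg heta.
have -> : k * (t * c0) * g - f * (t * c + eta) * g' =
  t * ((k - f) * c0 * g) + t * (f * (c0 - c) * g) + t * (f * c * (g - g')) - f * eta * g' by ring.
have fn : `|f| <= 1 by rewrite ger0_norm.
have p0 : 0 <= p%:R :> R by [].
have b1 : `|(k - f) * c0 * g| <= u * D * p%:R * CG.
  by rewrite !normrM; apply: ler_pM => //; rewrite ?mulr_ge0 //; apply: ler_pM.
have b2 : `|f * (c0 - c) * g| <= v * D * CG.
  rewrite !normrM; apply: ler_pM => //; rewrite ?mulr_ge0 //.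
  by apply: le_trans hcc; rewrite ler_piMl.
have b3 : `|f * c * (g - g')| <= p%:R * (CdG * e).
  rewrite !normrM; apply: ler_pM => //; rewrite ?mulr_ge0 //.
  by apply: le_trans hc; rewrite ler_piMl.
have b4 : `|f * eta * g'| <= v * e * CG.
  rewrite !normrM; apply: ler_pM => //; rewrite ?mulr_ge0 //.
  by apply: le_trans heta; rewrite ler_piMl.
apply: le_trans (ler_normB _ _) _; apply: le_trans (lerD (ler_normD _ _) b4) _.
apply: le_trans (lerD (lerD (ler_normD _ _) (lexx _)) (lexx _)) _.
rewrite !(normrM t).
have B1 := ler_wpM2l (normr_ge0 t) b1; have B2 := ler_wpM2l (normr_ge0 t) b2.
have B3 := ler_wpM2l (normr_ge0 t) b3.
apply: le_trans (lerD (lerD (lerD B1 B2) B3) (lexx _)) _.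
by rewrite le_eqVlt; apply/orP; left; apply/eqP; ring.
Qed.

Lemma field_small : sml field_error.
Proof.
have [C C0 HC] := increment_expansion.
have k1 : 0 < 1 + kappa p beta by rewrite addr_gt0 // kappa_gt0.
pose v := 2 * (p%:R * p%:R) + C.
have p0 : 0 <= p%:R :> R by [].
have v0 : 0 <= v by rewrite addr_ge0 ?mulr_ge0 // ltW.
pose A := q1 * (`|t| * ((1 + kappa p beta) * p%:R * CG + v * CG)).
pose A' := q1 * (`|t| * p%:R * CdG + v * CG).
apply: (@small_le _ _ _ hP _ (fun N X => A * deviation X + A' * (K N)^-1)).
  apply: smallD => //; first by apply: smallZ => //; exact: deviation_cvg0.
  apply: small_seq => //; rewrite -[X in _ --> X](mulr0 A'); apply: cvgMr; exact: inv_scale_cvg0.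
near=> N => X.
have [N0 HN] : (0 < N)%N /\ forall r (X : config q N), r != i0 ->
  `|K N ^+ d.-1 * (expR (ee N r X) - 1)
    - t * (p%:R * (freq X 0 r ^+ p.-1 - freq X 0 i0 ^+ p.-1))| <= C * (K N)^-1.
  by near: N; exact: HC.
have KN := @scale_gt0 R d N N0.
have pz : prob_vec (freq X : 'rV[R]_q) by exact: freq_prob_vec.
have d0 : 0 <= deviation X by exact: sumr_ge0.
have Ki : 0 <= (K N)^-1 by rewrite invr_ge0 ltW.
have mu := fun r => coord_unit r (xvec_prob hq sint).
have au : 0 <= a <= 1 by have := mu i0; rewrite xvecE.
apply: le_trans (ler_norm _).
have gg : `|G (order X) - G (order X + step N)| <= CdG * (K N)^-1.
  have [z _ Gz] := test_step (order X) N0; rewrite distrC Gz normrM.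
  by apply: ler_pM => //; have /andP[s0 s1] := step_small N0; rewrite ger0_norm.
have pw (x y : R) : 0 <= x <= 1 -> 0 <= y <= 1 -> `|p%:R * (x ^+ p.-1 - y ^+ p.-1)| <= p%:R.
  by move=> xu yu; rewrite normrM normr_nat ler_piMr //; apply: unit_dist; exact: unit_expr.
have term r : r != i0 ->
  `|th b * (t * (p%:R * (b ^+ p.-1 - a ^+ p.-1))) * G (order X) - field0 (freq X) *
     (K N ^+ d.-1 * (expR (ee N r X) - 1)) * G (order X + step N)| <=
    `|t| * ((1 + kappa p beta) * p%:R * CG + v * CG) * deviation X +
    (`|t| * p%:R * CdG + v * CG) * (K N)^-1.
  move=> r0; pose w : R := p%:R * (freq X 0 r ^+ p.-1 - freq X 0 i0 ^+ p.-1).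
  have rn : (r == 0 :> nat) = false by move: r0; rewrite neq_colour0 => /negbTE.
  have bu : 0 <= b <= 1 by have := mu r; rewrite xvecE rn.
  rewrite -[K N ^+ d.-1 * (expR (ee N r X) - 1)](subrKC (t * w)).
  apply: field_step => //; first exact: field0_unit.
  - exact: field0_dev.
  - exact: pw.
  - by apply: pw; exact: coord_unit.
  - have -> : p%:R * (b ^+ p.-1 - a ^+ p.-1) - w =
       p%:R * ((b ^+ p.-1 - freq X 0 r ^+ p.-1) - (a ^+ p.-1 - freq X 0 i0 ^+ p.-1)).
      by rewrite /w; ring.
    rewrite normrM normr_nat /v mulrDl; apply: ler_wpDr; first by rewrite mulr_ge0 // ltW.
    have -> : 2 * (p%:R * p%:R) * deviation X = p%:R * (p%:R * deviation X + p%:R * deviation X) by ring.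
    rewrite ler_wpM2l //; apply: le_trans (ler_normB _ _) _.
    have pwl (x y : R) : 0 <= x <= 1 -> 0 <= y <= 1 -> `|x - y| <= deviation X ->
       `|x ^+ p.-1 - y ^+ p.-1| <= p%:R * deviation X.
      move=> xu yu xy; apply: le_trans (expr_lipschitz _ xu yu) _.
      by apply: ler_pM => //; rewrite ler_nat leq_pred.
    apply: lerD; apply: pwl => //; try exact: coord_unit.
      by rewrite distrC; have := deviation_ge X r; rewrite xvecE rn.
    by rewrite distrC; have := deviation_ge X i0; rewrite xvecE.
  - by apply: le_trans (HN r X r0) _; rewrite ler_wpM2r // /v lerDr mulr_ge0.
have -> : field_error X = \sum_(r | r != i0)
  (th b * (t * (p%:R * (b ^+ p.-1 - a ^+ p.-1))) * G (order X) - field0 (freq X) *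
     (K N ^+ d.-1 * (expR (ee N r X) - 1)) * G (order X + step N)).
  rewrite sumrB (sum_others hq) -mulr_suml -mulr_sumr -mulr_sumr /field_error /field_coef.
  ring.
apply: le_trans (ler_norm_sum _ _ _) _; apply: le_trans (ler_sum _ term) _.
by rewrite (sum_others hq) /A /A' le_eqVlt; apply/orP; left; apply/eqP; ring.
Unshelve. all: by end_near. Qed.

(** [FA] and [FB] have the same mean by [balance], and the remaining difference is the
    combination of the four errors. *)
Lemma stein_test : E N (fun X => dG (order X) -
    (q1 * lam / d%:R * (d%:R * order X ^+ d.-1) - t * field_coef) * G (order X))
  @[N --> \oo] --> (0 : R).
Proof.
have tb0 := theta_gt0 p beta b0; have dn0 : d%:R != 0 :> R by rewrite pnatr_eq0 -lt0n.
have H : sml (fun N X => (th b)^-1 * ((diffusion_error X + field_error X) -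
     (drift_error X + spread_error X))).
  apply: smallZ => //; apply: smallB => //; apply: smallD => //.
  - exact: diffusion_small.
  - exact: field_small.
  - exact: drift_small.
  - exact: spread_small.
apply: cvg_trans (small_cvg hP H); apply: near_eq_cvg; near=> N.
have N0 : (0 < N)%N by near: N; exact: near_ge.
have KN := @scale_gt0 R d N N0.
have := balance p beta h s d t hq (fun y => G (K N * y)) N0 => bal.
apply/eqP; rewrite -subr_eq0 -(fexpB (P N)); apply/eqP.
pose FA (X : config q N) := expR (- h) * th (freq X 0 i0) *
  (\sum_(r | r != i0) expR (ee N r X)) * G (K N * (xi (freq X) + (q1 * N%:R)^-1)).
pose FB (X : config q N) := (\sum_(r | r != i0) th (freq X 0 r)) * G (K N * xi (freq X)).
transitivity (E N (fun X => - ((th b)^-1 * K N ^+ d.-1) * (FA X - FB X))); last first.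
  by rewrite (fexpZ (P N)) (fexpB (P N)) [X in X - _]bal subrr mulr0.
congr fexp; apply/funext => X.
rewrite /diffusion_error /field_error /drift_error /spread_error /FA /FB drift_xi.
rewrite -/(field0 (freq X)) -/(order X).
have -> : K N * (xi (freq X) + (q1 * N%:R)^-1) = order X + step N by rewrite /order; ring.
have -> : \sum_(r | r != i0) (expR (ee N r X) - 1) = \sum_(r | r != i0) expR (ee N r X) - q1.
  by rewrite sumrB (sum_others hq) mulr1.
by field; rewrite dn0 gt_eqF.
Unshelve. all: by end_near. Qed.

End test_function.

Theorem stein_order (G dG : R -> R) M :
  (forall y : R, is_derive y (1 : R) G (dG y)) -> continuous dG -> vanishes_beyond M G ->
  E N (fun X => dG (order X) -
    (q1 * lam / d%:R * (d%:R * order X ^+ d.-1) - t * field_coef) * G (order X))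
  @[N --> \oo] --> (0 : R).
Proof.
move=> dGP cdG GM; have dGM := derivative_vanishes dGP GM.
have cG : continuous G by move=> y; exact: dv_continuous (dGP y).
have [CG CG0 GC] := compact_support_bounded cG GM.
have [CdG CdG0 dGC] := compact_support_bounded cdG dGM.
have M1 : 0 < `|M| + 1 by rewrite ltr_wpDl.
have ML : M <= `|M| + 1 by rewrite (le_trans (ler_norm M)) // lerDl.
have ML1 : M + 1 <= `|M| + 1 by rewrite lerD2r ler_norm.
apply: (@stein_test G dG (`|M| + 1) CG CdG) => // y yM; [apply: GM | apply: dGM].
  exact: le_trans yM.
exact: le_trans yM.
Qed.

End stein.

(** * Fluctuations of the power sum *)

Lemma abs_growth (R : realType) (y : R) : `|y| <= 1 + y ^+ 2.
Proof.
rewrite -(real_normK (num_real y)); have := sqr_ge0 (`|y| - 1); have := normr_ge0 y; lra.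
Qed.

Section observables.
Context {R : realType}.
Variables (p q : nat) (beta h s : R) (d : nat) (lam : R).
Hypotheses (hp : (2 <= p)%N) (hq : (2 <= q)%N) (hbeta : 0 < beta) (hh : 0 <= h).
Hypothesis hspecial : special p q beta h s.
Hypotheses (od : ~~ odd d) (d4 : (4 <= d)%N) (lam0 : 0 < lam).

Local Notation mu := (@lebesgue_measure R).
Local Notation q1 := (q%:R - 1 : R).
Local Notation a := (vtop q s).
Local Notation b := (vbot q s).
Local Notation th := (theta p beta).
Local Notation K := (@scale R d).
Local Notation m := (xvec q s).
Local Notation P t N := (@window_law R p q beta h d t N).
Local Notation E t N Z := (fexp (P t N) Z).
Local Notation i0 := (colour0 hq).
Local Notation xi := (xi s hq).
Local Notation spread := (spread s hq).
Local Notation order := (order s d hq).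
Local Notation drift := (drift p q beta h s).
Local Notation sml t := (@small R (fun N => config q N) (fun N => P t N)).
Local Notation fc := (field_coef p q s).
Local Notation c := (q1 * lam / d%:R).

Hypothesis hdrift : asym drift (- (th b * lam)) d.-1.
Hypothesis hconvex : (2 < q)%N -> kappa p beta * b ^+ p.-1 < 1.

Let hP t N : is_dist (P t N). Proof. exact: window_dist. Qed.
Let q11 := @q1_ge1 R q hq.
Let q1pos : 0 < q1. Proof. exact: lt_le_trans q11. Qed.
Let sint := special_interior hq hspecial.
Let dpos : (0 < d)%N. Proof. by apply: leq_trans d4. Qed.

Lemma stein_const_gt0 : 0 < c.
Proof. by rewrite divr_gt0 ?mulr_gt0 // ltr0n. Qed.
Local Notation c0 := stein_const_gt0.

Lemma pow4_le (y : R) : y ^+ 4 <= 1 + y ^+ d.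
Proof.
have y0 : 0 <= y ^+ d by rewrite exprn_even_ge0.
have E4 (n : nat) : ~~ odd n -> y ^+ n = `|y| ^+ n.
  by move=> on; rewrite -normrX ger0_norm // exprn_even_ge0.
rewrite E4 // (E4 d) //; have [y1|y1] := leP `|y| 1.
  by apply: (@le_trans _ _ 1); [rewrite exprn_ile1 | rewrite lerDl exprn_ge0].
apply: (@le_trans _ _ (`|y| ^+ d)); last by rewrite lerDr.
by rewrite ler_weXn2l // ltW.
Qed.

Lemma order_cvg t (F : R -> R) C : continuous F -> (forall y, `|F y| <= C * (1 + y ^+ 2)) ->
  E t N (fun X => F (order X)) @[N --> \oo] -->
    (\int[mu]_y (F y * edens c (t * fc) d y)) / \int[mu]_y edens c (t * fc) d y.
Proof.
have [C4 HC4] := moment_bound t hp hq hbeta hh hspecial od d4 lam0 hdrift hconvex.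
apply: (@stein_cvg R (fun N => config q N) (fun N => P t N) (fun N X => order X) (hP t)
  c (t * fc) d c0 od d4 _ (1 + C4)).
  by move=> G dG M dGP cdG GM; exact: (stein_order t hp hq hbeta hh hspecial d4 hdrift hconvex dGP cdG GM).
apply: filterS HC4 => N HN.
apply: le_trans (_ : 1 + E t N (fun X => order X ^+ d) <= _); last by rewrite lerD2l.
have -> : 1 + E t N (fun X => order X ^+ d) = E t N (fun X => 1 + order X ^+ d).
  by rewrite (fexpD (P t N) (fun=> 1)) (fexp_cst (hP t N)).
apply: (le_fexp (hP t N)) => X.
exact: pow4_le.
Qed.

Definition obs N (X : config q N) : R := pnormp p (freq X) - pnormp p m.

Lemma dist2_xi z : prob_vec z -> dist2 z m = spread z + (q1 ^+ 2 + q1) * xi z ^+ 2.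
Proof.
move=> pz; have sd := sum_deviation s hq pz.
rewrite /dist2 (bigD1 i0) //= xvecE /= -(top_xi s hq z).
have -> : \sum_(r < q | r != i0) (z 0 r - m 0 r) ^+ 2 =
   \sum_(r | r != i0) ((z 0 r - (b + xi z)) ^+ 2 + 2 * xi z * (z 0 r - (b + xi z)) + xi z ^+ 2).
  apply: eq_bigr => r; rewrite neq_colour0 xvecE => /negbTE ->; ring.
rewrite big_split big_split /= -mulr_sumr sd mulr0 (sum_others hq) /spread; ring.
Qed.

Lemma obs_linear N (X : config q N) : (0 < N)%N ->
  `|obs X - fc * xi (freq X)| <= 2 ^+ p * dist2 (freq X) m.
Proof.
move=> N0; have pz : prob_vec (freq X : 'rV[R]_q) by exact: freq_prob_vec.
have sd := sum_deviation s hq pz.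
set z := freq X in pz sd *.
have -> : obs X - fc * xi z = \sum_r (z 0 r ^+ p - m 0 r ^+ p
   - (z 0 r - m 0 r) * (p%:R * m 0 r ^+ p.-1)).
  rewrite sumrB sumrB /obs /pnormp -/z; congr (_ - _).
  rewrite (bigD1 i0) //= xvecE /= -(top_xi s hq z).
  have -> : \sum_(r < q | r != i0) (z 0 r - m 0 r) * (p%:R * m 0 r ^+ p.-1) =
     \sum_(r | r != i0) ((z 0 r - (b + xi z)) * (p%:R * b ^+ p.-1) + xi z * (p%:R * b ^+ p.-1)).
    apply: eq_bigr => r; rewrite neq_colour0 xvecE => /negbTE ->; ring.
  rewrite big_split /= -mulr_suml sd mul0r add0r (sum_others hq) /field_coef; ring.
apply: le_trans (ler_norm_sum _ _ _) _; rewrite /dist2 mulr_sumr; apply: ler_sum => r _.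
have mu := coord_unit r (xvec_prob hq sint); have zu := coord_unit r pz.
have := @expr_increment2 R p (m 0 r) (z 0 r - m 0 r).
rewrite [m 0 r + _]addrC subrK; apply.
  by rewrite ger0_norm; case/andP: mu.
by rewrite ger0_norm; case/andP: zu => // z0 z1; rewrite (le_trans z1) // ler1n.
Qed.

Lemma square_small t : sml t (fun N X => K N * dist2 (freq X) m).
Proof.
have [Cs Cs0 Hs] := spread_rare t hp hq hbeta hspecial d4 hconvex.
have sq (y : R) : `|y ^+ 2| <= 1 * (1 + y ^+ 2) by rewrite mul1r ger0_norm ?sqr_ge0 // lerDr.
have Hx := @order_cvg t _ _ (@ctX R 2) sq.
set L := _ / _ in Hx.
apply: (small_of_bound (hP t) (u := fun N => Cs * (K N)^-1 +
   (q1 ^+ 2 + q1) * ((K N)^-1 * E t N (fun X => order X ^+ 2)))).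
  have i0 := @inv_scale_cvg0 R d d4.
  rewrite -[X in _ --> X]addr0 -[X in _ --> X + _](mulr0 Cs) -[X in _ --> _ + X](mulr0 (q1 ^+ 2 + q1)).
  by apply: cvgD; apply: cvgMr => //; rewrite -[X in _ --> X](mul0r L); apply: cvgM.
near=> N; have N0 : (0 < N)%N by near: N; exact: near_ge.
have KN := @scale_gt0 R d N N0; have K1 := @scale_ge1 R d d4 N N0.
have hs : E t N (fun X => spread (freq X)) <= Cs / N%:R by near: N; exact: Hs.
have -> : E t N (fun X => `|K N * dist2 (freq X) m|) =
   K N * E t N (fun X => spread (freq X)) + (q1 ^+ 2 + q1) * ((K N)^-1 * E t N (fun X => order X ^+ 2)).
  rewrite -!(fexpZ (P t N)) -(fexpD (P t N)); congr fexp; apply/funext => X.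
  rewrite dist2_xi; last exact: freq_prob_vec.
  rewrite ger0_norm.
    by rewrite /order; field; rewrite gt_eqF.
  rewrite mulr_ge0 ?(ltW KN) // addr_ge0 ?spread_ge0 // mulr_ge0 ?sqr_ge0 //.
  by rewrite addr_ge0 ?sqr_ge0 // ltW.
rewrite lerD2r; apply: (@le_trans _ _ (K N * (Cs / N%:R))); first by rewrite ler_pM2l.
rewrite mulrCA ler_pM2l // -(@scale_mul_inv R d d4 N N0) ler_pM2r ?invr_gt0 ?ltr0n //.
by rewrite -{1}[K N]expr1 ler_weXn2l //; case: (d) d4 => [|[]].
Unshelve. all: by end_near. Qed.

Lemma linear_small t : sml t (fun N X => K N * obs X - fc * order X).
Proof.
apply: (@small_le _ _ _ (hP t) _ (fun N X => 2 ^+ p * (K N * dist2 (freq X) m))).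
  by apply: smallZ; [exact: hP | exact: square_small].
near=> N => X; have N0 : (0 < N)%N by near: N; exact: near_ge.
have KN := @scale_gt0 R d N N0.
have -> : K N * obs X - fc * order X = K N * (obs X - fc * xi (freq X)).
  by rewrite /order; ring.
have dd : 0 <= dist2 (freq X) m by apply: sumr_ge0 => r _; exact: sqr_ge0.
rewrite normrM (gtr0_norm KN) [X in _ <= X]ger0_norm; last first.
  by rewrite mulr_ge0 ?exprn_ge0 // mulr_ge0 // ltW.
by rewrite [leRHS]mulrCA ler_pM2l //; exact: obs_linear.
Unshelve. all: by end_near. Qed.

Lemma fexp_limit t (v : forall N, config q N -> R) (f : R -> R) C : continuous f ->
  (forall y, `|f y| <= C * (1 + y ^+ 2)) -> sml t (fun N X => v N X - f (order X)) ->
  E t N (v N) @[N --> \oo] -->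
    (\int[mu]_y (f y * edens c (t * fc) d y)) / \int[mu]_y edens c (t * fc) d y.
Proof.
move=> cf fC vf; set L := _ / _.
have -> : (fun N => E t N (v N)) = (fun N => E t N (fun X => v N X - f (order X)) +
    E t N (fun X => f (order X))).
  apply/funext => N; rewrite -(fexpD (P t N)); congr fexp.
  by apply/funext => X; rewrite subrK.
rewrite -[L]add0r; apply: cvgD; first exact: (small_cvg (hP t) vf).
exact: (@order_cvg t _ _ cf fC).
Qed.

(** The slope is negative, so that [fc * y <= fc * emean] is a lower bound on [y], turned
    into a distribution function by the evenness of the density. *)
Lemma linear_limit t : fc < 0 ->
  fexp (P 0 N) (fun X => (K N * obs X <= E t N (fun Y => K N * obs Y))%R%:R) @[N --> \oo] -->
  ecdf c d 0 (- emean c d (t * fc)).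
Proof.
move=> fc0; pose f y := fc * y.
have cf : continuous f by apply: ctM; [exact: ct_cst | exact: ct_id].
have fC y : `|f y| <= `|fc| * (1 + y ^+ 2).
  by rewrite normrM ler_wpM2l // abs_growth.
have HM := fexp_limit cf fC (linear_small t).
have ME : (\int[mu]_y (f y * edens c (t * fc) d y)) / \int[mu]_y edens c (t * fc) d y =
    fc * emean c d (t * fc).
  rewrite /emean [RHS]mulrA; congr (_ / _); rewrite -RintegralZl //.
    by apply: eq_Rintegral => y _; rewrite /f mulrA.
  have yC (y : R) : `|y| <= 1 * (1 + y ^+ 2) by rewrite mul1r abs_growth.
  exact: (integrable_growth2 (t * fc) c0 od d4 (@ct_id R) yC).
rewrite ME in HM.
have fM : mu [set y | f y = fc * emean c d (t * fc)] = 0%E.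
  have -> : [set y | f y = fc * emean c d (t * fc)] = [set emean c d (t * fc)].
    apply/seteqP; split => y /=; last by move=> ->.
    by apply: mulfI; rewrite lt_eqF.
  by rewrite lebesgue_measure_set1.
have H0 := @order_cvg 0; rewrite mul0r in H0.
have V0 := linear_small 0.
have := cdf_cvg c0 od d4 cf fM (hP 0) H0 V0 HM.
have -> : [set y | f y <= fc * emean c d (t * fc)] = [set y | emean c d (t * fc) <= y].
  by apply/seteqP; split => y /=; rewrite /f ler_nM2l.
by rewrite (ecdf_reflect c0 od d4).
Qed.

(** At the centre the statistic is even in the order parameter; half of the second
    derivative of [(1/2 - x) ^+ p + (1/2 + x) ^+ p] is 2 for [p = 2], and 3 for [p = 3] and
    [p = 4]. *)
Definition obs_curvature : R := if p == 2%N then 2 else 3.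

Lemma obs_quadratic N (X : config q N) : s = 0 -> q = 2%N -> (p < 5)%N -> (0 < N)%N ->
  `|obs X - obs_curvature * xi (freq X) ^+ 2| <= 2 * xi (freq X) ^+ 4.
Proof.
move=> s0 q2 p5 N0; have pz : prob_vec (freq X : 'rV[R]_q) by exact: freq_prob_vec.
have [q1E [aE bE]] := special_centre_half hp hq hbeta hspecial s0.
set z := freq X in pz *; set x := xi z.
have x4 : 0 <= x ^+ 4 by rewrite exprn_even_ge0.
have sumE (v : 'rV[R]_q) B : (forall r, r != i0 -> v 0 r = B) -> pnormp p v = v 0 i0 ^+ p + B ^+ p.
  move=> vB; rewrite /pnormp (bigD1 i0) //=; congr (_ + _).
  transitivity (\sum_(r < q | r != i0) B ^+ p); first by apply: eq_bigr => r /vB ->.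
  by rewrite (sum_others hq) q1E mul1r.
have -> : obs X = (1/2 - x) ^+ p + (1/2 + x) ^+ p - ((1/2) ^+ p + (1/2) ^+ p).
  rewrite /obs -/z (sumE z (1/2 + x)) ?(sumE m (1/2)).
  - have -> : m 0 i0 = 1/2 by rewrite xvecE.
    by have -> : z 0 i0 = 1/2 - x by rewrite -(top_xi s hq z) -/x aE q1E; ring.
  - by move=> r; rewrite neq_colour0 xvecE => /negbTE ->.
  move=> r r0; have := sum_deviation s hq pz; rewrite (bigD1 r) //= big1 ?addr0.
    by rewrite -/x bE => /eqP; rewrite subr_eq0 => /eqP.
  move=> r' /andP[r'0 r'r]; exfalso; move: r'r; apply/negP; rewrite negbK -val_eqE /=.
  move: r0 r'0; rewrite !neq_colour0; have := ltn_ord r; have := ltn_ord r'; rewrite {2 4}q2.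
  by case: (r : nat) => [|[|?]] //; case: (r' : nat) => [|[|?]].
rewrite /obs_curvature; move: p5 hp; case: (p) => [|[|[|[|[|//]]]]] //= _ _; rewrite ?eqxx /=.
- have -> : (1/2 - x) ^+ 2 + (1/2 + x) ^+ 2 - ((1/2) ^+ 2 + (1/2) ^+ 2) - 2 * x ^+ 2 = 0 by field.
  by rewrite normr0 mulr_ge0.
- have -> : (1/2 - x) ^+ 3 + (1/2 + x) ^+ 3 - ((1/2) ^+ 3 + (1/2) ^+ 3) - 3 * x ^+ 2 = 0 by field.
  by rewrite normr0 mulr_ge0.
have -> : (1/2 - x) ^+ 4 + (1/2 + x) ^+ 4 - ((1/2) ^+ 4 + (1/2) ^+ 4) - 3 * x ^+ 2 = 2 * x ^+ 4.
  by field.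
by rewrite ger0_norm // mulr_ge0.
Qed.

Lemma quadratic_small t : s = 0 -> q = 2%N -> (p < 5)%N ->
  sml t (fun N X => K N ^+ 2 * obs X - obs_curvature * order X ^+ 2).
Proof.
move=> s0 q2 p5.
have [C HC] := moment_bound t hp hq hbeta hh hspecial od d4 lam0 hdrift hconvex.
apply: (small_of_bound (hP t) (u := fun N => 2 * (1 + C) * (K N)^-1 ^+ 2)).
  rewrite -[X in _ --> X](mulr0 (2 * (1 + C))); apply: cvgMr; exact: inv_scaleX_cvg0.
near=> N; have N0 : (0 < N)%N by near: N; exact: near_ge.
have KN := @scale_gt0 R d N N0.
have hC : E t N (fun X => order X ^+ d) <= C by near: N; exact: HC.
apply: (@le_trans _ _ (E t N (fun X => 2 * (K N)^-1 ^+ 2 * (1 + order X ^+ d)))).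
  apply: (le_fexp (hP t N)) => X.
  have -> : K N ^+ 2 * obs X - obs_curvature * order X ^+ 2 =
     K N ^+ 2 * (obs X - obs_curvature * xi (freq X) ^+ 2) by rewrite /order; ring.
  rewrite normrM ger0_norm ?sqr_ge0 //.
  apply: (@le_trans _ _ (K N ^+ 2 * (2 * xi (freq X) ^+ 4))).
    by rewrite ler_wpM2l ?sqr_ge0 //; exact: obs_quadratic.
  have -> : K N ^+ 2 * (2 * xi (freq X) ^+ 4) = 2 * (K N)^-1 ^+ 2 * order X ^+ 4.
    by rewrite /order; field; rewrite gt_eqF.
  apply: ler_wpM2l; last exact: pow4_le.
  by apply: mulr_ge0 => //; exact: sqr_ge0.
rewrite (fexpZ (P t N)) (fexpD (P t N) (fun=> 1)) (fexp_cst (hP t N)).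
have -> : 2 * (1 + C) * (K N)^-1 ^+ 2 = 2 * (K N)^-1 ^+ 2 * (1 + C) by ring.
apply: ler_wpM2l; last by rewrite lerD2l.
by apply: mulr_ge0 => //; exact: sqr_ge0.
Unshelve. all: by end_near. Qed.

(** At the centre [fc = 0], so the limit does not depend on [t]. *)
Lemma quadratic_limit t : s = 0 -> q = 2%N -> (p < 5)%N ->
  fexp (P 0 N) (fun X => (K N ^+ 2 * obs X <= E t N (fun Y => K N ^+ 2 * obs Y))%R%:R)
  @[N --> \oo] -->
  (\int[mu]_(y in [set y : R | y ^+ 2 <= (\int[mu]_y (y ^+ 2 * edens c 0 d y)) /
      \int[mu]_y edens c 0 d y]) edens c 0 d y) / \int[mu]_y edens c 0 d y.
Proof.
move=> s0 q2 p5.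
pose m2 := (\int[mu]_y (y ^+ 2 * edens c 0 d y)) / \int[mu]_y edens c 0 d y.
rewrite -/m2; have fc0 : fc = 0.
  by rewrite /field_coef (vbot_eq hq s0) subrr !mulr0.
pose f y := obs_curvature * y ^+ 2.
have k0 : 0 < obs_curvature by rewrite /obs_curvature; case: ifP.
have cf : continuous f by apply: ctM; [exact: ct_cst | exact: ctX].
have fC y : `|f y| <= obs_curvature * (1 + y ^+ 2).
  by rewrite /f normrM (gtr0_norm k0) ler_pM2l // ger0_norm ?sqr_ge0 // lerDr.
have HM := fexp_limit cf fC (quadratic_small t s0 q2 p5).
have ME : (\int[mu]_y (f y * edens c (t * fc) d y)) / \int[mu]_y edens c (t * fc) d y =
    obs_curvature * m2.
  rewrite fc0 mulr0 /m2 [RHS]mulrA; congr (_ / _); rewrite -RintegralZl //.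
    by apply: eq_Rintegral => y _; rewrite /f mulrA.
  have yC (y : R) : `|y ^+ 2| <= 1 * (1 + y ^+ 2).
    by rewrite mul1r ger0_norm ?sqr_ge0 // lerDr.
  exact: (integrable_growth2 0 c0 od d4 (@ctX R 2) yC).
rewrite ME in HM.
have fM : mu [set y | f y = obs_curvature * m2] = 0%E.
  apply: countable_lebesgue_measure0; apply: finite_set_countable.
  apply: (@sub_finite_set _ _ [set Num.sqrt m2; - Num.sqrt m2]); last first.
    by rewrite finite_setU; split; exact: finite_set1.
  move=> y /= /(mulfI (lt0r_neq0 k0)) yE; rewrite -yE sqrtr_sqr.
  by have [y0|y0] := leP 0 y; [left; rewrite ger0_norm | right; rewrite ltr0_norm ?opprK].
have H0 := @order_cvg 0; rewrite mul0r in H0.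
have V0 := quadratic_small 0 s0 q2 p5.
have := cdf_cvg c0 od d4 cf fM (hP 0) H0 V0 HM.
have -> // : [set y | f y <= obs_curvature * m2] = [set y | y ^+ 2 <= m2].
by apply/seteqP; split => y /=; rewrite /f ler_pM2l.
Qed.

End observables.

(** * The distribution of the estimator *)

Section estimator.
Context {R : realType}.
Variables (p q : nat) (beta h s : R) (d : nat) (lam : R).
Hypotheses (hp : (2 <= p)%N) (hq : (2 <= q)%N) (hbeta : 0 < beta) (hh : 0 <= h).
Hypothesis hspecial : special p q beta h s.
Hypotheses (od : ~~ odd d) (d4 : (4 <= d)%N) (lam0 : 0 < lam).
Variable betahat : forall N : nat, config q N -> \bar R.
Hypothesis hmle : forall (N : nat) (X : config q N), (0 < N)%N -> is_mle p h X (betahat X).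
Hypothesis hdrift : asym (drift p q beta h s) (- (theta p beta (vbot q s) * lam)) d.-1.

Local Notation q1 := (q%:R - 1 : R).
Local Notation K := (@scale R d).
Local Notation P t N := (@window_law R p q beta h d t N).
Local Notation E t N Z := (fexp (P t N) Z).
Local Notation c := (q1 * lam / d%:R).
Local Notation expo := (d.-1%:R / d%:R : R).
Local Notation Y := (scaled_error expo beta betahat).

Let hconvex : (2 < q)%N -> kappa p beta * vbot q s ^+ p.-1 < 1.
Proof.
move=> q3; apply: (special_vbot_convex hp hq hbeta hspecial).
rewrite lt_neqAle (special_s_ge0 hspecial) andbT eq_sym; apply/eqP => s0.
by move: q3; rewrite (special_centre hp hq hbeta hspecial s0).
Qed.

Lemma scale_expo N : N%:R `^ expo = K N ^+ d.-1.
Proof. by rewrite /scale -powR_mulrn ?powR_ge0 // -powRrM mulrC. Qed.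

Lemma ereal_affine_le (k b t : R) (y : \bar R) : 0 < k ->
  (k%:E * (y - b%:E) <= t%:E)%E = (y <= (b + t / k)%:E)%E.
Proof.
move=> k0; case: y => [r| |] /=.
- by rewrite -EFinB -EFinM !lee_fin mulrC -ler_pdivlMr // lerBlDl.
- by rewrite addye // gt0_muley ?lte_fin // !leye_eq.
- by rewrite gt0_muleNy ?lte_fin // !leNye.
Qed.

(** The likelihood is an exponential family, so the estimator is below a candidate value
    iff the sample value of the sufficient statistic is below its mean there. *)
Lemma estimator_event (k t : R) N (X : config q N) : 0 < k -> (2 <= N)%N ->
  (Y X <= t%:E)%E = (k * obs p s X <= E t N (fun Z => k * obs p s Z)).
Proof.
move=> k0 N2; have N0 : (0 < N)%N by apply: ltnW.
have KN : 0 < K N ^+ d.-1 by rewrite exprn_gt0 // scale_gt0.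
rewrite /scaled_error scale_expo ereal_affine_le //.
have -> : (betahat X <= (beta + t / K N ^+ d.-1)%:E)%E =
   (pnormp p (freq X) <= E t N (fun Z => pnormp p (freq Z))).
  exact: (mle_le_iff hp hq _ N2 (hmle X N0)).
have hP : is_dist (P t N) by exact: window_dist.
rewrite (fexpZ (P t N)) ler_pM2l // /obs (fexpB (P t N) _ (fun=> _)) (fexp_cst hP).
by rewrite lerD2r.
Qed.

Lemma window_law0 N : P 0 N = @potts R p q beta h N.
Proof. by rewrite /window_law /window /tau mul0r addr0. Qed.

Lemma estimator_cdf (k : nat -> R) (t L : R) : (forall N, (0 < N)%N -> 0 < k N) ->
  fexp (P 0 N) (fun X => (k N * obs p s X <= E t N (fun Z => k N * obs p s Z))%R%:R)
    @[N --> \oo] --> L ->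
  fexp (@potts R p q beta h N) (fun X => (Y X <= t%:E)%E%:R) @[N --> \oo] --> L.
Proof.
move=> k0; apply: cvg_trans; apply: near_eq_cvg; near=> N.
have N2 : (2 <= N)%N by near: N; exact: near_ge.
rewrite window_law0; congr fexp; apply/funext => X.
by rewrite (estimator_event _ _ (k0 N (ltnW N2)) N2).
Unshelve. all: by end_near. Qed.

Section limit_law.
Variable g : R -> R.
Hypothesis gE : g = edens c 0 d.

Let c0 : 0 < c. Proof. exact: stein_const_gt0. Qed.
Let g0 x : 0 <= g x. Proof. by rewrite gE; exact: edens_ge0. Qed.
Let gi : (@lebesgue_measure R).-integrable setT (EFin \o g).
Proof. by rewrite gE; exact: integrable_edens1. Qed.
Let gpos : 0 < Rintegral (@lebesgue_measure R) setT g.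
Proof. by rewrite gE; exact: Rintegral_edens_gt0. Qed.

Lemma measurable_sqr_le (r : R) : measurable [set x : measurableTypeR R | (x : R) ^+ 2 <= r].
Proof.
have -> : [set x : measurableTypeR R | (x : R) ^+ 2 <= r] = (fun x : R => x ^+ 2) @^-1` `]-oo, r]%classic.
  by apply/seteqP; split => y /=; rewrite in_itv.
by rewrite -[X in measurable X]setTI; apply: (measurable_ct (@ctX R 2)).
Qed.

Lemma prob_sqr_le_meanE : prob_sqr_le_mean (law_of_density g) =
  Rintegral (@lebesgue_measure R)
    [set y : R | y ^+ 2 <= Rintegral (@lebesgue_measure R) setT (fun y => y ^+ 2 * edens c 0 d y)
      / Rintegral (@lebesgue_measure R) setT (edens c 0 d)] (edens c 0 d)
  / Rintegral (@lebesgue_measure R) setT (edens c 0 d).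
Proof.
have yC (y : R) : `|y ^+ 2| <= 1 * (1 + y ^+ 2).
  by rewrite mul1r ger0_norm ?sqr_ge0 // lerDr.
rewrite /prob_sqr_le_mean /law_expectation.
rewrite (integral_law g0 gi gpos); first last.
- by rewrite gE; exact: (integrable_growth2 0 c0 od d4 (@ctX R 2) yC).
- exact: (measurable_ct (@ctX R 2)).
by rewrite /= (law_of_densityE gi) /= ?gE //; exact: measurable_sqr_le.
Qed.

Lemma prob_sqr_le_mean_unit : 0 <= prob_sqr_le_mean (law_of_density g) <= 1.
Proof.
have [Pr PrE] := law_of_density_probability g0 gi gpos.
rewrite /prob_sqr_le_mean PrE; set A := [set x | _].
have mA : measurable A by exact: measurable_sqr_le.
have A1 : (Pr A <= 1)%E by exact: probability_le1.
have A0 : (0 <= Pr A)%E by exact: measure_ge0.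
have Af : Pr A \is a fin_num by rewrite ge0_fin_numE // (le_lt_trans A1) // ltry.
by rewrite -!lee_fin fineK // A0.
Qed.

Lemma mixture_limit : s = 0 -> q = 2%N -> (p < 5)%N ->
  potts_cvg_distr p beta h Y (infty_mixture (prob_sqr_le_mean (law_of_density g))).
Proof.
move=> s0 q2 p5.
apply: (@mixture_cvg R (fun N => config q N) (fun N => @potts R p q beta h N)).
- by move=> N; exact: (potts_dist p h (ltnW hq)).
- exact: prob_sqr_le_mean_unit.
move=> t; rewrite prob_sqr_le_meanE.
apply: (@estimator_cdf (fun N => K N ^+ 2)) => [N N0|].
  by rewrite exprn_gt0 // scale_gt0.
exact: (quadratic_limit hp hq hbeta hh hspecial od d4 lam0 hdrift hconvex).
Qed.

End limit_law.

Lemma real_limit (L1 : probability (measurableTypeR R) R) : field_coef p q s < 0 ->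
  (forall t, L1 `]-oo, t]%classic = (ecdf c d 0 (- emean c d (t * field_coef p q s)))%:E) ->
  potts_cvg_distr p beta h Y (pushforward L1 (@EFin R : measurableTypeR R -> \bar R)).
Proof.
move=> fc0 L1E.
apply: (@real_law_cvg R (fun N => config q N) (fun N => @potts R p q beta h N) _ _ _ _ L1E).
  by move=> N; exact: (potts_dist p h (ltnW hq)).
move=> t; apply: (@estimator_cdf K) => [N N0|]; first exact: scale_gt0.
exact: (linear_limit hp hq hbeta hh hspecial od d4 lam0 hdrift hconvex).
Qed.

End estimator.

(** * The limit laws *)

Section densities.
Context {R : realType}.
Variables (p q : nat) (beta h s : R).
Hypotheses (hp : (2 <= p)%N) (hq : (2 <= q)%N) (hbeta : 0 < beta).
Hypothesis hspecial : special p q beta h s.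
Local Notation q1 := (q%:R - 1 : R).
Local Notation mu := (@lebesgue_measure R).
Local Notation D4 := (F4 p q beta s).

(** The drift is [- theta b * quartic_lam * xi ^+ 3] to leading order. *)
Definition quartic_lam : R := - (q%:R ^+ 4 * D4 / (6 * q1)).
Local Notation c := (q1 * quartic_lam / 4%:R).

Let q1pos : 0 < q1. Proof. exact: lt_le_trans (@q1_ge1 R q hq). Qed.

Lemma field_coefE : p%:R * (\sum_(r < q) xvec q s 0 r ^+ (p - 1) * uvec q 0 r) = field_coef p q s.
Proof.
rewrite subn1 (@sum_ord_first R q hq _ (vtop q s ^+ p.-1 * - q1) (vbot q s ^+ p.-1)) => [|r].
  by rewrite /field_coef; ring.
by rewrite xvecE mxE; case: ifP => _; ring.
Qed.

Lemma T_densityE t : T_density p q beta h s t 0 = edens c (t * field_coef p q s) 4.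
Proof.
apply/funext => x; rewrite /T_density derive1n4_fline //; last exact: special_interior hspecial.
rewrite /edens -field_coefE; congr expR; rewrite /quartic_lam; field.
by rewrite gt_eqF.
Qed.

Lemma F0_densityE : (fun x : R => expR (- (32 / 15) * x ^+ 6)) = edens (1 * (64 / 5) / 6%:R) 0 6.
Proof. by apply/funext => x; rewrite /edens; congr expR; field. Qed.

Hypothesis F4neg : D4 < 0.

Lemma quartic_lam_gt0 : 0 < quartic_lam.
Proof.
rewrite oppr_gt0 pmulr_llt0 ?invr_gt0 ?mulr_gt0 // pmulr_rlt0 // exprn_gt0 //.
exact: q_gt0.
Qed.

Let c0 : 0 < c. Proof. by rewrite divr_gt0 // mulr_gt0 // quartic_lam_gt0. Qed.
Let od4 : ~~ odd 4. Proof. by []. Qed.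
Let ge4 : (4 <= 4)%N. Proof. by []. Qed.

Lemma law_expectation_T t :
  law_expectation (T_law p q beta h s t 0) (fun u => u) = emean c 4 (t * field_coef p q s).
Proof.
rewrite /law_expectation /T_law T_densityE (integral_law (edens_ge0 _ _ _)) //.
- exact: integrable_edens1.
- exact: Rintegral_edens_gt0.
have yC (y : R) : `|y| <= 1 * (1 + y ^+ 2) by rewrite mul1r abs_growth.
exact: (integrable_growth2 _ c0 od4 ge4 (@ct_id R) yC).
Qed.

Lemma law_cdf_T x : law_cdf (T_law p q beta h s 0 0) x = ecdf c 4 0 x.
Proof.
rewrite /law_cdf /T_law T_densityE mul0r (law_of_densityE (integrable_edens1 _ c0 od4 ge4)) //.
Qed.

End densities.

Theorem theorem3p7 (R : realType) (p q : nat) (hp : (2 <= p)%N) (hq : (2 <= q)%N)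
    (beta h s : R) (hbeta : 0 < beta) (hh : 0 <= h)
    (hspecial : special p q beta h s)
    (betahat : forall N : nat, config q N -> \bar R)
    (hmle : forall (N : nat) (X : config q N), (0 < N)%N ->
       is_mle p h X (betahat N X)) :
  (typeI_special p q beta h s ->
     ((p, q) \notin [:: (2, 2); (3, 2)]%N ->
        exists L1 : probability (measurableTypeR R) R,
          (forall t : R, L1 `]-oo, t]%classic =
             (law_cdf (T_law p q beta h s 0 0)
                (- law_expectation (T_law p q beta h s t 0) (fun u => u)))%:E) /\
          potts_cvg_distr p beta h (scaled_error (3 / 4) beta betahat)
            (pushforward L1 (@EFin R : measurableTypeR R -> \bar R)))
     /\
     ((p, q) \in [:: (2, 2); (3, 2)]%N ->
        potts_cvg_distr p beta h (scaled_error (3 / 4) beta betahat)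
          (infty_mixture (prob_sqr_le_mean (T_law p q beta h s 0 0)))))
  /\
  (typeII_special p q beta h s ->
     potts_cvg_distr p beta h (scaled_error (5 / 6) beta betahat)
       (infty_mixture (prob_sqr_le_mean (@F0_law R)))).
Proof.
have od4 : ~~ odd 4 by []. have ge4 : (4 <= 4)%N by [].
have od6 : ~~ odd 6 by []. have ge6 : (4 <= 6)%N by [].
have sint := special_interior hq hspecial; have q11 := @q1_ge1 R q hq.
split=> [[_]|[_]]; rewrite derive1n4_fline // => F4s.
  have l0 := quartic_lam_gt0 hq F4s.
  have hdrift : asym (drift p q beta h s) (- (theta p beta (vbot q s) * quartic_lam p q beta s)) 4.-1.
    by rewrite /quartic_lam mulrN opprK; exact: drift_typeI.
  split=> [pq|pq].
    have s0 : 0 < s.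
      rewrite lt_neqAle (special_s_ge0 hspecial) andbT eq_sym; apply: contra pq => /eqP s0.
      have q2 := special_centre hp hq hbeta hspecial s0.
      have := special_typeI_centre hp hq hbeta hspecial s0 F4s.
      by rewrite q2; case: (p) hp => [|[|[|[|]]]].
    have fc0 : field_coef p q s < 0.
      rewrite /field_coef pmulr_rlt0 ?(lt_le_trans ltr01) // pmulr_rlt0 ?ltr0n ?(ltnW hp) //.
      have [a0 b0] := interior_pos hq sint.
      rewrite subr_lt0 ltrXn2r ?nnegrE ?(ltW a0) ?(ltW b0) ?(vbot_lt hq s0) //.
      by case: (p) hp => [|[]].
    have c0 := stein_const_gt0 hq ge4 l0 : 0 < (q%:R - 1) * quartic_lam p q beta s / 4%:R.
    have [L1 L1E] := ecdf_emean_probability c0 od4 ge4 fc0.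
    exists L1; split=> [t|]; first by rewrite law_cdf_T // law_expectation_T.
    exact: (real_limit hp hq hbeta hh hspecial od4 ge4 l0 hmle hdrift fc0 L1E).
  have s0 := lowdegree_centre hp hq hbeta hspecial pq.
  have q2 := special_centre hp hq hbeta hspecial s0.
  have p5 : (p < 5)%N by move: pq; rewrite !inE !xpair_eqE => /orP[] /andP[/eqP -> _].
  have TE : T_density p q beta h s 0 0 = edens ((q%:R - 1) * quartic_lam p q beta s / 4%:R) 0 4.
    by rewrite T_densityE // mul0r.
  exact: (mixture_limit hp hq hbeta hh hspecial od4 ge4 l0 hmle hdrift TE s0 q2 p5).
have s0 := typeII_centre hp hq hbeta hspecial F4s.
have q2 := special_centre hp hq hbeta hspecial s0.
have p4 := special_typeII_centre hp hq hbeta hspecial s0 F4s.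
have p5 : (p < 5)%N by rewrite p4.
have l0 : 0 < 64 / 5 :> R by rewrite divr_gt0.
have hdrift : asym (drift p q beta h s) (- (theta p beta (vbot q s) * (64 / 5))) 6.-1.
  by rewrite -mulrN; exact: drift_typeII.
have FE : (fun x : R => expR (- (32 / 15) * x ^+ 6)) = edens ((q%:R - 1) * (64 / 5) / 6%:R) 0 6.
  have [q1E _] := special_centre_half hp hq hbeta hspecial s0.
  by rewrite F0_densityE q1E.
exact: (mixture_limit hp hq hbeta hh hspecial od6 ge6 l0 hmle hdrift FE s0 q2 p5).
Qed.
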